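(* Let $E_3\subset\mathbb{A}_3$ be a real three-dimensional linear subspace with $f(E_3)=\mathbb{C}$, and let $a,b,c\in E_3$ be nonzero vectors with $f(a)=1$, $f(b)=i$, $f(c)=0$. Let $\Omega\subset E_3$ be a domain whose intersections with lines in $E_3$ parallel to the line $\{\zeta\in E_3: f(\zeta)=0\}$ are connected. Let $\Phi:\Omega\to\mathbb{A}_3$ be a locally bounded function such that for every $\zeta\in\Omega$ there exists an element $\Phi'(\zeta)\in\mathbb{A}_3$ with $$\lim_{\delta\to 0+}\bigl(\Phi(\zeta+\delta h)-\Phi(\zeta)\bigr)\delta^{-1}=h\,\Phi'(\zeta)$$ for all $h\in\{\pm a,\pm b,\pm c\}$. Then the function $\Phi$ admits the representation $$\Phi(\zeta)=\frac{1}{2\pi i}\int_{\gamma}\bigl(F_0(t)+F_1(t)\rho+F_2(t)\rho^2\bigr)(t-\zeta)^{-1}\,dt,$$ where $F_0$, $F_1$ and $F_2$ are analytic functions in the domain $D=f(\Omega)$, and $\gamma$ is a closed rectifiable Jordan curve in $D=f(\Omega)\subset\mathbb{C}$ enclosing the point $f(\zeta)$.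
   Context: $\mathbb{A}_3$ is the three-dimensional commutative associative Banach algebra with identity $1$ over $\mathbb{C}$ with basis $\{1,\rho,\rho^2\}$, where $\rho^3=0$, and with the Euclidean norm $\|\alpha+\beta\rho+\kappa\rho^2\|=\sqrt{|\alpha|^2+|\beta|^2+|\kappa|^2}$, $\alpha,\beta,\kappa\in\mathbb{C}$. Complex numbers $t$ are identified with the elements $t\cdot 1\in\mathbb{A}_3$. The map $f:\mathbb{A}_3\to\mathbb{C}$ is the continuous multiplicative linear functional $f(\alpha+\beta\rho+\kappa\rho^2)=\alpha$. An element $t-\zeta$ is invertible in $\mathbb{A}_3$ exactly when $t\neq f(\zeta)$, and $(t-\zeta)^{-1}$ denotes the inverse in $\mathbb{A}_3$. The vectors of $E_3$ need not span $\mathbb{A}_3$ over $\mathbb{C}$. A domain in $E_3$ is a nonempty connected subset that is open in $E_3$; the empty set counts as connected. ''Locally bounded'' means that every point of $\Omega$ has a neighbourhood in $\Omega$ on which $\|\Phi\|$ is bounded.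
   Formalization: The curve γ is taken positively oriented and its interior is required to lie in D=f(Ω); without the latter the formula fails, e.g. for Φ(ζ)=ζ^{-1} over an annulus D with γ going around the hole. *)

(* Defs.v *)
From HB Require Import structures.
From mathcomp Require Import all_boot all_order all_algebra.
From mathcomp Require Import all_classical all_reals all_analysis.
From mathcomp Require Import complex.
From mathcomp Require Import ring.

Set Implicit Arguments.
Unset Strict Implicit.
Unset Printing Implicit Defensive.

Import Order.TTheory GRing.Theory Num.Theory.
Import numFieldNormedType.Exports.

Local Open Scope classical_set_scope.
Local Open Scope ring_scope.

(* The complex numbers R[i] as a normed space over themselves. *)
HB.instance Definition _ (R : realType) := NormedModule.copy R[i] R[i]^o.

(* [A3 K] is K[rho]/(rho^3); [MkA3 x y z] stands for x + y rho + z rho^2. *)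
Record A3 (K : Type) := MkA3 { coord0 : K; coord1 : K; coord2 : K }.

Definition A3_encode (K : Type) (u : A3 K) : K * K * K :=
  (coord0 u, coord1 u, coord2 u).
Definition A3_decode (K : Type) (t : K * K * K) : A3 K :=
  MkA3 t.1.1 t.1.2 t.2.
Lemma A3_encodeK (K : Type) : cancel (@A3_encode K) (@A3_decode K).
Proof. by case. Qed.

HB.instance Definition _ (K : choiceType) :=
  Choice.copy (A3 K) (can_type (@A3_encodeK K)).

Lemma A3P (K : Type) (u v : A3 K) :
  coord0 u = coord0 v -> coord1 u = coord1 v -> coord2 u = coord2 v -> u = v.
Proof. by case: u v => [a b c] [a' b' c'] /= -> -> ->. Qed.

Definition A3_zero (K : fieldType) : A3 K := MkA3 0 0 0.
Definition A3_one (K : fieldType) : A3 K := MkA3 1 0 0.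
Definition A3_opp (K : fieldType) (u : A3 K) :=
  MkA3 (- coord0 u) (- coord1 u) (- coord2 u).
Definition A3_add (K : fieldType) (u v : A3 K) :=
  MkA3 (coord0 u + coord0 v) (coord1 u + coord1 v) (coord2 u + coord2 v).
Definition A3_scale (K : fieldType) (k : K) (u : A3 K) :=
  MkA3 (k * coord0 u) (k * coord1 u) (k * coord2 u).
Definition A3_mul (K : fieldType) (u v : A3 K) :=
  MkA3 (coord0 u * coord0 v)
       (coord0 u * coord1 v + coord1 u * coord0 v)
       (coord0 u * coord2 v + coord1 u * coord1 v + coord2 u * coord0 v).
Definition A3_unit (K : fieldType) : pred (A3 K) := fun u => coord0 u != 0.
(* On non-invertible elements the inverse is, by convention, the identity. *)
Definition A3_inv (K : fieldType) (u : A3 K) :=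
  if A3_unit u then
    MkA3 (coord0 u)^-1
         (- coord1 u / coord0 u ^+ 2)
         ((coord1 u ^+ 2 - coord0 u * coord2 u) / coord0 u ^+ 3)
  else u.

Lemma A3_addA (K : fieldType) : associative (@A3_add K).
Proof. by move=> u v w; apply: A3P => /=; rewrite addrA. Qed.
Lemma A3_addC (K : fieldType) : commutative (@A3_add K).
Proof. by move=> u v; apply: A3P => /=; rewrite addrC. Qed.
Lemma A3_add0 (K : fieldType) : left_id (A3_zero K) (@A3_add K).
Proof. by move=> u; apply: A3P => /=; rewrite add0r. Qed.
Lemma A3_addN (K : fieldType) :
  left_inverse (A3_zero K) (@A3_opp K) (@A3_add K).
Proof. by move=> u; apply: A3P => /=; rewrite addNr. Qed.

HB.instance Definition _ (K : fieldType) := GRing.isZmodule.Build (A3 K)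
  (@A3_addA K) (@A3_addC K) (@A3_add0 K) (@A3_addN K).

Lemma A3_mulA (K : fieldType) : associative (@A3_mul K).
Proof. by move=> u v w; apply: A3P => /=; ring. Qed.
Lemma A3_mulC (K : fieldType) : commutative (@A3_mul K).
Proof. by move=> u v; apply: A3P => /=; ring. Qed.
Lemma A3_mul1 (K : fieldType) : left_id (A3_one K) (@A3_mul K).
Proof. by move=> u; apply: A3P => /=; ring. Qed.
Lemma A3_mulDl (K : fieldType) : left_distributive (@A3_mul K) +%R.
Proof. by move=> u v w; apply: A3P => /=; ring. Qed.
Lemma A3_one_neq0 (K : fieldType) : A3_one K != 0.
Proof.
by apply/eqP => /(congr1 (@coord0 K)) /= e; have := oner_neq0 K; rewrite e eqxx.
Qed.

HB.instance Definition _ (K : fieldType) :=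
  GRing.Zmodule_isComNzRing.Build (A3 K) (@A3_mulA K) (@A3_mulC K)
    (@A3_mul1 K) (@A3_mulDl K) (@A3_one_neq0 K).

Lemma A3_scaleA (K : fieldType) (a b : K) (u : A3 K) :
  A3_scale a (A3_scale b u) = A3_scale (a * b) u.
Proof. by apply: A3P => /=; rewrite mulrA. Qed.
Lemma A3_scale1 (K : fieldType) : left_id 1 (@A3_scale K).
Proof. by move=> u; apply: A3P => /=; rewrite mul1r. Qed.
Lemma A3_scaleDr (K : fieldType) : right_distributive (@A3_scale K) +%R.
Proof. by move=> k u v; apply: A3P => /=; rewrite mulrDr. Qed.
Lemma A3_scaleDl (K : fieldType) (u : A3 K) :
  {morph (@A3_scale K)^~ u : a b / a + b}.
Proof. by move=> a b; apply: A3P => /=; rewrite mulrDl. Qed.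

HB.instance Definition _ (K : fieldType) :=
  GRing.Zmodule_isLmodule.Build K (A3 K) (@A3_scaleA K) (@A3_scale1 K)
    (@A3_scaleDr K) (@A3_scaleDl K).

Lemma A3_scaleAl (K : fieldType) (k : K) (u v : A3 K) :
  k *: (u * v) = k *: u * v.
Proof. by apply: A3P => /=; ring. Qed.

HB.instance Definition _ (K : fieldType) :=
  GRing.Lmodule_isLalgebra.Build K (A3 K) (@A3_scaleAl K).
HB.instance Definition _ (K : fieldType) :=
  GRing.Lalgebra_isComAlgebra.Build K (A3 K).

Lemma A3_mulV (K : fieldType) :
  {in @A3_unit K, left_inverse 1 (@A3_inv K) *%R}.
Proof.
move=> u hu; rewrite /A3_inv; rewrite -topredE /= in hu; rewrite hu.
by apply: A3P => /=; field; exact: hu.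
Qed.
Lemma A3_unitP (K : fieldType) (u v : A3 K) : v * u = 1 -> A3_unit u.
Proof.
move=> /(congr1 (@coord0 K)) /= e; apply/eqP => u0.
by have := oner_neq0 K; rewrite -[1]e u0 mulr0 eqxx.
Qed.
Lemma A3_inv_out (K : fieldType) : {in [predC @A3_unit K], @A3_inv K =1 id}.
Proof. by move=> u; rewrite inE -topredE /= /A3_inv => /negbTE ->. Qed.

HB.instance Definition _ (K : fieldType) :=
  GRing.ComNzRing_hasMulInverse.Build (A3 K)
    (@A3_mulV K) (@A3_unitP K) (@A3_inv_out K).

Definition rho (K : fieldType) : A3 K := MkA3 0 1 0.

Lemma A3_basisE (K : fieldType) (u : A3 K) :
  u = (coord0 u)%:A + coord1 u *: rho K + coord2 u *: rho K ^+ 2.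
Proof. by apply: A3P => /=; ring. Qed.

Lemma rho3 (K : fieldType) : rho K ^+ 3 = 0.
Proof. by apply: A3P => /=; ring. Qed.

(* The Euclidean norm.  It takes values in K, like the modulus of K = R[i];
   its values are nonnegative reals. *)
Definition A3_norm (K : numClosedFieldType) (u : A3 K) : K :=
  sqrtC (`|coord0 u| ^+ 2 + `|coord1 u| ^+ 2 + `|coord2 u| ^+ 2).

Lemma A3_norm_ge0 (K : numClosedFieldType) (u : A3 K) : 0 <= A3_norm u.
Proof. by rewrite sqrtC_ge0 !addr_ge0 ?exprn_ge0. Qed.

Lemma A3_normZ (K : numClosedFieldType) (k : K) (u : A3 K) :
  A3_norm (k *: u) = `|k| * A3_norm u.
Proof.
rewrite /A3_norm /= !normrM !exprMn -!mulrDr rootCMl ?exprn_ge0//.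
by rewrite sqrCK.
Qed.

Lemma A3_norm_eq0 (K : numClosedFieldType) (u : A3 K) : A3_norm u = 0 -> u = 0.
Proof.
move/eqP; rewrite sqrtC_eq0 !paddr_eq0 ?addr_ge0 ?exprn_ge0//.
rewrite !expf_eq0 !normr_eq0 /= => /andP[/andP[/eqP h0 /eqP h1] /eqP h2].
exact: A3P.
Qed.

Lemma A3_normD (K : numClosedFieldType) (u v : A3 K) :
  A3_norm (u + v) <= A3_norm u + A3_norm v.
Proof.
rewrite -(@ler_pXn2r _ 2) ?nnegrE ?addr_ge0 ?A3_norm_ge0//.
rewrite sqrrD !sqrtCK /=.
set x0 := `|coord0 u|; set x1 := `|coord1 u|; set x2 := `|coord2 u|.
set y0 := `|coord0 v|; set y1 := `|coord1 v|; set y2 := `|coord2 v|.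
have [px0 px1 px2] : [/\ 0 <= x0, 0 <= x1 & 0 <= x2] by split; exact: normr_ge0.
have [py0 py1 py2] : [/\ 0 <= y0, 0 <= y1 & 0 <= y2] by split; exact: normr_ge0.
have CS : x0 * y0 + x1 * y1 + x2 * y2 <= A3_norm u * A3_norm v.
  rewrite -(@ler_pXn2r _ 2) ?nnegrE ?mulr_ge0 ?A3_norm_ge0//; last first.
    by rewrite !addr_ge0 ?mulr_ge0.
  rewrite exprMn !sqrtCK -/x0 -/x1 -/x2 -/y0 -/y1 -/y2 -subr_ge0.
  have -> : (x0 ^+ 2 + x1 ^+ 2 + x2 ^+ 2) * (y0 ^+ 2 + y1 ^+ 2 + y2 ^+ 2)
      - (x0 * y0 + x1 * y1 + x2 * y2) ^+ 2
    = (x0 * y1 - x1 * y0) ^+ 2 + (x0 * y2 - x2 * y0) ^+ 2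
      + (x1 * y2 - x2 * y1) ^+ 2 by ring.
  have sqr_real (a b c d : K) : 0 <= a -> 0 <= b -> 0 <= c -> 0 <= d ->
      0 <= (a * b - c * d) ^+ 2.
    by move=> *; rewrite real_exprn_even_ge0// rpredB ?rpredM ?ger0_real.
  by rewrite !addr_ge0 ?sqr_real.
apply: (@le_trans _ _ ((x0 + y0) ^+ 2 + (x1 + y1) ^+ 2 + (x2 + y2) ^+ 2)).
  by rewrite !lerD// ler_pXn2r ?nnegrE ?addr_ge0 ?ler_normD.
rewrite -subr_ge0.
have -> : x0 ^+ 2 + x1 ^+ 2 + x2 ^+ 2 + A3_norm u * A3_norm v *+ 2
      + (y0 ^+ 2 + y1 ^+ 2 + y2 ^+ 2)
      - ((x0 + y0) ^+ 2 + (x1 + y1) ^+ 2 + (x2 + y2) ^+ 2)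
   = (A3_norm u * A3_norm v - (x0 * y0 + x1 * y1 + x2 * y2)) *+ 2 by ring.
by rewrite mulrn_wge0// subr_ge0.
Qed.

(* The topology of [A3 K] is the one of the Euclidean norm. *)
HB.instance Definition _ (K : numClosedFieldType) :=
  Lmodule_isNormed.Build K (A3 K)
    (@A3_normD K) (@A3_normZ K) (@A3_norm_eq0 K).

(* The multiplicative functional f. *)
Definition ff (K : Type) (u : A3 K) : K := coord0 u.

Local Open Scope complex_scope.

(* [E] is a real linear subspace of dimension [n]: it is the set of real
   linear combinations of [n] vectors linearly independent over R. *)
Definition real_subspace (R : realType) (n : nat) (E : set (A3 R[i])) : Prop :=
  exists e : 'I_n -> A3 R[i],
    (forall x : 'I_n -> R, \sum_i (x i)%:C *: e i = 0 -> forall i, x i = 0) /\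
    E = [set \sum_i (x i)%:C *: e i | x in [set: 'I_n -> R]].

Definition domain_in (T : topologicalType) (E Omega : set T) : Prop :=
  [/\ Omega !=set0, connected Omega
    & exists2 U, open U & Omega = E `&` U].

(* The line through [z] parallel to {w in E | f w = 0}. *)
Definition fiber_line (R : realType) (E : set (A3 R[i])) (z : A3 R[i]) :
    set (A3 R[i]) :=
  [set z + w | w in [set w | E w /\ ff w = 0]].

(* Analytic = complex differentiable at each point; used for open [D]. *)
Definition analytic_on (R : realType) (D : set R[i]) (F : R[i] -> R[i]) : Prop :=
  forall z, D z -> derivable F z 1.

(* Curves are parametrized by [0, 1]; values outside [0, 1] are irrelevant. *)
Definition curve_image (R : realType) (g : R -> R[i]) : set R[i] :=
  g @` `[0, 1].

Definition rectifiable (R : realType) (g : R -> R[i]) : Prop :=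
  exists L : R, forall s : seq R, itv_partition 0 1 s ->
    let x := nth 1 (0 :: s) in
    \sum_(0 <= n < size s) `|g (x n.+1) - g (x n)| <= L%:C.

Definition closed_rectifiable_jordan (R : realType) (g : R -> R[i]) : Prop :=
  [/\ {within `[0, 1], continuous g}, g 0 = g 1,
      {in `[0, 1[ &, injective g} & rectifiable g].

(* int_g G(t) dt = I, as the limit of the sums
   sum_n (g x_(n+1) - g x_n) G(g tau_n), x_n <= tau_n <= x_(n+1),
   when the mesh of the partition (x_n) of [0, 1] tends to 0. *)
Definition has_curve_integral (R : realType) (V : normedModType R[i])
    (g : R -> R[i]) (G : R[i] -> V) (I : V) : Prop :=
  forall eps : R, 0 < eps -> exists2 delta : R, 0 < delta &
    forall (s : seq R) (tau : nat -> R), itv_partition 0 1 s ->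
    let x := nth 1 (0 :: s) in
    (forall n, (n < size s)%N ->
       x n.+1 - x n < delta /\ x n <= tau n <= x n.+1) ->
    `|\sum_(0 <= n < size s) (g (x n.+1) - g (x n)) *: G (g (tau n)) - I|
      < eps%:C.

Definition two_pi_i (R : realType) : R[i] := (2 * pi)%:C * 'i.

(* [g] encloses [z]: [z] is off the curve and its component in the complement
   of the curve is bounded. *)
Definition encloses (R : realType) (g : R -> R[i]) (z : R[i]) : Prop :=
  ~ curve_image g z /\ bounded_set (connected_component (~` curve_image g) z).

(* Winding number 1 around each enclosed point. *)
Definition positively_oriented (R : realType) (g : R -> R[i]) : Prop :=
  forall z, encloses g z ->
    has_curve_integral g (fun t : R[i] => (t - z)^-1 : R[i]) (two_pi_i R).

(* Main.v *)
Require Import Defs.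
From HB Require Import structures.
From mathcomp Require Import all_boot all_order all_algebra.
From mathcomp Require Import all_classical all_reals all_analysis.
From mathcomp Require Import complex.
From mathcomp Require Import ring lra.

Set Implicit Arguments.
Unset Strict Implicit.
Unset Printing Implicit Defensive.

Import Order.TTheory GRing.Theory Num.Theory.
Import numFieldNormedType.Exports.
Import Defs.

Local Open Scope classical_set_scope.
Local Open Scope ring_scope.
Local Open Scope complex_scope.

(** Write the coordinates of [Phi] as Phi_0, Phi_1, Phi_2.  Since [c] lies in
    the kernel of [ff], the coordinate Phi_0 has at each point derivatives p,
    i p and 0 along [a], [b] and [c], for some complex p.  It is therefore
    constant on the fibres of [ff], which meet the domain in connected sets, and
    comes from a function F0 on the projection whose partial derivatives exist
    and satisfy the Cauchy-Riemann equations.  All that is known of the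
    continuity of F0 is that it is locally bounded; that it is holomorphic is
    Tolstov's theorem ([tolstov]).  The principal extension of F0, that is, the
    Taylor polynomial of F0 at [ff z] evaluated at the nilpotent part of [z],
    has the same differentiability property as [Phi]; subtracting it leaves a
    function with values in the ideal generated by [rho], whose next coordinate
    again comes from the projection.  After three rounds
    ([monogenic_structure]) [Phi] is the sum of the principal extensions of F0,
    of F1 multiplied by [rho], and of F2 multiplied by the square of [rho].
    Expanding the kernel in powers of [rho], the representation becomes Cauchy's
    integral formula for the functions F_k and their first two derivatives
    ([cauchy_formula], [cauchy_formula1], [cauchy_formula2]).

    Tolstov's theorem follows from a Poincare lemma for a real form P dx + Q dy
    with bounded, separately differentiable coefficients and P_y = Q_x
    ([potential]).  If p and q are primitives of P in x and of Q in y, the mixed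
    difference of q - p over a rectangle is the integral of the form along its
    boundary, and it has to vanish.  Suppose that it exceeds eps times the area
    for some rectangles, and call wild the points at which such rectangles
    accumulate.  Differentiability covers the plane by countably many closed
    sets on each of which P and Q differ by little from the coefficients of one
    closed affine form, along horizontal and vertical segments of a fixed
    length.  By Baire's argument one of these sets contains all the wild points
    of some wild rectangle; but then no rectangle inside it is wild
    ([cross_tame]).  A function with Cauchy-Riemann partial derivatives thus has
    a primitive, and this primitive has a continuously differentiable one; it
    remains to know that derivatives of holomorphic functions are holomorphic.

    This, with the local theory of holomorphic functions, comes from Cauchy's
    estimate ([cauchy_estimate]), which the same Poincare lemma gives in
    logarithmic coordinates.  Cauchy's formula for a closed rectifiable curve
    whose inside lies in the domain is obtained by Dixon's method: the integral
    of a divided difference along the curve extends to an entire function that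
    tends to 0 at infinity.  Integrals of holomorphic functions along a curve
    are constructed by following local primitives ([holomorphic_integral]). *)


(** * Rectangles and wild points *)

Record rect (R : Type) := Rect { xl : R; xr : R; yl : R; yr : R }.

Section Rectangles.
Variable R : realType.
Implicit Types A S : rect R.

Definition wf A := xl A <= xr A /\ yl A <= yr A.
Definition inrect A x y := xl A <= x <= xr A /\ yl A <= y <= yr A.
Definition subrect A S :=
  (xl A <= xl S /\ xl S <= xr S /\ xr S <= xr A) /\
  (yl A <= yl S /\ yl S <= yr S /\ yr S <= yr A).
Definition width A := xr A - xl A.
Definition height A := yr A - yl A.
Definition area A := width A * height A.

Lemma subrect_wf A S : subrect A S -> wf S.
Proof. by rewrite /subrect /wf; lra. Qed.

Lemma subrect_refl A : wf A -> subrect A A.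
Proof. by rewrite /subrect /wf; lra. Qed.

Lemma subrect_trans A B S : subrect A B -> subrect B S -> subrect A S.
Proof. by rewrite /subrect; lra. Qed.

Lemma inrect_sub A S x y : subrect A S -> inrect S x y -> inrect A x y.
Proof. by rewrite /subrect /inrect; lra. Qed.

Lemma nested_rects (S : nat -> rect R) :
  wf (S 0%N) -> (forall n, subrect (S n) (S n.+1)) ->
  exists x y, forall n, inrect (S n) x y.
Proof.
move=> w0 hs.
have mono (n m : nat) : (n <= m)%N -> subrect (S n) (S m).
  elim: m => [|m IH]; first by rewrite leqn0 => /eqP ->; exact: subrect_refl.
  rewrite leq_eqVlt => /orP[/eqP ->|]; last first.
    by rewrite ltnS => /IH h; exact: subrect_trans h (hs m).
  by apply: subrect_refl; exact: subrect_wf (hs m).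
have cmp n m : xl (S n) <= xr (S m) /\ yl (S n) <= yr (S m).
  case: (leqP n m) => [/mono|/ltnW/mono]; rewrite /subrect; lra.
pose X : set R := [set xl (S n) | n in setT].
pose Y : set R := [set yl (S n) | n in setT].
have ubX n : ubound X (xr (S n)) by move=> _ [m _ <-]; have [] := cmp m n.
have ubY n : ubound Y (yr (S n)) by move=> _ [m _ <-]; have [] := cmp m n.
have inX n : X (xl (S n)) by exists n.
have inY n : Y (yl (S n)) by exists n.
exists (sup X), (sup Y) => n; split; apply/andP; split.
- by apply: ub_le_sup => //; exists (xr (S 0%N)).
- by apply: ge_sup => //; exists (xl (S 0%N)).
- by apply: ub_le_sup => //; exists (yr (S 0%N)).
- by apply: ge_sup => //; exists (yl (S 0%N)).
Qed.

Lemma halving_lt (a d : R) : 0 < d -> exists n : nat, a / 2 ^+ n < d.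
Proof.
move=> d0; exists (Num.bound (`|a| / d)).
rewrite ltr_pdivrMr ?exprn_gt0//.
have /upper_nthrootP h : (Num.bound (`|a| / d) <= Num.bound (`|a| / d))%N by [].
by have := h; rewrite ltr_pdivrMr// mulrC; apply: le_lt_trans; exact: ler_norm.
Qed.

Variables (T : R -> R -> R) (eps : R).

Definition mixdiff A :=
  T (xr A) (yr A) - T (xr A) (yl A) - T (xl A) (yr A) + T (xl A) (yl A).

(** The failure to control mixed differences by areas is localized at points, so
    that a Baire argument can be applied to it. *)
Definition wild A := wf A /\ eps * area A < `|mixdiff A|.

Definition wildpt A x y := inrect A x y /\
  forall d, 0 < d -> exists S,
    [/\ subrect A S, wild S &
        (x - d < xl S /\ xr S < x + d) /\ (y - d < yl S /\ yr S < y + d)].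

Lemma wildpt_sub A S x y : subrect A S -> wildpt S x y -> wildpt A x y.
Proof.
move=> AS [xy h]; split; first exact: inrect_sub AS xy.
move=> d /h[Q [SQ wQ Qd]]; exists Q; split=> //; exact: subrect_trans AS SQ.
Qed.

(** Mixed differences and areas are both additive. *)
Lemma wild_quarter A : wild A -> exists S,
  [/\ subrect A S, wild S, width S = width A / 2 & height S = height A / 2].
Proof.
move=> [[wx wy] h].
pose xm := (xl A + xr A) / 2; pose ym := (yl A + yr A) / 2.
pose S1 := Rect (xl A) xm (yl A) ym; pose S2 := Rect xm (xr A) (yl A) ym.
pose S3 := Rect (xl A) xm ym (yr A); pose S4 := Rect xm (xr A) ym (yr A).
pose Q S := [\/ S = S1, S = S2, S = S3 | S = S4].
have sub S : Q S ->
    [/\ subrect A S, area S = area A / 4, width S = width A / 2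
      & height S = height A / 2].
  by case=> ->; split; rewrite /subrect /area /width /height /= /xm /ym;
    (lra || field).
case: (pselect (exists2 S, Q S & wild S)).
  by move=> [S Sin wS]; exists S; have [] := sub S Sin.
move=> hn; exfalso.
have small S : Q S -> `|mixdiff S| <= eps * (area A / 4).
  move=> Sin; have [sS aS _ _] := sub S Sin; rewrite leNgt; apply/negP => w.
  by apply: hn; exists S => //; split; rewrite ?aS//; exact: subrect_wf sS.
have e : mixdiff A = mixdiff S1 + mixdiff S2 + mixdiff S3 + mixdiff S4.
  by rewrite /mixdiff /=; ring.
have := ler_normD (mixdiff S1 + mixdiff S2 + mixdiff S3) (mixdiff S4).
have := ler_normD (mixdiff S1 + mixdiff S2) (mixdiff S3).
have := ler_normD (mixdiff S1) (mixdiff S2).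
have s1 := small S1 (Or41 _ _ _ erefl); have s2 := small S2 (Or42 _ _ _ erefl).
have s3 := small S3 (Or43 _ _ _ erefl); have s4 := small S4 (Or44 _ _ _ erefl).
move: h; rewrite e; lra.
Qed.

(** Repeated quartering of a wild rectangle closes in on a wild point. *)
Lemma wild_has_wildpt A : wild A -> exists x y, wildpt A x y.
Proof.
move=> wA.
pose X := {S | wild S}.
pose rel (S S' : X) := [/\ subrect (sval S) (sval S'),
   width (sval S') = width (sval S) / 2 & height (sval S') = height (sval S) / 2].
have step (S : X) : {S' : X | rel S S'}.
  case: S => S wS; apply: cid.
  by have [S' [h1 h2 h3 h4]] := wild_quarter wS; exists (exist _ S' h2).
have [f [f0 hf]] := dependent_choice step (exist _ A wA).
have dim n : width (sval (f n)) = width A / 2 ^+ n /\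
             height (sval (f n)) = height A / 2 ^+ n.
  elim: n => [|n [IH1 IH2]]; first by rewrite f0 /= expr0 !divr1.
  have [_ -> ->] := hf n.
  rewrite IH1 IH2 !exprS !invfM; split; ring.
have sub n : subrect A (sval (f n)).
  elim: n => [|n IH]; first by rewrite f0; exact: subrect_refl wA.1.
  by apply: subrect_trans IH _; have [] := hf n.
have [||x [y xy]] := @nested_rects (fun n => sval (f n)).
- by rewrite f0; exact: wA.1.
- by move=> n; have [] := hf n.
exists x, y; split; first exact: inrect_sub (sub 0%N) (xy 0%N).
move=> d d0.
have [n hn] := halving_lt (Num.max (width A) (height A)) d0.
exists (sval (f n)); split; [exact: sub|exact: (svalP (f n))|].
have [dw dh] := dim n.
have lw : width (sval (f n)) < d.
  rewrite dw; apply: le_lt_trans hn.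
  by rewrite ler_pM2r ?invr_gt0 ?exprn_gt0// le_max lexx.
have lh : height (sval (f n)) < d.
  rewrite dh; apply: le_lt_trans hn.
  by rewrite ler_pM2r ?invr_gt0 ?exprn_gt0// le_max lexx orbT.
by have := xy n; move: lw lh; rewrite /inrect /width /height; lra.
Qed.

Lemma wild_shrink A d : wild A -> 0 < d ->
  exists S, [/\ subrect A S, wild S, width S < d & height S < d].
Proof.
move=> /wild_has_wildpt[x [y [_ h]]] d0.
have [|S [sS wS bS]] := h (d / 2); first by rewrite divr_gt0.
by exists S; split=> //; move: bS; rewrite /width /height; lra.
Qed.

End Rectangles.

(** * A Poincare lemma for bounded, separately differentiable forms *)

Section MeanValue.
Variable R : realType.

Lemma is_derive_continuous (f : R -> R) (x d : R) :
  is_derive x 1 f d -> {for x, continuous f}.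
Proof.
by move=> h; apply: differentiable_continuous; apply/derivable1_diffP; case: h.
Qed.

Lemma derive_within_continuous (f df : R -> R) (s t : R) :
  (forall x, s <= x <= t -> is_derive x 1 f (df x)) ->
  {within `[s, t], continuous f}.
Proof.
move=> h; apply: continuous_in_subspaceT => x /[!inE] /=.
by rewrite in_itv /= => /h; exact: is_derive_continuous.
Qed.

Lemma mean_value_le (f df : R -> R) (s t M : R) : s <= t ->
  (forall x, s <= x <= t -> is_derive x 1 f (df x)) ->
  (forall x, s <= x <= t -> `|df x| <= M) ->
  `|f t - f s| <= M * (t - s).
Proof.
move=> st hd hM.
have [|c + ->] := @MVT_segment _ f df s t st _ (derive_within_continuous hd).
  by move=> x /itvP hx; apply: hd; rewrite !hx.
rewrite in_itv /= => hc.
by rewrite normrM (ger0_norm (x := t - s)) ?subr_ge0// ler_wpM2r ?subr_ge0// hM.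
Qed.

End MeanValue.

Section Tame.
Variable R : realType.
Implicit Types (A S : rect R) (u P Q p q : R -> R -> R).

(** Along the two axis-parallel lines through the point, up to the distance [d],
    [u] stays within [e] of an affine function of slopes [a] and [b]. *)
Definition cross u A (a b e d x y : R) :=
  (forall x', `|x' - x| < d -> inrect A x' y ->
     `|u x' y - u x y - a * (x' - x)| <= e * `|x' - x|) /\
  (forall y', `|y' - y| < d -> inrect A x y' ->
     `|u x y' - u x y - b * (y' - y)| <= e * `|y' - y|).

Lemma cross_swap u A a b e d x y : cross u A a b e d x y ->
  cross (fun s t => u t s) (Rect (yl A) (yr A) (xl A) (xr A)) b a e d y x.
Proof.
by move=> [h1 h2]; split => z zd [i1 i2]; [apply: h2|apply: h1].
Qed.

(** Two points of the cross condition, one on the lower and one on the upper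
    side, compare the values of [P] on these sides up to the slope [b]; the mean
    value theorem turns this into a bound for the difference of the increments
    of its primitive [p]. *)
Lemma strip_bound p P A S (a b e d D xb xt : R) : 0 <= e ->
  subrect A S -> width S <= D -> height S <= D -> D < d ->
  (forall x y, inrect A x y -> is_derive x 1 (p^~ y) (P x y)) ->
  inrect S xb (yl S) -> inrect S xt (yr S) ->
  cross P A a b e d xb (yl S) -> cross P A a b e d xt (yr S) ->
  `|p (xr S) (yl S) - p (xl S) (yl S) - p (xr S) (yr S) + p (xl S) (yr S)
    - b * (yl S - yr S) * (xr S - xl S)| <= 4 * e * D ^+ 2.
Proof.
move=> e0 AS wD hD Dd dp ib it [cb1 cb2] [ct1 ct2].
pose f x := p x (yl S) - p x (yr S) - b * (yl S - yr S) * x.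
pose df x := P x (yl S) - P x (yr S) - b * (yl S - yr S).
have inA x y : inrect S x y -> inrect A x y by exact: inrect_sub.
have bnd x : xl S <= x <= xr S -> `|df x| <= 4 * e * D.
  move=> hx; move: wD hD ib it AS; rewrite /width /height => wD hD ib it AS.
  have le0 (h : R) : `|h| <= D -> e * `|h| <= e * D.
    by move=> ?; rewrite ler_wpM2l.
  have dx : `|x - xb| <= D by move: ib; rewrite /inrect ler_norml; lra.
  have dx' : `|x - xt| <= D by move: it; rewrite /inrect ler_norml; lra.
  have dxx : `|xb - xt| <= D by move: it ib; rewrite /inrect ler_norml; lra.
  have dy : `|yr S - yl S| <= D by move: AS; rewrite /subrect ler_norml; lra.
  have i1 : inrect S x (yl S) by move: AS; rewrite /subrect /inrect; lra.
  have i2 : inrect S x (yr S) by move: AS; rewrite /subrect /inrect; lra.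
  have i3 : inrect S xb (yr S).
    by move: AS ib; rewrite /subrect /inrect; lra.
  have h1 := cb1 x (le_lt_trans dx Dd) (inA _ _ i1).
  have h2 := cb2 (yr S) (le_lt_trans dy Dd) (inA _ _ i3).
  have h3 := ct1 xb (le_lt_trans dxx Dd) (inA _ _ i3).
  have h4 := ct1 x (le_lt_trans dx' Dd) (inA _ _ i2).
  move: h1 h2 h3 h4 (le0 _ dx) (le0 _ dx') (le0 _ dxx) (le0 _ dy).
  rewrite /df !ler_norml; lra.
have dfd x : xl S <= x <= xr S -> is_derive x 1 f (df x).
  move=> hx.
  have i1 : inrect S x (yl S) by move: AS; rewrite /subrect /inrect; lra.
  have i2 : inrect S x (yr S) by move: AS; rewrite /subrect /inrect; lra.
  have d1 := dp _ _ (inA _ _ i1); have d2 := dp _ _ (inA _ _ i2).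
  have -> : f = (p^~ (yl S)) - (p^~ (yr S)) - (b * (yl S - yr S)) *: id.
    by apply/funext => z; rewrite /f !fctE.
  apply: is_derive_eq; rewrite /df; congr (_ - _ - _).
  by rewrite /GRing.scale /= mulr1.
have xx : xl S <= xr S by move: AS; rewrite /subrect; lra.
have := mean_value_le xx dfd bnd.
have -> : f (xr S) - f (xl S) =
  p (xr S) (yl S) - p (xl S) (yl S) - p (xr S) (yr S) + p (xl S) (yr S)
    - b * (yl S - yr S) * (xr S - xl S) by rewrite /f; ring.
move/le_trans; apply.
have D0 : 0 <= D by apply: le_trans wD; rewrite subr_ge0.
by rewrite expr2 mulrA ler_wpM2l// !mulr_ge0.
Qed.

(** The contributions of the slope [b], which is common to [P] and [Q], cancel:
    this is where the equality of the cross derivatives enters. *)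
Lemma box_bound p P q Q A S (a b c e d D xb xt yL yR : R) : 0 <= e ->
  subrect A S -> width S <= D -> height S <= D -> D < d ->
  (forall x y, inrect A x y -> is_derive x 1 (p^~ y) (P x y)) ->
  (forall x y, inrect A x y -> is_derive y 1 (q x) (Q x y)) ->
  inrect S xb (yl S) -> inrect S xt (yr S) ->
  inrect S (xl S) yL -> inrect S (xr S) yR ->
  cross P A a b e d xb (yl S) -> cross P A a b e d xt (yr S) ->
  cross Q A b c e d (xl S) yL -> cross Q A b c e d (xr S) yR ->
  `|mixdiff (fun x y => q x y - p x y) S| <= 8 * e * D ^+ 2.
Proof.
move=> e0 AS wD hD Dd dp dq ib it iL iR cb ct cL cR.
have hp := strip_bound e0 AS wD hD Dd dp ib it cb ct.
pose sw (B : rect R) := Rect (yl B) (yr B) (xl B) (xr B).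
have hq := @strip_bound (fun s t => q t s) (fun s t => Q t s)
   (sw A) (sw S) c b e d D yL yR e0 _ hD wD Dd _ _ _
   (cross_swap cL) (cross_swap cR).
have {}hq : `|q (xl S) (yr S) - q (xl S) (yl S) - q (xr S) (yr S)
   + q (xr S) (yl S) - b * (xl S - xr S) * (yr S - yl S)| <= 4 * e * D ^+ 2.
  apply: hq; rewrite /sw.
  - by move: AS; rewrite /subrect /=; lra.
  - by move=> x y xy; apply: dq; move: xy; rewrite /inrect /=; lra.
  - by move: iL; rewrite /inrect /=; lra.
  - by move: iR; rewrite /inrect /=; lra.
by move: hp hq; rewrite /mixdiff !ler_norml; lra.
Qed.

Section Limits.

Lemma continuous_le0 (f : R -> R) (t : R) : {for t, continuous f} ->
  (forall d, 0 < d -> exists2 x, `|x - t| < d & f x <= 0) -> f t <= 0.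
Proof.
move=> cf h; rewrite leNgt; apply/negP => ft.
have /cvgrPdist_lt /(_ _ ft) [d /= d0 hd] := cf.
have [x xd fx] := h d d0.
have := hd x; rewrite /ball_ /= distrC => /(_ xd).
by rewrite ltr_norml; lra.
Qed.

Variables (T : R -> R -> R) (eps : R).
Variable A : rect R.
Hypothesis Tx : forall x y, inrect A x y -> {for x, continuous (T^~ y)}.
Hypothesis Ty : forall x y, inrect A x y -> {for y, continuous (T x)}.

Notation wp := (wildpt T eps A).
Notation md := (mixdiff T).

(** Contrapositive of [wild_has_wildpt]. *)
Lemma no_wildpt_tame S : subrect A S ->
  (forall x y, wp x y -> ~ inrect S x y) -> `|md S| <= eps * area S.
Proof.
move=> AS h; rewrite leNgt; apply/negP => w.
have wS : wild T eps S by split=> //; exact: subrect_wf AS.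
have [x [y xy]] := wild_has_wildpt wS.
by apply: (h x y); [exact: wildpt_sub AS xy|case: xy].
Qed.

Let cont_tame (S : R -> rect R) (t : R) :
  {for t, continuous (fun s => md (S s))} ->
  (exists k l, forall s, area (S s) = k * s + l) ->
  (forall d, 0 < d -> exists s, [/\ `|s - t| < d, subrect A (S s)
     & forall x y, wp x y -> ~ inrect (S s) x y]) ->
  `|md (S t)| <= eps * area (S t).
Proof.
move=> c1 [k [l aE]] h; rewrite -subr_le0 aE.
apply: (@continuous_le0 (fun s => `|md (S s)| - eps * (k * s + l)) t).
  apply: cvgB; first by apply: cvg_norm; exact: c1.
  apply: cvgMr; apply: cvgD; last exact: cvg_cst.
  by apply: cvgMr; exact: cvg_id.
move=> d d0; have [s [sd AS hs]] := h d d0; exists s => //.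
by rewrite subr_le0 -aE; exact: no_wildpt_tame.
Qed.

Let small_step (u v e : R) : u < v -> 0 < e ->
  exists r, [/\ 0 < r, r < e & r <= v - u].
Proof.
move=> uv e0; exists (Num.min (e / 2) (v - u)).
by case: (leP (e / 2) (v - u)) => ?; split; lra.
Qed.

Let degenerate S : xl S = xr S \/ yl S = yr S -> `|md S| <= eps * area S.
Proof.
move=> h; have [-> ->] : md S = 0 /\ area S = 0.
  by rewrite /mixdiff /area /width /height; case: h => ->; split; ring.
by rewrite normr0 mulr0.
Qed.

(** The next four lemmas allow wild points on one side of the rectangle, which is
    the limit of slightly smaller rectangles without wild points; separate
    continuity of [T] suffices since one edge moves at a time. *)
Lemma tame_but_right S : subrect A S ->
  (forall x y, wp x y -> inrect S x y -> x = xr S) -> `|md S| <= eps * area S.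
Proof.
move=> AS h; have [w1 w2] := subrect_wf AS.
move: w1; rewrite le_eqVlt => /orP[/eqP e|w1].
  by apply: degenerate; left.
have i1 : inrect A (xr S) (yl S) by move: AS; rewrite /subrect /inrect; lra.
have i2 : inrect A (xr S) (yr S) by move: AS; rewrite /subrect /inrect; lra.
have := @cont_tame (fun s => Rect (xl S) s (yl S) (yr S)) (xr S).
case: (S) AS h w1 w2 i1 i2 => a b c d /= AS h w1 w2 i1 i2; apply.
- rewrite /mixdiff /=; apply: cvgD; last exact: cvg_cst.
  by apply: cvgB; [apply: cvgB; [exact: Tx|exact: Tx]|exact: cvg_cst].
- by exists (d - c), (- a * (d - c)) => s; rewrite /area /width /height /=; ring.
move=> e e0; have [r [r0 re rw]] := small_step w1 e0.
exists (b - r); split.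
- by rewrite ltr_norml; lra.
- by move: AS; rewrite /subrect /=; lra.
move=> x y xy; have := h x y xy; move: AS.
by rewrite /subrect /inrect /= => AS h' xyin; have := h' ltac:(lra); lra.
Qed.

Lemma tame_but_left S : subrect A S ->
  (forall x y, wp x y -> inrect S x y -> x = xl S) -> `|md S| <= eps * area S.
Proof.
move=> AS h; have [w1 w2] := subrect_wf AS.
move: w1; rewrite le_eqVlt => /orP[/eqP e|w1].
  by apply: degenerate; left.
have i1 : inrect A (xl S) (yl S) by move: AS; rewrite /subrect /inrect; lra.
have i2 : inrect A (xl S) (yr S) by move: AS; rewrite /subrect /inrect; lra.
have := @cont_tame (fun s => Rect s (xr S) (yl S) (yr S)) (xl S).
case: (S) AS h w1 w2 i1 i2 => a b c d /= AS h w1 w2 i1 i2; apply.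
- rewrite /mixdiff /=; apply: cvgD; last exact: Tx.
  by apply: cvgB; [apply: cvgB; [exact: cvg_cst|exact: cvg_cst]|exact: Tx].
- by exists (c - d), (b * (d - c)) => s; rewrite /area /width /height /=; ring.
move=> e e0; have [r [r0 re rw]] := small_step w1 e0.
exists (a + r); split.
- by rewrite ltr_norml; lra.
- by move: AS; rewrite /subrect /=; lra.
move=> x y xy; have := h x y xy; move: AS.
by rewrite /subrect /inrect /= => AS h' xyin; have := h' ltac:(lra); lra.
Qed.

Lemma tame_but_top S : subrect A S ->
  (forall x y, wp x y -> inrect S x y -> y = yr S) -> `|md S| <= eps * area S.
Proof.
move=> AS h; have [w1 w2] := subrect_wf AS.
move: w2; rewrite le_eqVlt => /orP[/eqP e|w2].
  by apply: degenerate; right.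
have i1 : inrect A (xl S) (yr S) by move: AS; rewrite /subrect /inrect; lra.
have i2 : inrect A (xr S) (yr S) by move: AS; rewrite /subrect /inrect; lra.
have := @cont_tame (fun s => Rect (xl S) (xr S) (yl S) s) (yr S).
case: (S) AS h w1 w2 i1 i2 => a b c d /= AS h w1 w2 i1 i2; apply.
- rewrite /mixdiff /=; apply: cvgD; last exact: cvg_cst.
  by apply: cvgB; [apply: cvgB; [exact: Ty|exact: cvg_cst]|exact: Ty].
- by exists (b - a), (- c * (b - a)) => s; rewrite /area /width /height /=; ring.
move=> e e0; have [r [r0 re rw]] := small_step w2 e0.
exists (d - r); split.
- by rewrite ltr_norml; lra.
- by move: AS; rewrite /subrect /=; lra.
move=> x y xy; have := h x y xy; move: AS.
by rewrite /subrect /inrect /= => AS h' xyin; have := h' ltac:(lra); lra.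
Qed.

Lemma tame_but_bottom S : subrect A S ->
  (forall x y, wp x y -> inrect S x y -> y = yl S) -> `|md S| <= eps * area S.
Proof.
move=> AS h; have [w1 w2] := subrect_wf AS.
move: w2; rewrite le_eqVlt => /orP[/eqP e|w2].
  by apply: degenerate; right.
have i1 : inrect A (xl S) (yl S) by move: AS; rewrite /subrect /inrect; lra.
have i2 : inrect A (xr S) (yl S) by move: AS; rewrite /subrect /inrect; lra.
have := @cont_tame (fun s => Rect (xl S) (xr S) s (yr S)) (yl S).
case: (S) AS h w1 w2 i1 i2 => a b c d /= AS h w1 w2 i1 i2; apply.
- rewrite /mixdiff /=; apply: cvgD; last exact: Ty.
  by apply: cvgB; [apply: cvgB; [exact: cvg_cst|exact: Ty]|exact: cvg_cst].
- by exists (a - b), (d * (b - a)) => s; rewrite /area /width /height /=; ring.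
move=> e e0; have [r [r0 re rw]] := small_step w2 e0.
exists (c + r); split.
- by rewrite ltr_norml; lra.
- by move: AS; rewrite /subrect /=; lra.
move=> x y xy; have := h x y xy; move: AS.
by rewrite /subrect /inrect /= => AS h' xyin; have := h' ltac:(lra); lra.
Qed.

End Limits.
End Tame.

Section MinimalRectangle.
Variable R : realType.
Implicit Types (A S : rect R).

Lemma le_pinch (a b : R) : (forall d, 0 < d -> a < b + d) -> a <= b.
Proof.
move=> h; rewrite leNgt; apply/negP => ab.
by have := h (a - b); rewrite subr_gt0 => /(_ ab); lra.
Qed.

Variables (T : R -> R -> R) (eps : R).
Notation wp A := (wildpt T eps A).

Lemma wildpt_closed A x y :
  (forall d, 0 < d -> exists x' y', [/\ wp A x' y', `|x' - x| < d & `|y' - y| < d]) ->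
  wp A x y.
Proof.
move=> h; split.
  split; apply/andP; split; apply: le_pinch => d /h[x' [y' [[i _]]]];
  rewrite !ltr_norml; move: i; rewrite /inrect; lra.
move=> d d0.
have [|x' [y' [[_ w]]]] := h (d / 2); first lra.
rewrite !ltr_norml => xx yy.
have [|S [h1 h2 h3]] := w (d / 2); first lra.
by exists S; split=> //; lra.
Qed.

Lemma compact_rect S : compact [set z : R * R | inrect S z.1 z.2].
Proof.
have -> : [set z : R * R | inrect S z.1 z.2] =
   `[xl S, xr S]%classic `*` `[yl S, yr S]%classic.
  by apply/seteqP; split=> -[x y] /=; rewrite !in_itv.
by apply: compact_setX; exact: segment_compact.
Qed.

Lemma compact_wildpts A S :
  compact [set z : R * R | wp A z.1 z.2 /\ inrect S z.1 z.2].
Proof.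
apply: (subclosed_compact _ (@compact_rect S)); last by move=> z [].
move=> [x y] /= cl.
have app d : 0 < d -> exists x' y',
    [/\ wp A x' y' /\ inrect S x' y', `|x' - x| < d & `|y' - y| < d].
  move=> d0; have [|[x' y'] /= [h [b1 b2]]] := cl (ball (x, y) d).
    exact: nbhsx_ballx.
  by exists x', y'; split=> //; rewrite distrC.
split.
  apply: wildpt_closed => d /app[x' [y' [[? _] ? ?]]]; by exists x', y'.
split; apply/andP; split; apply: le_pinch => d /app[x' [y' [[_ i]]]];
  rewrite !ltr_norml; move: i; rewrite /inrect; lra.
Qed.

(** The wild points in [S] form a compact set, on which the coordinates attain
    their extrema. *)
Lemma minimal_rectangle A S x0 y0 : wp A x0 y0 -> inrect S x0 y0 ->
  exists S', [/\ subrect S S',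
    forall x y, wp A x y -> inrect S x y -> inrect S' x y,
    (exists2 y, wp A (xl S') y & inrect S' (xl S') y) /\
    (exists2 y, wp A (xr S') y & inrect S' (xr S') y),
    exists2 x, wp A x (yl S') & inrect S' x (yl S') &
    exists2 x, wp A x (yr S') & inrect S' x (yr S')].
Proof.
move=> w0 i0.
pose W := [set z : R * R | wp A z.1 z.2 /\ inrect S z.1 z.2].
have Wn : W !=set0 by exists (x0, y0).
have cW : compact W by exact: compact_wildpts.
have c1 : {within W, continuous (fst : R * R -> R)}.
  by apply: continuous_subspaceT; move=> ?; exact: cvg_fst.
have c2 : {within W, continuous (snd : R * R -> R)}.
  by apply: continuous_subspaceT; move=> ?; exact: cvg_snd.
have [[l yL] /set_mem[/= wl il] ml] := compact_EVT_min Wn cW c1.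
have [[r yR] /set_mem[/= wr ir] mr] := compact_EVT_max Wn cW c1.
have [[xb b] /set_mem[/= wb ib] mb] := compact_EVT_min Wn cW c2.
have [[xt t] /set_mem[/= wt it] mt] := compact_EVT_max Wn cW c2.
have ex x y : wp A x y -> inrect S x y -> inrect (Rect l r b t) x y.
  move=> w i; have Wz : (x, y) \in W by apply/mem_set.
  have := ml _ Wz; have := mr _ Wz; have := mb _ Wz; have := mt _ Wz.
  by rewrite /inrect /=; lra.
exists (Rect l r b t); split=> //=.
- by move: il ir ib it (ex _ _ w0 i0); rewrite /inrect /subrect /=; lra.
- by split; [exists yL|exists yR] => //; exact: ex.
- by exists xb => //; exact: ex.
- by exists xt => //; exact: ex.
Qed.

End MinimalRectangle.

Section Induction.
Variable R : realType.
Implicit Types (A S : rect R).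
Variable (T : R -> R -> R).
Notation md := (mixdiff T).

Definition squarish S := width S <= 2 * height S /\ height S <= 2 * width S.

(** A long rectangle is cut into pieces of bounded eccentricity, and the bound is
    additive. *)
Lemma squarish_all A (c : R) :
  (forall S, subrect A S -> squarish S -> `|md S| <= c * area S) ->
  forall S, subrect A S -> `|md S| <= c * area S.
Proof.
move=> h.
have cut n S : subrect A S ->
    width S <= 2 * 2 ^+ n * height S -> height S <= 2 * 2 ^+ n * width S ->
    `|md S| <= c * area S.
  elim: n S => [|n IH] S AS hw hh.
    by apply: h => //; split; move: hw hh; rewrite expr0 mulr1.
  have p1 : 1 <= 2 ^+ n :> R by rewrite exprn_ege1// ler1n.
  move: hw hh; rewrite exprS; set k := 2 ^+ n in p1 IH *; clearbody k => hw hh.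
  have [w1 w2] := subrect_wf AS.
  have kw : width S <= k * width S by rewrite ler_peMl// /width; lra.
  have kh : height S <= k * height S by rewrite ler_peMl// /height; lra.
  have glue S1 S2 : md S = md S1 + md S2 -> area S1 = area S / 2 ->
      area S2 = area S / 2 -> `|md S1| <= c * area S1 -> `|md S2| <= c * area S2 ->
      `|md S| <= c * area S.
    by move=> -> -> ->; have := ler_normD (md S1) (md S2); lra.
  case: (leP (width S) (height S)) => cmp.
    pose m := (yl S + yr S) / 2.
    have half S' : width S' = width S -> height S' = height S / 2 -> subrect S S' ->
        `|md S'| <= c * area S'.
      by move=> ew eh SS'; apply: IH; rewrite ?ew ?eh; [exact: subrect_trans SS'|lra|lra].
    by apply: (glue (Rect (xl S) (xr S) (yl S) m) (Rect (xl S) (xr S) m (yr S)));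
      [rewrite /mixdiff /=; ring|rewrite /area /width /height /= /m; field
      |rewrite /area /width /height /= /m; field|apply: half|apply: half];
      rewrite /width /height /subrect /= /m //; (lra || field).
  pose m := (xl S + xr S) / 2.
  have half S' : width S' = width S / 2 -> height S' = height S -> subrect S S' ->
      `|md S'| <= c * area S'.
    by move=> ew eh SS'; apply: IH; rewrite ?ew ?eh; [exact: subrect_trans SS'|lra|lra].
  by apply: (glue (Rect (xl S) m (yl S) (yr S)) (Rect m (xr S) (yl S) (yr S)));
    [rewrite /mixdiff /=; ring|rewrite /area /width /height /= /m; field
    |rewrite /area /width /height /= /m; field|apply: half|apply: half];
    rewrite /width /height /subrect /= /m //; (lra || field).
move=> S AS; have [w1 w2] := subrect_wf AS.
case: (eqVneq (xl S) (xr S)) => [e|nx].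
  have [-> ->] : md S = 0 /\ area S = 0.
    by rewrite /mixdiff /area /width /height e; split; ring.
  by rewrite normr0 mulr0.
case: (eqVneq (yl S) (yr S)) => [e|ny].
  have [-> ->] : md S = 0 /\ area S = 0.
    by rewrite /mixdiff /area /width /height e; split; ring.
  by rewrite normr0 mulr0.
have W : 0 < width S by rewrite subr_gt0 lt_neqAle nx.
have H : 0 < height S by rewrite subr_gt0 lt_neqAle ny.
have [n hn] := halving_lt (width S) H.
have [m hm] := halving_lt (height S) W.
apply: (cut (n + m)%N) => //.
  move: hn; rewrite ltr_pdivrMr ?exprn_gt0// => /ltW /le_trans; apply.
  rewrite [leRHS]mulrC ler_pM2l// exprD.
  have p1 : 1 <= 2 ^+ m :> R by rewrite exprn_ege1// ler1n.
  have p2 : 0 <= 2 ^+ n :> R by rewrite exprn_ge0.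
  rewrite mulrCA ler_peMr//; lra.
move: hm; rewrite ltr_pdivrMr ?exprn_gt0// => /ltW /le_trans; apply.
rewrite [leRHS]mulrC ler_pM2l// exprD.
have p1 : 1 <= 2 ^+ n :> R by rewrite exprn_ege1// ler1n.
have p2 : 0 <= 2 ^+ m :> R by rewrite exprn_ge0.
rewrite mulrA ler_peMl//; lra.
Qed.

End Induction.

Section Tameness.
Variable R : realType.
Implicit Types (A S : rect R).
Variables (P Q p q : R -> R -> R).
Let T x y := q x y - p x y.
Notation md := (mixdiff T).

Variables (eps : R) (A : rect R).
Hypothesis eps_gt0 : 0 < eps.
Hypothesis dp : forall x y, inrect A x y -> is_derive x 1 (p^~ y) (P x y).
Hypothesis dq : forall x y, inrect A x y -> is_derive y 1 (q x) (Q x y).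
Hypothesis Tx : forall x y, inrect A x y -> {for x, continuous (T^~ y)}.
Hypothesis Ty : forall x y, inrect A x y -> {for y, continuous (T x)}.
Notation wp := (wildpt T eps A).

(** On a rectangle [S] of bounded eccentricity cut off the four margins around
    the smallest rectangle [S'] that contains the wild points of [S].  The
    margins are controlled, and [box_bound] controls [mixdiff T S'] by half of
    [eps * area S].  This is enough when [S'] fills half of [S]; otherwise the
    excess over [eps] in the bound on [S] is at most half of the excess in the
    bound on [S'], and induction drives it to 0. *)
Lemma cross_tame (a b c d : R) : width A < d -> height A < d ->
  (forall x y, wp x y ->
     cross P A a b (eps / 32) d x y /\ cross Q A b c (eps / 32) d x y) ->
  forall S, subrect A S -> `|md S| <= eps * area S.
Proof.
move=> wA hA hc; have e0 : 0 <= eps by exact: ltW.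
have core S : subrect A S -> squarish S -> `|md S| <= eps * area S \/
    exists S', [/\ subrect S S', `|md S| <= eps * (area S - area S') + `|md S'|
                & `|md S'| <= eps / 2 * area S].
  move=> AS [sq1 sq2].
  case: (pselect (exists x y, wp x y /\ inrect S x y)) => [|no]; last first.
    left; apply: (no_wildpt_tame (A := A)) => // x y w i.
    by apply: no; exists x, y.
  move=> [x0 [y0 [w0 i0]]]; right.
  have [S' [SS' hS' [[yL wL iL] [yR wR iR]] [xb wb ib] [xt wt it]]] :=
    minimal_rectangle w0 i0.
  exists S'; split => //.
    pose Ml := Rect (xl S) (xl S') (yl S) (yr S).
    pose Mr := Rect (xr S') (xr S) (yl S) (yr S).
    pose Mb := Rect (xl S') (xr S') (yl S) (yl S').
    pose Mt := Rect (xl S') (xr S') (yr S') (yr S).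
    have emd : md S = md Ml + md Mr + md Mb + md Mt + md S'.
      by rewrite /mixdiff /=; ring.
    have ear : area S - area S' = area Ml + area Mr + area Mb + area Mt.
      by rewrite /area /width /height /=; ring.
    have inS M : subrect S M -> forall x y, wp x y -> inrect M x y -> inrect S' x y.
      by move=> SM x y w i; apply: hS' => //; exact: inrect_sub SM i.
    have sl : subrect S Ml by move: SS' AS; rewrite /subrect /=; lra.
    have sr : subrect S Mr by move: SS' AS; rewrite /subrect /=; lra.
    have sb : subrect S Mb by move: SS' AS; rewrite /subrect /=; lra.
    have st : subrect S Mt by move: SS' AS; rewrite /subrect /=; lra.
    have bl : `|md Ml| <= eps * area Ml.
      apply: (tame_but_right Tx (subrect_trans AS sl)) => x y w i.
      by have := inS _ sl x y w i; move: i; rewrite /inrect /=; lra.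
    have br : `|md Mr| <= eps * area Mr.
      apply: (tame_but_left Tx (subrect_trans AS sr)) => x y w i.
      by have := inS _ sr x y w i; move: i; rewrite /inrect /=; lra.
    have bb : `|md Mb| <= eps * area Mb.
      apply: (tame_but_top Ty (subrect_trans AS sb)) => x y w i.
      by have := inS _ sb x y w i; move: i; rewrite /inrect /=; lra.
    have bt : `|md Mt| <= eps * area Mt.
      apply: (tame_but_bottom Ty (subrect_trans AS st)) => x y w i.
      by have := inS _ st x y w i; move: i; rewrite /inrect /=; lra.
    rewrite emd ear.
    have := ler_normD (md Ml + md Mr + md Mb + md Mt) (md S').
    have := ler_normD (md Ml + md Mr + md Mb) (md Mt).
    have := ler_normD (md Ml + md Mr) (md Mb).
    have := ler_normD (md Ml) (md Mr).
    lra.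
  pose D := Num.max (width S) (height S).
  have D0 : 0 <= D by rewrite le_max /width; move: AS; rewrite /subrect; lra.
  have wD : width S <= D by rewrite le_max lexx.
  have hD : height S <= D by rewrite le_max lexx orbT.
  have w'D : width S' <= D.
    by apply: le_trans wD; move: SS'; rewrite /subrect /width; lra.
  have h'D : height S' <= D.
    by apply: le_trans hD; move: SS'; rewrite /subrect /height; lra.
  have Dd : D < d.
    rewrite gt_max; apply/andP; split.
      by apply: le_lt_trans wA; move: AS; rewrite /subrect /width; lra.
    by apply: le_lt_trans hA; move: AS; rewrite /subrect /height; lra.
  have e32 : 0 <= eps / 32 by lra.
  (* The bound is [8 * (eps / 32) * D ^+ 2], and [D ^+ 2] is at most twice the
     area of [S]. *)
  have := box_bound e32 (subrect_trans AS SS') w'D h'D Dd dp dq ib it iL iR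
    (hc _ _ wb).1 (hc _ _ wt).1 (hc _ _ wL).2 (hc _ _ wR).2.
  move/le_trans; apply.
  have : D ^+ 2 <= 2 * area S.
    rewrite /area /D expr2; have [w1 w2] := subrect_wf AS.
    have W : 0 <= width S by rewrite /width; lra.
    have H : 0 <= height S by rewrite /height; lra.
    have := ler_wpM2l W sq1; have := ler_wpM2l H sq2.
    case: (leP (width S) (height S)) => _; lra.
  move=> /(ler_wpM2l e0); lra.
have area0 S : subrect A S -> 0 <= area S.
  by move=> /subrect_wf[w1 w2]; rewrite mulr_ge0// subr_ge0.
have main n : forall S, subrect A S -> `|md S| <= (eps + eps / 2 ^+ n) * area S.
  elim: n => [|n IH]; apply: squarish_all => S AS sq.
    have aS := area0 _ AS; rewrite expr0 divr1.
    have eS : 0 <= eps * area S by rewrite mulr_ge0.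
    case: (core S AS sq) => [h|[S' [SS' h1 h2]]]; first lra.
    have eS' : 0 <= eps * area S'.
      by rewrite mulr_ge0// area0//; exact: subrect_trans SS'.
    lra.
  have aS := area0 _ AS.
  have k0 : 0 <= (2 ^+ n)^-1 :> R by rewrite invr_ge0 exprn_ge0.
  move: k0 IH; rewrite exprS invfM; move: (2 ^+ n)^-1 => k k0 IH.
  have eS : 0 <= eps * k * area S by apply: mulr_ge0 aS; exact: mulr_ge0.
  case: (core S AS sq) => [h|[S' [SS' h1 h2]]]; first lra.
  have AS' := subrect_trans AS SS'.
  case: (leP (area S / 2) (area S')) => hS.
    have := ler_wpM2l e0 hS; lra.
  have h3 := IH _ AS'.
  have ek : 0 <= eps * k by rewrite mulr_ge0.
  have := ler_wpM2l ek (ltW hS); lra.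
move=> S AS; apply: le_pinch => r r0.
have aS := area0 _ AS.
have [n hn] := halving_lt (eps * area S) r0.
have := main n S AS; rewrite mulrDl [_ / _ * _]mulrAC; lra.
Qed.

End Tameness.

Section Exhaustion.
Variable R : realType.
Implicit Types (A S : rect R) (u : R -> R -> R).

Lemma is_derive_eps (f : R -> R) (x l : R) : is_derive x 1 f l ->
  forall e, 0 < e -> exists2 d, 0 < d &
    forall z, `|z - x| < d -> `|f z - f x - l * (z - x)| <= e * `|z - x|.
Proof.
move=> /is_derive1_caratheodory[g [hg cg gx]] e e0.
have /cvgrPdist_lt /(_ _ e0) [d /= d0 hd] := cg.
exists d => // z zd; rewrite hg -mulrBl normrM ler_wpM2r// distrC -gx.
by apply/ltW; apply: hd; rewrite /ball_ /= distrC.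
Qed.

Lemma eps_is_derive (f : R -> R) (x l : R) :
  (forall e, 0 < e -> exists2 d, 0 < d &
    forall z, `|z - x| < d -> `|f z - f x - l * (z - x)| <= e * `|z - x|) ->
  is_derive x 1 f l.
Proof.
move=> h; apply/is_derive1_caratheodory.
exists (fun z => if z == x then l else (f z - f x) / (z - x)); split.
- move=> z; case: eqP => [->|/eqP zx]; first by rewrite !subrr mulr0.
  by rewrite divfK// subr_eq0.
- apply/cvgrPdist_le => e e0; have [d d0 hd] := h e e0.
  exists d => //= z zd; rewrite eqxx; case: eqP => [_|/eqP zx].
    by rewrite subrr normr0 ltW.
  have zx0 : 0 < `|z - x| by rewrite normr_gt0 subr_eq0.
  rewrite -(ler_pM2r zx0) -normrM mulrBl divfK ?subr_eq0// distrC.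
  by apply: hd; rewrite distrC.
- by rewrite eqxx.
Qed.

Lemma continuous_eps (f : R -> R) (x : R) : {for x, continuous f} ->
  forall e, 0 < e -> exists2 d, 0 < d & forall z, `|z - x| < d -> `|f z - f x| < e.
Proof.
move=> cf e e0; have /cvgrPdist_lt /(_ _ e0) [d /= d0 hd] := cf.
by exists d => // z zd; rewrite distrC; apply: hd; rewrite /ball_ /= distrC.
Qed.

(** The lines through the approximating points replace joint continuity: on them
    the condition holds, and [u] varies continuously across them. *)
Lemma hcross_closed u A (a e d x y : R) : 0 <= e ->
  (forall x y, inrect A x y -> {for y, continuous (u x)}) -> inrect A x y ->
  (forall r, 0 < r -> exists x' y', [/\ inrect A x' y', `|x' - x| < r, `|y' - y| < r &
     forall x1, `|x1 - x'| < d -> inrect A x1 y' ->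
       `|u x1 y' - u x' y' - a * (x1 - x')| <= e * `|x1 - x'|]) ->
  forall x1, `|x1 - x| < d -> inrect A x1 y ->
    `|u x1 y - u x y - a * (x1 - x)| <= e * `|x1 - x|.
Proof.
move=> e0 cu xy h x1 x1d x1y; apply: le_pinch => k k0.
have k4 : 0 < k / 4 by lra.
have [r1 r10 hr1] := continuous_eps (cu _ _ x1y) k4.
have [r2 r20 hr2] := continuous_eps (cu _ _ xy) k4.
(* With [e + 1] in place of [e], also the case [e = 0] is covered. *)
pose r3 := k / (4 * (e + 1)).
have r30 : 0 < r3 by rewrite divr_gt0// mulr_gt0//; lra.
have er3 : e * r3 < k / 4.
  have -> : e * r3 = k / 4 * (e / (e + 1)).
    by rewrite /r3; field; rewrite lt0r_neq0//; lra.
  by rewrite gtr_pMr// ltr_pdivrMr; lra.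
have d0 : 0 < d - `|x1 - x| by lra.
pose r := Num.min (Num.min r1 r2) (Num.min r3 (d - `|x1 - x|)).
have r0 : 0 < r by rewrite !lt_min r10 r20 r30 d0.
have [x' [y' [x'y' xr yr hc]]] := h r r0.
have : r <= r1 /\ r <= r2 /\ r <= r3 /\ r <= d - `|x1 - x|.
  by rewrite !ge_min !lexx !orbT.
move=> [l1 [l2 [l3 l4]]].
have t1 : `|x1 - x'| <= `|x1 - x| + `|x' - x|.
  by rewrite (distrC x' x); exact: ler_distD.
have d1 : `|x1 - x'| < d by lra.
have d2 : `|x - x'| < d by rewrite distrC; have := normr_ge0 (x1 - x); lra.
have i1 : inrect A x1 y' by move: x'y' x1y; rewrite /inrect; lra.
have i2 : inrect A x y' by move: x'y' xy; rewrite /inrect; lra.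
have c1 := hc _ d1 i1; have c2 := hc _ d2 i2.
have n1 := hr1 y' (lt_le_trans yr l1); have n2 := hr2 y' (lt_le_trans yr l2).
have le1 := ler_wpM2l e0 t1.
have le2 : e * `|x' - x| <= e * r3 by apply: ler_wpM2l => //; lra.
rewrite (distrC x x') in c2.
move: c1 c2 n1 n2; rewrite !ler_norml !ltr_norml; lra.
Qed.

Lemma cross_closed u A (a b e d x y : R) : 0 <= e ->
  (forall x y, inrect A x y -> {for x, continuous (u^~ y)}) ->
  (forall x y, inrect A x y -> {for y, continuous (u x)}) -> inrect A x y ->
  (forall r, 0 < r -> exists x' y', [/\ inrect A x' y', `|x' - x| < r, `|y' - y| < r
     & cross u A a b e d x' y']) ->
  cross u A a b e d x y.
Proof.
move=> e0 cx cy xy h; split.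
  apply: hcross_closed => // r /h[x' [y' [? ? ? [? ?]]]].
  by exists x', y'.
move=> y1 y1d y1i.
apply: (@hcross_closed (fun s t => u t s) (Rect (yl A) (yr A) (xl A) (xr A))
  b e d y x) => //.
- by move=> s t st; apply: cx; move: st; rewrite /inrect /=; lra.
- by move: xy; rewrite /inrect /=; lra.
- move=> r /h[x' [y' [i ? ? [? h2]]]]; exists y', x'; split => //.
    by move: i; rewrite /inrect /=; lra.
  by move=> z zd zi; apply: h2 => //; move: zi; rewrite /inrect /=; lra.
- by move: y1i; rewrite /inrect /=; lra.
Qed.

Variables (P Q p q dPx dPy dQy : R -> R -> R) (A : rect R).
Let T x y := q x y - p x y.
Hypothesis dp : forall x y, inrect A x y -> is_derive x 1 (p^~ y) (P x y).
Hypothesis dq : forall x y, inrect A x y -> is_derive y 1 (q x) (Q x y).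
Hypothesis Tx : forall x y, inrect A x y -> {for x, continuous (T^~ y)}.
Hypothesis Ty : forall x y, inrect A x y -> {for y, continuous (T x)}.
Hypothesis Px : forall x y, inrect A x y -> is_derive x 1 (P^~ y) (dPx x y).
Hypothesis Py : forall x y, inrect A x y -> is_derive y 1 (P x) (dPy x y).
Hypothesis Qx : forall x y, inrect A x y -> is_derive x 1 (Q^~ y) (dPy x y).
Hypothesis Qy : forall x y, inrect A x y -> is_derive y 1 (Q x) (dQy x y).

Lemma is_derive_rat (f : R -> R) (x l e : R) : is_derive x 1 f l -> 0 < e ->
  exists2 d, 0 < d & forall r : R, `|l - r| < e / 2 ->
    forall z, `|z - x| < d -> `|f z - f x - r * (z - x)| <= e * `|z - x|.
Proof.
move=> h e0; have [|d d0 hd] := is_derive_eps h (e := e / 2); first lra.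
exists d => // r lr z zd; have := hd z zd.
have : `|(l - r) * (z - x)| <= e / 2 * `|z - x|.
  by rewrite normrM ler_wpM2r// ltW.
by rewrite !ler_norml; lra.
Qed.

Lemma near_rat (l e : R) : 0 < e -> exists r : rat, `|l - ratr r| < e.
Proof.
move=> e0; have [|r] := @rat_in_itvoo R (l - e) (l + e); first lra.
by rewrite in_itv /= => h; exists r; rewrite ltr_norml; lra.
Qed.

(** The partial derivatives at the point provide the slopes, which are then
    replaced by rational approximations. *)
Lemma cross_cover (e x y : R) : 0 < e -> inrect A x y ->
  exists (n : nat) (a b c : rat),
    cross P A (ratr a) (ratr b) e n.+1%:R^-1 x y /\
    cross Q A (ratr b) (ratr c) e n.+1%:R^-1 x y.
Proof.
move=> e0 xy; have e20 : 0 < e / 2 by lra.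
have [a ha] := near_rat (dPx x y) e20; have [b hb] := near_rat (dPy x y) e20.
have [c hc] := near_rat (dQy x y) e20.
have [d1 d10 h1] := is_derive_rat (Px xy) e0.
have [d2 d20 h2] := is_derive_rat (Py xy) e0.
have [d3 d30 h3] := is_derive_rat (Qx xy) e0.
have [d4 d40 h4] := is_derive_rat (Qy xy) e0.
have [n] : exists n : nat, n.+1%:R^-1 < Num.min (Num.min d1 d2) (Num.min d3 d4).
  have d0 : 0 < Num.min (Num.min d1 d2) (Num.min d3 d4) by rewrite !lt_min d10 d20 d30.
  have [n hn] := halving_lt 1 d0; exists (2 ^ n).-1.
  by rewrite prednK ?expn_gt0// natrX; move: hn; rewrite div1r.
rewrite !lt_min => /andP[/andP[n1 n2] /andP[n3 n4]].
exists n, a, b, c; split; split => z zd _.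
- by apply: h1 => //; exact: lt_trans zd n1.
- by apply: h2 => //; exact: lt_trans zd n2.
- by apply: h3 => //; exact: lt_trans zd n3.
- by apply: h4 => //; exact: lt_trans zd n4.
Qed.

Lemma cross_sub u S (a b e d x y : R) : subrect A S -> cross u A a b e d x y ->
  cross u S a b e d x y.
Proof.
move=> AS [h1 h2]; split => z zd zi; [apply: h1|apply: h2] => //;
  exact: inrect_sub zi.
Qed.

(** Otherwise a nested sequence of wild rectangles leaves, one after the other,
    the closed sets of the countable cover [cross_cover]: by [cross_tame] the
    wild points of a small wild rectangle cannot all lie in one of them. *)
Lemma closed_form_tame (eps : R) : 0 < eps -> forall S, subrect A S -> ~ wild T eps S.
Proof.
move=> eps0 S0 AS0 wS0.
have e0 : 0 < eps / 32 by lra.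
pose X := (nat * {S | wild T eps S /\ subrect A S})%type.
pose param (n : nat) : option (nat * rat * rat * rat) := unpickle n.
pose C n x y := if param n is Some (m, a, b, c) then
  cross P A (ratr a) (ratr b) (eps / 32) m.+1%:R^-1 x y /\
  cross Q A (ratr b) (ratr c) (eps / 32) m.+1%:R^-1 x y else False.
pose rel (s s' : X) := [/\ s'.1 = s.1.+1, subrect (sval s.2) (sval s'.2) &
   forall x y, inrect (sval s'.2) x y -> ~ C s.1 x y].
have step (s : X) : {s' : X | rel s s'}.
  case: s => n [S [wS AS]]; apply: cid; rewrite /rel /C /=.
  case E : (param n) => [[[[m a] b] c]|]; last first.
    exists (n.+1, exist _ S (conj wS AS)); split=> //=; last by move=> x y _ [].
    exact: subrect_refl (subrect_wf AS).
  have m0 : 0 < m.+1%:R^-1 :> R by rewrite invr_gt0.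
  have [S1 [SS1 wS1 W1 H1]] := wild_shrink wS m0.
  have AS1 := subrect_trans AS SS1.
  have inA x y : inrect S1 x y -> inrect A x y by exact: inrect_sub AS1.
  have [x [y [wxy ncr]]] : exists x y, wildpt T eps S1 x y /\ ~ C n x y.
    apply: contrapT => hn.
    have [w1 w2] := wS1.
    have := @cross_tame R P Q p q eps S1 eps0 _ _ _ _ (ratr a) (ratr b) (ratr c)
      _ W1 H1 _ S1 (subrect_refl w1).
    rewrite leNgt w2 => h; suff: false by []; apply: h.
    - by move=> x y /inA; exact: dp.
    - by move=> x y /inA; exact: dq.
    - by move=> x y /inA; exact: Tx.
    - by move=> x y /inA; exact: Ty.
    move=> x y wxy.
    have : C n x y by apply: contrapT => ?; apply: hn; exists x, y.
    by rewrite /C E => -[c1 c2]; split; exact: cross_sub AS1 _.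
  have xyA : inrect A x y by apply: inA; case: wxy.
  have e00 := ltW e0.
  (* The n-th set of the cover is closed, so some neighbourhood of the wild point
     avoids it; a wild rectangle inside that neighbourhood is the next one. *)
  have [r r0 hr] : exists2 r, 0 < r & forall x' y', inrect A x' y' ->
      `|x' - x| < r -> `|y' - y| < r -> ~ C n x' y'.
    apply: contrapT => hn; apply: ncr.
    have hn' r : 0 < r -> exists x' y', [/\ inrect A x' y', `|x' - x| < r,
        `|y' - y| < r & C n x' y'].
      move=> r0; apply: contrapT => h; apply: hn; exists r => // x' y' ? ? ? ?.
      by apply: h; exists x', y'.
    rewrite /C E in hn' *; split; apply: cross_closed => //.
    - by move=> s t /Px; exact: is_derive_continuous.
    - by move=> s t /Py; exact: is_derive_continuous.
    - by move=> r /hn'[x' [y' [? ? ? [? ?]]]]; exists x', y'.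
    - by move=> s t /Qx; exact: is_derive_continuous.
    - by move=> s t /Qy; exact: is_derive_continuous.
    - by move=> r /hn'[x' [y' [? ? ? [? ?]]]]; exists x', y'.
  have [S2 [S1S2 wS2 bS2]] := wxy.2 r r0.
  have AS2 := subrect_trans AS1 S1S2.
  exists (n.+1, exist _ S2 (conj wS2 AS2)); split=> //=.
    exact: subrect_trans SS1 S1S2.
  move=> x' y' i'; have := hr x' y' (inrect_sub AS2 i'); rewrite /C E; apply.
  - by move: i' bS2; rewrite /inrect ltr_norml; lra.
  - by move: i' bS2; rewrite /inrect ltr_norml; lra.
have [f [f0 hf]] := dependent_choice step (0%N, exist _ S0 (conj wS0 AS0)).
have f1 n : (f n).1 = n.
  by elim: n => [|n IH]; [rewrite f0|have [-> _ _] := hf n; rewrite IH].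
have [||x [y xy]] := @nested_rects R (fun n => sval (f n).2).
- by rewrite f0; exact: subrect_wf AS0.
- by move=> n; have [] := hf n.
have xyA : inrect A x y.
  by have := xy 0%N; rewrite f0; exact: inrect_sub.
have [n [a [b [c hc]]]] := cross_cover e0 xyA.
pose i := pickle (n, a, b, c).
have [_ _ /(_ x y (xy i.+1))] := hf i.
by rewrite f1 /C /param /i pickleK.
Qed.

Lemma closed_form_mixdiff0 S : subrect A S -> mixdiff T S = 0.
Proof.
move=> AS; apply/eqP; rewrite -normr_le0; apply: le_pinch => e e0; rewrite add0r.
have [w1 w2] := subrect_wf AS.
have a0 : 0 <= area S by rewrite mulr_ge0// subr_ge0.
pose eps := e / (2 * (area S + 1)).
have eps0 : 0 < eps by rewrite divr_gt0//; lra.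
have := closed_form_tame eps0 AS; rewrite /wild => h.
have : `|mixdiff T S| <= eps * area S.
  by rewrite leNgt; apply/negP => w; apply: h.
move=> /le_lt_trans; apply.
rewrite /eps mulrAC ltr_pdivrMr; last lra.
rewrite -subr_gt0; have -> : e * (2 * (area S + 1)) - e * area S = e * area S + 2 * e.
  by ring.
have := mulr_ge0 (ltW e0) a0; lra.
Qed.

End Exhaustion.

Section Potential.
Variable R : realType.
Implicit Types (A S : rect R).

Definition inside A x y := xl A < x < xr A /\ yl A < y < yr A.

Lemma inside_inrect A x y : inside A x y -> inrect A x y.
Proof. by rewrite /inside /inrect; lra. Qed.

(** Integration in one variable.  Dominated convergence preserves the continuity
    in the other one; boundedness enters the proof here. *)
Lemma partial_primitive (P : R -> R -> R) A (M : R) :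
  (forall x y, inrect A x y -> {for x, continuous (P^~ y)}) ->
  (forall x y, inrect A x y -> {for y, continuous (P x)}) ->
  (forall x y, inrect A x y -> `|P x y| <= M) ->
  exists p : R -> R -> R, forall x y, inside A x y ->
    is_derive x 1 (p^~ y) (P x y) /\ {for y, continuous (p x)}.
Proof.
move=> cx cy bM.
pose mu := @lebesgue_measure R.
exists (fun x y => \int[mu]_(t in `[xl A, x]) P t y)%R => x y xy.
have intP z y' : z <= xr A -> yl A <= y' <= yr A ->
    mu.-integrable `[xl A, z] (EFin \o P^~ y').
  move=> zr hy; apply: continuous_compact_integrable; first exact: segment_compact.
  apply: continuous_in_subspaceT => t /[!inE] /=; rewrite in_itv /= => ht.
  by apply: cx; rewrite /inrect; lra.
split.
  have [[lx xr'] [ly yr']] : (xl A < x /\ x < xr A) /\ (yl A <= y /\ y <= yr A).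
    by case: xy; lra.
  have hy : yl A <= y <= yr A by rewrite ly.
  have [d1 d2] := @continuous_FTC1_closed R (P^~ y) (xl A) x (xr A) xr'
    (intP _ y (lexx _) hy) lx (cx x y (inside_inrect xy)).
  by rewrite -d2 derive1E; exact: derivableP.
have yin : y \in (`]yl A, yr A[%classic : set R).
  by rewrite inE /= in_itv /=; case: xy.
apply: (@continuity_under_integral R _ _ mu (fun y t => P t y) `[xl A, x]
  _ (yl A) (yr A) _ _ (cst M)) => //=.
- move=> y' /=; rewrite in_itv /= => hy; apply: intP; by case: xy; lra.
- apply: aeW => t /=; rewrite in_itv /= => ht y'; rewrite inE /= in_itv /= => hy.
  by apply: cy; case: xy; rewrite /inrect; lra.
- by apply: continuous_compact_integrable; [exact: segment_compact|
    apply: continuous_subspaceT => ?; exact: cvg_cst].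
- move=> y' /=; rewrite in_itv /= => hy; apply: aeW => t /=; rewrite in_itv /= => ht.
  by apply: bM; case: xy; rewrite /inrect; lra.
Qed.

(** The mixed differences of [q - p] vanish, so [q - p] is a function of [x] plus
    a function of [y], and correcting [p] by the latter gives the potential. *)
Theorem potential (P Q dPx dPy dQy : R -> R -> R) A (M : R) :
  (forall x y, inrect A x y -> is_derive x 1 (P^~ y) (dPx x y)) ->
  (forall x y, inrect A x y -> is_derive y 1 (P x) (dPy x y)) ->
  (forall x y, inrect A x y -> is_derive x 1 (Q^~ y) (dPy x y)) ->
  (forall x y, inrect A x y -> is_derive y 1 (Q x) (dQy x y)) ->
  (forall x y, inrect A x y -> `|P x y| <= M) ->
  (forall x y, inrect A x y -> `|Q x y| <= M) ->
  exists H : R -> R -> R, forall x y, inside A x y ->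
    is_derive x 1 (H^~ y) (P x y) /\ is_derive y 1 (H x) (Q x y).
Proof.
move=> Px Py Qx Qy bP bQ.
have [p hp] := @partial_primitive P A M
  (fun x y h => is_derive_continuous (Px x y h))
  (fun x y h => is_derive_continuous (Py x y h)) bP.
have [q' hq'] := @partial_primitive (fun s t => Q t s)
  (Rect (yl A) (yr A) (xl A) (xr A)) M
  (fun x y h => is_derive_continuous (Qy y x (conj h.2 h.1)))
  (fun x y h => is_derive_continuous (Qx y x (conj h.2 h.1)))
  (fun x y h => bQ y x (conj h.2 h.1)).
pose q x y := q' y x.
have hq x y : inside A x y -> is_derive y 1 (q x) (Q x y) /\ {for x, continuous (q^~ y)}.
  by move=> [h1 h2]; exact: hq' (conj h2 h1).
pose T x y := q x y - p x y.
case: (pselect (exists x0 y0, inside A x0 y0)) => [[x0 [y0 i0]]|no]; last first.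
  by exists (fun _ _ => 0) => x y xy; exfalso; apply: no; exists x, y.
have Tx x y : inside A x y -> {for x, continuous (T^~ y)}.
  move=> xy; apply: cvgB; first by have [] := hq x y xy.
  by have [h _] := hp x y xy; exact: is_derive_continuous h.
have Ty x y : inside A x y -> {for y, continuous (T x)}.
  move=> xy; apply: cvgB; last by have [] := hp x y xy.
  by have [h _] := hq x y xy; exact: is_derive_continuous h.
have T0 x y : inside A x y -> T x y = T x y0 + T x0 y - T x0 y0.
  move=> xy.
  pose S := Rect (Num.min x x0) (Num.max x x0) (Num.min y y0) (Num.max y y0).
  have inS s t : inrect S s t -> inside A s t.
    move: xy i0; rewrite /inside /inrect /=.
    by case: (leP x x0) => _; case: (leP y y0) => _; lra.
  have wS : wf S.
    by rewrite /wf /=; case: (leP x x0) => ?; case: (leP y y0) => ?; split; lra.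
  have := @closed_form_mixdiff0 R P Q p q dPx dPy dQy S _ _ _ _ _ _ _ _ S
    (subrect_refl wS).
  rewrite -/T => h; have {h} : mixdiff T S = 0.
    apply: h => s t /inS st.
    - by have [] := hp s t st.
    - by have [] := hq s t st.
    - exact: Tx.
    - exact: Ty.
    - by apply: Px; exact: inside_inrect.
    - by apply: Py; exact: inside_inrect.
    - by apply: Qx; exact: inside_inrect.
    - by apply: Qy; exact: inside_inrect.
  rewrite /mixdiff /=.
  by case: (leP x x0) => _; case: (leP y y0) => _; lra.
exists (fun x y => p x y + T x0 y) => x y xy; split.
  have [h _] := hp x y xy.
  have -> : (fun x => p x y + T x0 y) = (p^~ y) + cst (T x0 y) by apply/funext.
  by apply: is_derive_eq; rewrite addr0.
have [h _] := hq x y xy.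
apply: eps_is_derive => e e0.
have [d d0 hd] := is_derive_eps h e0.
pose r := Num.min d (Num.min (y - yl A) (yr A - y)).
have r0 : 0 < r by case: xy => _ h2; rewrite !lt_min; apply/and3P; split; lra.
exists r => // z zr.
have : r <= d /\ r <= y - yl A /\ r <= yr A - y by rewrite !ge_min !lexx !orbT.
move=> [l1 [l2 l3]].
have xz : inside A x z.
  by case: xy => h1 _; split=> //; move: zr; rewrite ltr_norml; lra.
have E1 := T0 _ _ xz; have E2 := T0 _ _ xy.
have -> : p x z + T x0 z - (p x y + T x0 y) = q x z - q x y.
  by move: E1 E2; rewrite /T; lra.
by apply: hd; exact: lt_le_trans zr l1.
Qed.

End Potential.


(** * Complex derivatives *)

Section Modulus.
Variable R : realType.
Implicit Types z w : R[i].

(** The modulus as a real number; the norm of [R[i]] takes values in [R[i]]. *)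
Definition cmod z : R := Normc.normc z.

Lemma eq_ler (a b : R) : a = b -> a <= b. Proof. by move=> ->. Qed.

Lemma cmodE z : `|z| = (cmod z)%:C. Proof. by []. Qed.
Lemma cmod_ge0 z : 0 <= cmod z.
Proof. by rewrite -lecR -cmodE; exact: (@normr_ge0 R[i] R[i]). Qed.
Lemma cmod0 : cmod 0 = 0. Proof. exact: Normc.normc0. Qed.
Lemma cmod1 : cmod 1 = 1. Proof. exact: Normc.normc1. Qed.
Lemma cmodM z w : cmod (z * w) = cmod z * cmod w. Proof. exact: Normc.normcM. Qed.
Lemma cmodV z : cmod z^-1 = (cmod z)^-1. Proof. exact: Normc.normcV. Qed.
Lemma cmodX z n : cmod (z ^+ n) = cmod z ^+ n.
Proof. by elim: n => [|n IH]; rewrite ?cmod1// !exprS cmodM IH. Qed.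
Lemma cmodD z w : cmod (z + w) <= cmod z + cmod w. Proof. exact: le_normcD. Qed.
Lemma cmodN z : cmod (- z) = cmod z. Proof. exact: normcN. Qed.
Lemma cmodB z w : cmod (z - w) = cmod (w - z). Proof. by rewrite -opprB cmodN. Qed.
Lemma cmodBD z w : cmod (z - w) <= cmod z + cmod w.
Proof. by rewrite -(cmodN w); exact: cmodD. Qed.
Lemma cmod_dist z w x : cmod (z - x) <= cmod (z - w) + cmod (w - x).
Proof. by apply: le_trans (cmodD _ _); rewrite addrA subrK. Qed.
Lemma cmod_eq0 z : (cmod z == 0) = (z == 0).
Proof.
by apply/eqP/eqP => [/Normc.eq0_normc//|->]; exact: cmod0.
Qed.
Lemma cmod_gt0 z : (0 < cmod z) = (z != 0).
Proof. by rewrite lt0r cmod_eq0 cmod_ge0 andbT. Qed.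
Lemma cmodR (x : R) : cmod x%:C = `|x|.
Proof. by rewrite /cmod /Normc.normc /= expr0n /= addr0 sqrtr_sqr. Qed.
Lemma cmod_sqr z : cmod z ^+ 2 = complex.Re z ^+ 2 + complex.Im z ^+ 2.
Proof.
by case: z => a b; rewrite /cmod /Normc.normc /= sqr_sqrtr// addr_ge0 ?sqr_ge0.
Qed.
Lemma cmodi : cmod 'i = 1.
Proof. by rewrite /cmod /Normc.normc /= expr0n /= add0r expr1n sqrtr1. Qed.
Lemma cmod_Re z : `|complex.Re z| <= cmod z.
Proof.
rewrite -(@ler_pXn2r _ 2) ?nnegrE ?cmod_ge0// cmod_sqr real_normK ?num_real//.
by rewrite lerDl sqr_ge0.
Qed.
Lemma cmod_Im z : `|complex.Im z| <= cmod z.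
Proof.
rewrite -(@ler_pXn2r _ 2) ?nnegrE ?cmod_ge0// cmod_sqr real_normK ?num_real//.
by rewrite lerDr sqr_ge0.
Qed.
Lemma cmod_le_ReIm z : cmod z <= `|complex.Re z| + `|complex.Im z|.
Proof.
have -> : z = (complex.Re z)%:C + 'i * (complex.Im z)%:C.
  by case: z => a b; apply/eqP; rewrite eq_complex /=; apply/andP; split;
     apply/eqP; ring.
apply: le_trans (cmodD _ _) _; rewrite cmodM cmodi mul1r !cmodR /=.
by rewrite !(mul0r, mul1r, subr0, addr0, add0r).
Qed.

Lemma nbhs_cmod z (A : set R[i]) :
  nbhs z A <-> exists2 r : R, 0 < r & forall w, cmod (w - z) < r -> A w.
Proof.
split=> [|[r r0 h]].
  move=> /nbhs_normP[[r i]] /=; rewrite ltcE /= => /andP[/eqP -> r0] h.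
  exists r => // w wz; apply: h => /=; rewrite distrC.
  by rewrite [ `|_| ]cmodE ltcR.
apply/nbhs_normP; exists r%:C; first by rewrite /= ltcR.
by move=> w /=; rewrite distrC [ `|_| ]cmodE ltcR; exact: h.
Qed.

Lemma open_cmod (D : set R[i]) : open D <->
  forall z, D z -> exists2 r : R, 0 < r & forall w, cmod (w - z) < r -> D w.
Proof.
rewrite openE; split=> h z /h; first by move/nbhs_cmod.
by move=> h'; apply/nbhs_cmod.
Qed.

End Modulus.

Section Derivation.
Variables (R : realType) (X : Type) (j : X -> R[i]).
Implicit Types (F G : X -> R[i]) (x y : X).

(** Derivative with respect to the coordinate [j].  The identity gives complex
    derivatives and the embedding of the reals gives derivatives of curves, so
    that the rules of calculus are proved once for both. *)
Definition gder F x (L : R[i]) := forall e : R, 0 < e -> exists2 d, 0 < d &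
  forall y, cmod (j y - j x) < d ->
    cmod (F y - F x - L * (j y - j x)) <= e * cmod (j y - j x).

Lemma gder_cst c x : gder (fun _ => c) x 0.
Proof.
move=> e e0; exists 1 => // y _.
by rewrite subrr mul0r subrr cmod0 mulr_ge0 ?cmod_ge0// ltW.
Qed.

Lemma gder_coord x : gder j x 1.
Proof.
move=> e e0; exists 1 => // y _.
by rewrite mul1r subrr cmod0 mulr_ge0 ?cmod_ge0// ltW.
Qed.

Lemma gderD F G x L K : gder F x L -> gder G x K ->
  gder (fun y => F y + G y) x (L + K).
Proof.
move=> hF hG e e0; have e2 : 0 < e / 2 by lra.
have [d1 d10 h1] := hF _ e2; have [d2 d20 h2] := hG _ e2.
exists (Num.min d1 d2); first by rewrite lt_min d10.
move=> y; rewrite lt_min => /andP[/h1 {}h1 /h2 {}h2].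
have -> : F y + G y - (F x + G x) - (L + K) * (j y - j x) =
  (F y - F x - L * (j y - j x)) + (G y - G x - K * (j y - j x)) by ring.
by apply: le_trans (cmodD _ _) _; lra.
Qed.

Lemma gder_lip F x L : gder F x L -> exists2 d, 0 < d &
  forall y, cmod (j y - j x) < d -> cmod (F y - F x) <= (cmod L + 1) * cmod (j y - j x).
Proof.
move=> hF; have [d d0 h] := hF 1 ltr01; exists d => // y /h {}h.
have -> : F y - F x = (F y - F x - L * (j y - j x)) + L * (j y - j x) by ring.
by apply: le_trans (cmodD _ _) _; rewrite cmodM mulrDl addrC lerD2l.
Qed.

Lemma gderM F G x L K : gder F x L -> gder G x K ->
  gder (fun y => F y * G y) x (L * G x + F x * K).
Proof.
move=> hF hG e e0.
pose S := cmod (F x) + cmod (G x) + 1.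
have S0 : 0 < S by rewrite /S; have := cmod_ge0 (F x); have := cmod_ge0 (G x); lra.
pose N := (cmod L + 1) * (cmod K + 1).
have N0 : 0 < N.
  by rewrite mulr_gt0//; [have := cmod_ge0 L|have := cmod_ge0 K]; lra.
have eS : 0 < e / 2 / S by rewrite !divr_gt0.
have eN : 0 < e / 2 / N by rewrite !divr_gt0.
have [d1 d10 h1] := hF _ eS; have [d2 d20 h2] := hG _ eS.
have [d3 d30 h3] := gder_lip hF; have [d4 d40 h4] := gder_lip hG.
exists (Num.min (Num.min d1 d2) (Num.min (Num.min d3 d4) (e / 2 / N))).
  by rewrite !lt_min d10 d20 d30 d40.
move=> y; rewrite !lt_min => /andP[/andP[/h1 {}h1 /h2 {}h2]].
move=> /andP[/andP[/h3 {}h3 /h4 {}h4] hN].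
set h := j y - j x in h1 h2 h3 h4 hN *.
have -> : F y * G y - F x * G x - (L * G x + F x * K) * h =
  (F y - F x - L * h) * G x + F x * (G y - G x - K * h) + (F y - F x) * (G y - G x).
  by ring.
apply: le_trans (cmodD _ _) _.
have hh := cmod_ge0 h.
have b1 : cmod ((F y - F x - L * h) * G x + F x * (G y - G x - K * h)) <=
    e / 2 * cmod h.
  apply: le_trans (cmodD _ _) _; rewrite !cmodM.
  have := ler_wpM2r (cmod_ge0 (G x)) h1; have := ler_wpM2l (cmod_ge0 (F x)) h2.
  have -> : e / 2 * cmod h = e / 2 / S * cmod h * S by field; exact: lt0r_neq0.
  have t0 : 0 <= e / 2 / S * cmod h by rewrite mulr_ge0// ltW.
  by rewrite {4}/S; move: t0; set t := e / 2 / S * cmod h; lra.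
have b2 : cmod ((F y - F x) * (G y - G x)) <= e / 2 * cmod h.
  rewrite cmodM; apply: le_trans (ler_pM _ _ h3 h4) _; rewrite ?cmod_ge0//.
  have -> : (cmod L + 1) * cmod h * ((cmod K + 1) * cmod h) = N * cmod h * cmod h.
    by rewrite /N; ring.
  rewrite ler_wpM2r//.
  by move: hN => /ltW; rewrite ler_pdivlMr// mulrC.
lra.
Qed.

Lemma gder_ext F G x L (r : R) : 0 < r ->
  (forall y, cmod (j y - j x) < r -> F y = G y) -> gder F x L -> gder G x L.
Proof.
move=> r0 FG hF e /hF[d d0 h]; exists (Num.min d r); first by rewrite lt_min d0.
move=> y; rewrite lt_min => /andP[yd yr].
by rewrite -(FG y yr) -(FG x) ?subrr ?cmod0//; exact: h.
Qed.

End Derivation.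

Section ComplexDerivative.
Variable R : realType.
Implicit Types (F G : R[i] -> R[i]) (z w L : R[i]).

Definition cder F z L := gder (fun w : R[i] => w) F z L.
Definition rder (g : R -> R[i]) (t : R) (v : R[i]) := gder (fun s : R => s%:C) g t v.

Lemma gder_comp X (j : X -> R[i]) F (g : X -> R[i]) x L v :
  cder F (g x) L -> gder j g x v -> gder j (fun y => F (g y)) x (L * v).
Proof.
move=> hF hg e e0.
pose N := cmod v + 1; have N0 : 0 < N by rewrite /N; have := cmod_ge0 v; lra.
pose S := cmod L + 1; have S0 : 0 < S by rewrite /S; have := cmod_ge0 L; lra.
have eS : 0 < e / 2 / S by rewrite !divr_gt0.
have eN : 0 < e / 2 / N by rewrite !divr_gt0.
have [d1 d10 h1] := hF _ eN; have [d2 d20 h2] := hg _ eS.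
have [d3 d30 h3] := gder_lip hg.
exists (Num.min (Num.min d2 d3) (d1 / N)).
  by rewrite !lt_min d20 d30 divr_gt0.
move=> y; rewrite !lt_min => /andP[/andP[/h2 {}h2 /h3 {}h3] hN].
set h := j y - j x in h2 h3 hN *.
have {}h1 := h1 (g y).
have gy : cmod (g y - g x) < d1.
  by apply: le_lt_trans h3 _; rewrite mulrC -ltr_pdivlMr.
have -> : F (g y) - F (g x) - L * v * h =
  (F (g y) - F (g x) - L * (g y - g x)) + L * (g y - g x - v * h) by ring.
apply: le_trans (cmodD _ _) _; rewrite cmodM.
have b1 : e / 2 / N * cmod (g y - g x) <= e / 2 * cmod h.
  have -> : e / 2 * cmod h = e / 2 / N * (N * cmod h) by field; exact: lt0r_neq0.
  by rewrite ler_pM2l.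
have b2 : cmod L * cmod (g y - g x - v * h) <= e / 2 * cmod h.
  have -> : e / 2 * cmod h = S * (e / 2 / S * cmod h) by field; exact: lt0r_neq0.
  by rewrite ler_pM ?cmod_ge0// /S lerDl.
have := h1 gy; lra.
Qed.

Lemma cder_inv z : z != 0 -> cder (fun w => w^-1) z (- z ^- 2).
Proof.
move=> z0 e e0; have c0 : 0 < cmod z by rewrite cmod_gt0.
exists (Num.min (cmod z / 2) (e * cmod z ^+ 3 / 2)).
  by rewrite lt_min !divr_gt0// mulr_gt0// exprn_gt0.
move=> w; rewrite lt_min => /andP[h1 h2].
have wz : cmod z / 2 < cmod w.
  by have := cmodD (z - w) w; rewrite subrK cmodB; lra.
have w0 : w != 0 by rewrite -cmod_gt0; lra.
have -> : w^-1 - z^-1 - - z ^- 2 * (w - z) = (w - z) * (w - z) / (w * z ^+ 2).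
  by field; apply/andP.
rewrite cmodM cmodV [cmod (w * _)]cmodM cmodX cmodM mulrAC ler_wpM2r ?cmod_ge0//.
have c1 : 0 < cmod w by rewrite cmod_gt0.
rewrite ler_pdivrMr; last by rewrite mulr_gt0// exprn_gt0.
apply: le_trans (ltW h2) _.
have -> : e * cmod z ^+ 3 / 2 = e * (cmod z / 2 * cmod z ^+ 2) by ring.
by rewrite ler_pM2l// ler_wpM2r ?exprn_ge0 ?cmod_ge0// ltW.
Qed.

Lemma gder_unique X (j : X -> R[i]) (F : X -> R[i]) x L K :
  (forall r, 0 < r -> exists2 y, 0 < cmod (j y - j x) & cmod (j y - j x) < r) ->
  gder j F x L -> gder j F x K -> L = K.
Proof.
move=> acc hL hK; apply/eqP; rewrite -subr_eq0 -cmod_eq0; apply/eqP/le_anti.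
rewrite cmod_ge0 andbT; apply: le_pinch => e e0; rewrite add0r.
have e2 : 0 < e / 4 by lra.
have [d1 d10 h1] := hL _ e2; have [d2 d20 h2] := hK _ e2.
have r0 : 0 < Num.min d1 d2 by rewrite lt_min d10.
have [y y0] := acc _ r0; rewrite lt_min => /andP[/h1 k1 /h2 k2].
have : cmod ((L - K) * (j y - j x)) <= e / 2 * cmod (j y - j x).
  have -> : (L - K) * (j y - j x) = (F y - F x - K * (j y - j x)) -
    (F y - F x - L * (j y - j x)) by ring.
  by apply: le_trans (cmodBD _ _) _; lra.
rewrite cmodM ler_pM2r//; lra.
Qed.

Lemma cder_unique F z L K : cder F z L -> cder F z K -> L = K.
Proof.
apply: gder_unique => r r0; exists (z + (r / 2)%:C);
  rewrite /= [z + _]addrC addrK cmodR gtr0_norm; lra.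
Qed.

Lemma rder_unique (g : R -> R[i]) t v w : rder g t v -> rder g t w -> v = w.
Proof.
apply: gder_unique => r r0.
have e : (t + r / 2)%:C - t%:C = (r / 2)%:C :> R[i].
  by rewrite -rmorphB /= [t + _]addrC addrK.
by exists (t + r / 2); rewrite e cmodR gtr0_norm; lra.
Qed.

Lemma cder_id z : cder (fun w => w) z 1. Proof. exact: gder_coord. Qed.

Lemma gder_sub X (j : X -> R[i]) (F G : X -> R[i]) x L K :
  gder j F x L -> gder j G x K -> gder j (fun y => F y - G y) x (L - K).
Proof.
move=> hF hG.
have h : gder j (fun y => -1 * G y) x (0 * G x + -1 * K).
  by apply: gderM => //; exact: gder_cst.
have := gderD hF h; rewrite mul0r add0r mulN1r.
by apply: gder_ext (ltr01) _ => y _; rewrite mulN1r.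
Qed.

Lemma gder_scale X (j : X -> R[i]) (G : X -> R[i]) c x K :
  gder j G x K -> gder j (fun y => c * G y) x (c * K).
Proof.
by move=> h; have := gderM (gder_cst j c x) h; rewrite mul0r add0r.
Qed.

Lemma gder_div X (j : X -> R[i]) (F G : X -> R[i]) x L K : G x != 0 ->
  gder j F x L -> gder j G x K ->
  gder j (fun y => F y / G y) x ((L * G x - F x * K) / G x ^+ 2).
Proof.
move=> g0 hF hG; have := gderM hF (gder_comp (cder_inv g0) hG).
by congr gder; field.
Qed.

Lemma cderP F z : derivable F z 1 <-> exists L, cder F z L.
Proof.
split=> [|[L hL]].
  move=> /cvg_ex[L /= hL]; exists L => e e0.
  have /cvgrPdist_le /(_ e%:C) := hL; rewrite ltcR => /(_ e0).
  rewrite /dnbhs /within /= => /nbhs_cmod[d d0 hd].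
  exists d => // w wd; case: (eqVneq w z) => [->|wz].
    by rewrite !subrr mulr0 subrr cmod0 mulr0.
  have wz0 : w - z != 0 by rewrite subr_eq0.
  have := hd (w - z); rewrite subr0 => /(_ wd wz0).
  rewrite [ `|_| ]cmodE lecR => h.
  have : cmod (w - z) * cmod (L - (w - z)^-1 *: (F ((w - z) *: 1 + z) - F z)) <=
     cmod (w - z) * e by rewrite ler_wpM2l ?cmod_ge0.
  rewrite -cmodM mulrC [e * _]mulrC => /(le_trans _); apply.
  rewrite -[leLHS]cmodN; apply: eq_ler; congr cmod.
  rewrite /GRing.scale /= mulr1 subrK.
  by field.
apply/cvg_ex; exists L => /=; apply/cvgrPdist_le => -[e i].
rewrite ltcE /= => /andP[/eqP -> e0].
have [d d0 hd] := hL e e0.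
apply/nbhs_cmod; exists d => // h; rewrite subr0 => hd' h0.
have := hd (h + z); rewrite addrK => /(_ hd').
have c0 : 0 < cmod h by rewrite cmod_gt0.
rewrite [ `|_| ]cmodE lecR => hh.
rewrite -(ler_pM2r c0) -cmodM; apply: le_trans hh; rewrite -cmodN; apply: eq_ler.
congr cmod; rewrite /GRing.scale /= mulr1.
by field.
Qed.

End ComplexDerivative.

Section Curves.
Variable R : realType.
Implicit Types (F G : R[i] -> R[i]) (g : R -> R[i]) (t : R) (z w L v : R[i]).

Lemma realB (s t : R) : s%:C - t%:C = (s - t)%:C :> R[i].
Proof. by rewrite -rmorphB. Qed.

Lemma Re_rem z w v (s : R) :
  complex.Re (z - w - v * s%:C) = complex.Re z - complex.Re w - complex.Re v * s.
Proof. by case: z w v => [a b] [a' b'] [c d'] /=; ring. Qed.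

Lemma Im_rem z w v (s : R) :
  complex.Im (z - w - v * s%:C) = complex.Im z - complex.Im w - complex.Im v * s.
Proof. by case: z w v => [a b] [a' b'] [c d'] /=; ring. Qed.

Lemma rder_Re g t v : rder g t v -> is_derive t 1 (fun s => complex.Re (g s)) (complex.Re v).
Proof.
move=> h; apply: eps_is_derive => e /h[d d0 hd]; exists d => // s sd.
have := hd s; rewrite realB cmodR => /(_ sd); apply: le_trans.
by rewrite -Re_rem; exact: cmod_Re.
Qed.

Lemma rder_Im g t v : rder g t v -> is_derive t 1 (fun s => complex.Im (g s)) (complex.Im v).
Proof.
move=> h; apply: eps_is_derive => e /h[d d0 hd]; exists d => // s sd.
have := hd s; rewrite realB cmodR => /(_ sd); apply: le_trans.
by rewrite -Im_rem; exact: cmod_Im.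
Qed.

Lemma rder_ReIm (a b : R -> R) (t va vb : R) :
  is_derive t 1 a va -> is_derive t 1 b vb ->
  rder (fun s => (a s +i* b s)%C) t (va +i* vb)%C.
Proof.
move=> ha hb e e0; have e2 : 0 < e / 2 by lra.
have [d1 d10 h1] := is_derive_eps ha e2; have [d2 d20 h2] := is_derive_eps hb e2.
exists (Num.min d1 d2); first by rewrite lt_min d10.
move=> s; rewrite realB cmodR lt_min => /andP[/h1 k1 /h2 k2].
by apply: le_trans (cmod_le_ReIm _) _; rewrite Re_rem Im_rem /=; lra.
Qed.

Lemma complexRI z : z = (complex.Re z +i* complex.Im z)%C.
Proof. by case: z. Qed.

Lemma rder_const_dir z v t : rder (fun s => z + s%:C * v) t v.
Proof.
have h1 : rder (fun s => s%:C) t 1 by exact: gder_coord.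
have := gderD (gder_cst _ z t) (gderM h1 (gder_cst _ v t)).
by rewrite mulr0 addr0 add0r mul1r.
Qed.

(** The real mean value theorem applied to the component of [g] in the direction
    of its total increment. *)
Lemma curve_mean_value g (dg : R -> R[i]) (s t M : R) : s <= t ->
  (forall x, s <= x <= t -> rder g x (dg x)) ->
  (forall x, s <= x <= t -> cmod (dg x) <= M) ->
  cmod (g t - g s) <= M * (t - s).
Proof.
move=> st hd hM.
set u := g t - g s.
case: (eqVneq u 0) => [u0|u0].
  rewrite u0 cmod0 mulr_ge0 ?subr_ge0//.
  by apply: le_trans (hM s _); [exact: cmod_ge0|rewrite lexx].
have cu : 0 < cmod u by rewrite cmod_gt0.
pose f x := complex.Re (u^*%C * g x).
have := @mean_value_le R f (fun x => complex.Re (u^*%C * dg x)) s t (cmod u * M) st.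
have cj : cmod (u^*%C) = cmod u.
  by rewrite /cmod /Normc.normc; case: (u) => a b /=; rewrite sqrrN.
have -> : f t - f s = cmod u ^+ 2.
  rewrite cmod_sqr /f.
  have -> : complex.Re (u^*%C * g t) - complex.Re (u^*%C * g s) = complex.Re (u^*%C * u).
    have -> : u^*%C * u = u^*%C * g t - u^*%C * g s by rewrite -mulrBr.
    by case: (u^*%C * g t) (u^*%C * g s) => [a b] [c d].
  by case: (u) => a b /=; ring.
rewrite ger0_norm ?exprn_ge0 ?cmod_ge0// expr2 -mulrA ler_pM2l//; apply.
  move=> x hx; apply: (@rder_Re (fun x => u^*%C * g x)).
  by apply: gder_scale; exact: hd.
move=> x hx; apply: le_trans (cmod_Re _) _; rewrite cmodM cj ler_pM2l//.
exact: hM.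
Qed.

Lemma curve_mean_value2 g (dg : R -> R[i]) (s t M : R) :
  (forall x, Num.min s t <= x <= Num.max s t -> rder g x (dg x)) ->
  (forall x, Num.min s t <= x <= Num.max s t -> cmod (dg x) <= M) ->
  cmod (g t - g s) <= M * `|t - s|.
Proof.
case: (leP s t) => st.
  by move=> h1 h2; rewrite ger0_norm ?subr_ge0//; exact: (curve_mean_value st h1 h2).
move=> h1 h2; rewrite cmodB distrC ger0_norm; last by rewrite subr_ge0 ltW.
exact: (curve_mean_value (ltW st) h1 h2).
Qed.

Lemma cder_mean_value F (dF : R[i] -> R[i]) z w (M : R) :
  (forall t : R, 0 <= t <= 1 -> cder F (z + t%:C * (w - z)) (dF (z + t%:C * (w - z)))) ->
  (forall t : R, 0 <= t <= 1 -> cmod (dF (z + t%:C * (w - z))) <= M) ->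
  cmod (F w - F z) <= M * cmod (w - z).
Proof.
move=> hd hM.
have := @curve_mean_value (fun t => F (z + t%:C * (w - z)))
  (fun t => dF (z + t%:C * (w - z)) * (w - z)) 0 1 (M * cmod (w - z)) ler01.
rewrite rmorph1 rmorph0 mul1r mul0r addr0 subr0 mulr1 [z + (w - z)]addrC subrK; apply.
  by move=> x hx; apply: gder_comp; [exact: hd|exact: rder_const_dir].
by move=> x hx; rewrite cmodM ler_wpM2r ?cmod_ge0// hM.
Qed.

End Curves.

Section CauchyRiemann.
Variable R : realType.
Implicit Types (f F G : R[i] -> R[i]) (A : rect R).

Definition cross_der f (x y : R) (L : R[i]) :=
  rder (fun t => f (t +i* y)%C) x L /\ rder (fun t => f (x +i* t)%C) y ('i * L).

Lemma imul (a b : R) : 'i * (a +i* b)%C = (- b +i* a)%C.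
Proof. by apply/eqP; rewrite eq_complex /=; apply/andP; split; apply/eqP; ring. Qed.

Lemma cder_cross f x y L : cder f (x +i* y)%C L -> cross_der f x y L.
Proof.
move=> h; split.
  have h2 : rder (fun t => (t +i* y)%C) x 1.
    exact: rder_ReIm.
  by have := gder_comp h h2; rewrite mulr1.
have h2 : rder (fun t => (x +i* t)%C) y 'i.
  exact: rder_ReIm.
by have := gder_comp h h2; rewrite mulrC.
Qed.

(** For f = u + i v the Cauchy-Riemann equations say that u dx - v dy and
    v dx + u dy have equal cross derivatives. *)
Lemma cross_der_primitive f (df : R -> R -> R[i]) A (M : R) :
  (forall x y, inrect A x y -> cross_der f x y (df x y)) ->
  (forall x y, inrect A x y -> cmod (f (x +i* y)%C) <= M) ->
  exists G, forall x y, inside A x y -> cross_der G x y (f (x +i* y)%C).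
Proof.
move=> hd hM.
pose u x y := complex.Re (f (x +i* y)%C); pose v x y := complex.Im (f (x +i* y)%C).
pose ux x y := complex.Re (df x y); pose vx x y := complex.Im (df x y).
have dux x y : inrect A x y -> is_derive x 1 (u^~ y) (ux x y).
  by move=> /hd[h _]; exact: rder_Re h.
have dvx x y : inrect A x y -> is_derive x 1 (v^~ y) (vx x y).
  by move=> /hd[h _]; exact: rder_Im h.
have duy x y : inrect A x y -> is_derive y 1 (u x) (- vx x y).
  move=> /hd[_ h]; have := rder_Re h; rewrite /vx.
  by case: (df x y) => a b; rewrite imul.
have dvy x y : inrect A x y -> is_derive y 1 (v x) (ux x y).
  move=> /hd[_ h]; have := rder_Im h; rewrite /ux.
  by case: (df x y) => a b; rewrite imul.
have bu x y : inrect A x y -> `|u x y| <= M.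
  by move=> /hM; apply: le_trans; exact: cmod_Re.
have bv x y : inrect A x y -> `|v x y| <= M.
  by move=> /hM; apply: le_trans; exact: cmod_Im.
have [H1 hH1] := @potential R u (fun x y => - v x y) ux (fun x y => - vx x y)
  (fun x y => - ux x y) A M dux duy (fun x y h => is_deriveN (dvx x y h))
  (fun x y h => is_deriveN (dvy x y h)) bu
  (fun x y h => eq_ind_r (fun r => r <= M) (bv x y h) (normrN _)).
have [H2 hH2] := @potential R v u vx ux (fun x y => - vx x y) A M dvx dvy dux duy bv bu.
exists (fun z => (H1 (complex.Re z) (complex.Im z) +i* H2 (complex.Re z) (complex.Im z))%C).
move=> x y xy; have [h1 h2] := hH1 x y xy; have [h3 h4] := hH2 x y xy.
split=> /=; first by rewrite [f _]complexRI; exact: rder_ReIm.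
by rewrite [f _]complexRI imul; exact: rder_ReIm.
Qed.

(** Go from one point to the other along a horizontal and a vertical segment, on
    which the partial derivatives are close to their values at the first one. *)
Lemma continuous_cross_cder f G A x y : inside A x y ->
  (forall x y, inside A x y -> cross_der G x y (f (x +i* y)%C)) ->
  (forall e, 0 < e -> exists2 d, 0 < d &
     forall w, cmod (w - (x +i* y)%C) < d -> cmod (f w - f (x +i* y)%C) <= e) ->
  cder G (x +i* y)%C (f (x +i* y)%C).
Proof.
move=> xy hG cf e e0; have e2 : 0 < e / 2 by lra.
have [d d0 hd] := cf _ e2.
pose r := Num.min d (Num.min (Num.min (x - xl A) (xr A - x)) (Num.min (y - yl A) (yr A - y))).
have r0 : 0 < r by rewrite !lt_min d0 /=; case: xy => ? ?; apply/andP; split; lra.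
exists r => // w; set z := (x +i* y)%C; move=> wr.
set a := complex.Re w; set b := complex.Im w.
have wE : w = (a +i* b)%C by exact: complexRI.
have wz : w - z = ((a - x) +i* (b - y))%C by rewrite /a /b /z; case: (w).
have ax : `|a - x| <= cmod (w - z) by have := cmod_Re (w - z); rewrite wz.
have yb : `|b - y| <= cmod (w - z) by have := cmod_Im (w - z); rewrite wz.
set k := cmod (w - z) in wr ax yb *.
have : r <= d /\ (r <= x - xl A /\ r <= xr A - x) /\ (r <= y - yl A /\ r <= yr A - y).
  by rewrite !ge_min !lexx !orbT.
move=> [rd [[r1 r2] [r3 r4]]].
have nearz s t : Num.min x a <= s <= Num.max x a -> Num.min y b <= t <= Num.max y b ->
    inside A s t /\ cmod (f (s +i* t)%C - f z) <= e / 2.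
  move=> hs ht.
  have sx : `|s - x| <= `|a - x|.
    move: hs; rewrite real_ler_norml ?num_real//.
    by case: (leP x a) => xa; [rewrite ger0_norm|rewrite ltr0_norm]; lra.
  have ty : `|t - y| <= `|b - y|.
    move: ht; rewrite real_ler_norml ?num_real//.
    by case: (leP y b) => ya; [rewrite ger0_norm|rewrite ltr0_norm]; lra.
  split.
    have : `|s - x| < r /\ `|t - y| < r by split; lra.
    by rewrite /inside !ltr_norml; lra.
  apply: hd; apply: lt_le_trans rd; apply: le_lt_trans wr.
  rewrite -(@ler_pXn2r _ 2) ?nnegrE ?cmod_ge0// /k wz !cmod_sqr /=.
  apply: lerD; rewrite -(real_normK (num_real (s - x))) -(real_normK (num_real (a - x)))
    || rewrite -(real_normK (num_real (t - y))) -(real_normK (num_real (b - y)));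
  by rewrite ler_pXn2r ?nnegrE.
have h1 : cmod (G (a +i* b)%C - f z * a%:C - (G (x +i* b)%C - f z * x%:C)) <= e / 2 * `|a - x|.
  apply: (@curve_mean_value2 R (fun t => G (t +i* b)%C - f z * t%:C)
     (fun t => f (t +i* b)%C - f z * 1)) => t ht.
    have [i _] := nearz t b ht ltac:(by rewrite ge_min le_max lexx !orbT).
    by apply: gder_sub; [have [] := hG _ _ i|apply: gder_scale; exact: gder_coord].
  by rewrite mulr1; have [] := nearz t b ht ltac:(by rewrite ge_min le_max lexx !orbT).
have h2 : cmod (G (x +i* b)%C - f z * 'i * b%:C - (G (x +i* y)%C - f z * 'i * y%:C))
    <= e / 2 * `|b - y|.
  apply: (@curve_mean_value2 R (fun t => G (x +i* t)%C - f z * 'i * t%:C)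
     (fun t => 'i * f (x +i* t)%C - f z * 'i * 1)) => t ht.
    have [i _] := nearz x t ltac:(by rewrite ge_min le_max lexx) ht.
    by apply: gder_sub; [have [] := hG _ _ i|apply: gder_scale; exact: gder_coord].
  rewrite mulr1 mulrC -mulrBl cmodM cmodi mulr1.
  by have [] := nearz x t ltac:(by rewrite ge_min le_max lexx) ht.
have -> : G w - G z - f z * (w - z) =
  (G (a +i* b)%C - f z * a%:C - (G (x +i* b)%C - f z * x%:C)) +
  (G (x +i* b)%C - f z * 'i * b%:C - (G (x +i* y)%C - f z * 'i * y%:C)).
  have -> : w - z = a%:C - x%:C + 'i * (b%:C - y%:C).
    by rewrite wz !realB; apply/eqP; rewrite eq_complex /=; apply/andP; split;
       apply/eqP; ring.
  by rewrite -wE; ring.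
apply: le_trans (cmodD _ _) _.
have := ler_wpM2l (ltW e2) ax; have := ler_wpM2l (ltW e2) yb.
by move: h1 h2; lra.
Qed.

End CauchyRiemann.

(** * Holomorphic functions *)

Section Holomorphic.
Variable R : realType.
Implicit Types (F G : R[i] -> R[i]) (z w L : R[i]) (D : set R[i]).

Definition disc z (r : R) : set R[i] := [set w | cmod (w - z) < r].
Definition hol D F := forall z, D z -> exists L, cder F z L.
(** The derivative, with an arbitrary value where there is none. *)
Definition dC F z : R[i] := get [set L | cder F z L].

Lemma dCE F z L : cder F z L -> dC F z = L.
Proof.
move=> h; apply: (@cder_unique R F z) => //.
by rewrite /dC; case: xgetP => [w -> //|/(_ L) /=].
Qed.

Lemma hol_cder D F z : hol D F -> D z -> cder F z (dC F z).
Proof. by move=> h /h[L hL]; rewrite (dCE hL). Qed.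

Lemma hol_sub D D' F : D `<=` D' -> hol D' F -> hol D F.
Proof. by move=> DD h z /DD/h. Qed.

Lemma disc_sub z w r s : s + cmod (w - z) <= r -> disc w s `<=` disc z r.
Proof.
move=> h x /=; rewrite /disc /= => xw.
have := cmod_dist x w z; lra.
Qed.

(** The exponential of [s + i t]. *)
Definition cexp (s t : R) : R[i] := (expR s * cos t +i* (expR s * sin t))%C.

Lemma cmod_cexp s t : cmod (cexp s t) = expR s.
Proof.
apply/eqP; rewrite -(@eqrXn2 _ 2) ?cmod_ge0 ?expR_ge0// cmod_sqr /=.
by rewrite !exprMn -mulrDr cos2Dsin2 mulr1.
Qed.

Lemma cexp_neq0 s t : cexp s t != 0.
Proof. by rewrite -cmod_gt0 cmod_cexp expR_gt0. Qed.

Lemma cexp_per s : cexp s (2 * pi) = cexp s 0.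
Proof. by rewrite /cexp mulr_natl cos2pi sin2pi cos0 sin0. Qed.

Lemma cexp_rderl s t : rder (cexp^~ t) s (cexp s t).
Proof.
apply: rder_ReIm.
  have := is_deriveM (is_derive_expR s) (is_derive_cst (cos t) s 1).
  by move/is_derive_eq; apply; rewrite scaler0 add0r /GRing.scale /= mulrC.
have := is_deriveM (is_derive_expR s) (is_derive_cst (sin t) s 1).
by move/is_derive_eq; apply; rewrite scaler0 add0r /GRing.scale /= mulrC.
Qed.

Lemma cexp_rderr s t : rder (cexp s) t ('i * cexp s t).
Proof.
rewrite /cexp imul; apply: rder_ReIm.
have := is_deriveM (is_derive_cst (expR s) t 1) (is_derive_cos t).
by move/is_derive_eq; apply; rewrite scaler0 addr0 /GRing.scale /= mulrN.
Qed.

(** In the coordinate log (w - z) the form F(w) / (w - z)^2 dw is given by the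
    function F(w) / (w - z), which has a primitive on a strip of height 2 pi.
    The increment of this primitive over a period does not depend on the radius
    |w - z|.  On small circles it tends to 2 pi i F'(z), and on the circle of
    radius [r] it is at most 2 pi M / r. *)
Lemma cauchy_estimate F z L (M r d : R) : 0 < r -> r < d ->
  hol (disc z d) F -> (forall w, disc z d w -> cmod (F w) <= M) ->
  cder F z L -> cmod L <= M / r.
Proof.
move=> r0 rd hF hM hL.
have M0 : 0 <= M.
  by apply: le_trans (cmod_ge0 _) (hM z _); rewrite /disc /= subrr cmod0; lra.
apply: le_pinch => e e0.
have [k k0 hk] := hL (e / 2) ltac:(lra).
(* The radius of the small circle. *)
pose q := Num.min k r / 2.
have q0 : 0 < q by rewrite divr_gt0// lt_min k0.
have [qk qr] : q < k /\ q < r by rewrite /q; split; case: (leP k r) => ?; lra.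
pose s0 := ln q; pose s1 := ln r; pose s2 := ln ((r + d) / 2).
have e0E : expR s0 = q by rewrite lnK ?posrE.
have e1E : expR s1 = r by rewrite lnK ?posrE.
have e2E : expR s2 = (r + d) / 2 by rewrite lnK ?posrE//; lra.
have s01 : s0 < s1 by rewrite ltr_ln ?posrE.
have s12 : s1 < s2 by rewrite ltr_ln ?posrE//; lra.
have pi0 := pi_gt0 R.
pose A := Rect (s0 - 1) s2 (- 1) (2 * pi + 1) : rect R.
pose W w := F (z + w) / w.
pose f w := W (cexp (complex.Re w) (complex.Im w)).
have inD x y : x <= s2 -> disc z d (z + cexp x y).
  move=> xs; rewrite /disc /= addrC addKr cmod_cexp.
  by apply: (@le_lt_trans _ _ (expR s2)); [rewrite ler_expR|rewrite e2E; lra].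
have dW x y : x <= s2 -> cder W (cexp x y) (dC W (cexp x y)).
  move=> xs; have [K hK] := hF _ (inD x y xs).
  have h1 : cder (fun w => F (z + w)) (cexp x y) (K * (0 + 1)).
    by apply: (gder_comp hK); apply: gderD; [exact: gder_cst|exact: cder_id].
  have h2 := @gder_div R R[i] _ _ (fun w => w) _ _ _ (cexp_neq0 x y) h1 (cder_id _).
  by rewrite (dCE h2).
have cf x y : inrect A x y -> cross_der f x y (dC W (cexp x y) * cexp x y).
  move=> [/andP[_ /= xs] _]; split.
    exact: (@gder_comp R R _ W (cexp^~ y) x _ _ (dW x y xs) (cexp_rderl x y)).
  by rewrite mulrCA; exact: (@gder_comp R R _ W (cexp x) y _ _ (dW x y xs) (cexp_rderr x y)).
have bf x y : x <= s2 -> cmod (f (x +i* y)%C) <= M / expR x.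
  move=> xs; rewrite /f /W /= cmodM cmodV cmod_cexp ler_pM2r ?invr_gt0 ?expR_gt0//.
  by apply: hM; exact: inD.
have [|G hG] := cross_der_primitive cf (M := M / expR (s0 - 1)).
  move=> x y [/andP[/= x1 x2] _]; apply: le_trans (bf x y x2) _.
  by rewrite ler_wpM2l// lef_pV2 ?posrE ?expR_gt0// ler_expR.
pose C s := G (s +i* (2 * pi))%C - G (s +i* 0)%C.
have inA s t : s0 <= s <= s1 -> 0 <= t <= 2 * pi -> inside A s t.
  by rewrite /inside /=; lra.
have t0 : (0 : R) <= 0 <= 2 * (pi : R) by lra.
have t2 : (0 : R) <= 2 * (pi : R) <= 2 * (pi : R) by lra.
have i0 : s0 <= s0 <= s1 by lra.
have i1 : s0 <= s1 <= s1 by lra.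
(* The form has period 2 pi i, so the increment [C] has derivative 0. *)
have C01 : C s1 = C s0.
  have := @curve_mean_value R C (fun s => f (s +i* (2 * pi))%C - f (s +i* 0)%C)
     s0 s1 0 (ltW s01).
  rewrite mul0r => h; apply/eqP; rewrite -subr_eq0 -cmod_eq0; apply/eqP/le_anti.
  rewrite cmod_ge0 andbT; apply: h => s hs.
    by apply: gder_sub; [have [] := hG _ _ (inA s _ hs t2)|
                         have [] := hG _ _ (inA s _ hs t0)].
  by rewrite /f /= cexp_per subrr cmod0.
have B1 : cmod (C s1) <= M / r * (2 * pi - 0).
  apply: (@curve_mean_value R (fun t => G (s1 +i* t)%C) (fun t => 'i * f (s1 +i* t)%C)).
  - lra.
  - by move=> t ht; have [] := hG _ _ (inA s1 t i1 ht).
  - by move=> t ht; rewrite cmodM cmodi mul1r -e1E; apply: bf; lra.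
(* The derivative of [g] is 'i times the quotient of F(w) - F(z) - L (w - z) by
   w - z on the small circle, which is small by the choice of [k]. *)
pose g t := G (s0 +i* t)%C + F z / cexp s0 t - L * 'i * t%:C.
have B0 : cmod (g (2 * pi) - g 0) <= e / 2 * (2 * pi - 0).
  apply: (@curve_mean_value R g (fun t => 'i * f (s0 +i* t)%C +
    (0 * cexp s0 t - F z * ('i * cexp s0 t)) / cexp s0 t ^+ 2 - L * 'i * 1)).
  - lra.
  - move=> t ht; apply: gder_sub; last by apply: gder_scale; exact: gder_coord.
    apply: gderD; first by have [] := hG _ _ (inA s0 t i0 ht).
    by apply: gder_div; [exact: cexp_neq0|exact: gder_cst|exact: cexp_rderr].
  - move=> t ht.
    have := hk (z + cexp s0 t); rewrite addrC addKr cmod_cexp e0E => /(_ qk) hk'.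
    set w := cexp s0 t; have w0 : w != 0 by exact: cexp_neq0.
    have -> : 'i * f (s0 +i* t)%C + (0 * w - F z * ('i * w)) / w ^+ 2 - L * 'i * 1
      = 'i * ((F (w + z) - F z - L * w) / w).
      by rewrite /f /W /= -/w [z + w]addrC; field.
    rewrite cmodM cmodi mul1r cmodM cmodV cmod_cexp e0E ler_pdivrMr//.
    by rewrite [w + z]addrC.
have gC : g (2 * pi) - g 0 = C s0 - L * 'i * (2 * pi)%:C.
  by rewrite /g /C cexp_per rmorph0; ring.
have : cmod (L * 'i * (2 * pi)%:C) <= (M / r + e / 2) * (2 * pi).
  have -> : L * 'i * (2 * pi)%:C = C s1 - (g (2 * pi) - g 0).
    by rewrite gC C01; ring.
  apply: le_trans (cmodBD _ _) _; move: B1 B0; rewrite subr0; lra.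
rewrite !cmodM cmodi mulr1 cmodR ger0_norm; last by lra.
rewrite ler_pM2r; lra.
Qed.

End Holomorphic.

Section Taylor.
Variable R : realType.
Implicit Types (F G : R[i] -> R[i]) (z w L : R[i]) (D : set R[i]).

Lemma hol_B D F G : hol D F -> hol D G -> hol D (fun w => F w - G w).
Proof. by move=> h1 h2 z zD; eexists; exact: gder_sub (hol_cder h1 zD) (hol_cder h2 zD). Qed.

Lemma hol_M D F G : hol D F -> hol D G -> hol D (fun w => F w * G w).
Proof. by move=> h1 h2 z zD; eexists; exact: gderM (hol_cder h1 zD) (hol_cder h2 zD). Qed.

Lemma hol_div D F G : hol D F -> hol D G -> (forall z, D z -> G z != 0) ->
  hol D (fun w => F w / G w).
Proof.
move=> h1 h2 h z zD; eexists.
exact: gder_div (h z zD) (hol_cder h1 zD) (hol_cder h2 zD).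
Qed.

Lemma hol_cst D c : hol D (fun _ => c).
Proof. by move=> z _; exists 0; exact: gder_cst. Qed.

Lemma hol_id D : hol D (fun w : R[i] => w).
Proof. by move=> z _; exists 1; exact: cder_id. Qed.

Lemma hol_ext D F G : open D -> (forall z, D z -> F z = G z) -> hol D F -> hol D G.
Proof.
move=> /open_cmod oD FG hF z zD; have [L hL] := hF z zD; exists L.
have [r r0 hr] := oD z zD.
by apply: gder_ext r0 _ hL => w /hr; exact: FG.
Qed.

Lemma open_disc z r : open (disc z r).
Proof.
apply/open_cmod => w wz; exists (r - cmod (w - z)); first by rewrite subr_gt0.
by move=> x xw; apply: (@disc_sub R z w r (r - cmod (w - z))) => //; lra.
Qed.

Lemma disc_convex z r x y (s : R) : 0 <= s <= 1 -> disc z r x -> disc z r y ->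
  disc z r (x + s%:C * (y - x)).
Proof.
move=> /andP[s0 s1]; rewrite /disc /= => xr yr.
have -> : x + s%:C * (y - x) - z = (1 - s)%:C * (x - z) + s%:C * (y - z).
  by rewrite rmorphB rmorph1; ring.
apply: le_lt_trans (cmodD _ _) _; rewrite !cmodM !cmodR !ger0_norm ?subr_ge0//.
set a := cmod _ in xr *; set b := cmod _ in yr *.
have h1 : (1 - s) * a <= (1 - s) * Num.max a b.
  by rewrite ler_wpM2l ?subr_ge0// le_max lexx.
have h2 : s * b <= s * Num.max a b by rewrite ler_wpM2l// le_max lexx orbT.
have : Num.max a b < r by rewrite gt_max xr.
lra.
Qed.

Lemma segment_disc z w (t : R) r : 0 <= t <= 1 -> cmod (w - z) < r ->
  disc z r (z + t%:C * (w - z)).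
Proof.
move=> t01 wz; apply: disc_convex => //; rewrite /disc /= subrr cmod0.
exact: le_lt_trans (cmod_ge0 _) wz.
Qed.

Lemma dC_bound F z w (M r s : R) : s < r -> cmod (w - z) < s ->
  hol (disc z r) F -> (forall w, disc z r w -> cmod (F w) <= M) ->
  cmod (dC F w) <= M / (r - s).
Proof.
move=> sr ws hF hM.
have sub : disc w (r - cmod (w - z)) `<=` disc z r by apply: disc_sub; lra.
apply: (@cauchy_estimate R F w _ M (r - s) (r - cmod (w - z))); [lra|lra| | |].
- exact: hol_sub sub hF.
- by move=> x /sub; exact: hM.
- by apply: hol_cder hF _; rewrite /disc /=; lra.
Qed.

(** Cauchy's estimate for the increment of [F] by the constant [w - z], which
    the bound on the derivative makes small. *)
Lemma dC_lipschitz F z w (M r : R) : 0 < r -> cmod (w - z) < r ->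
  hol (disc z (3 * r)) F -> (forall x, disc z (3 * r) x -> cmod (F x) <= M) ->
  cmod (dC F w - dC F z) <= 2 * M / r ^+ 2 * cmod (w - z).
Proof.
move=> r0 wr hF hM.
pose G v := F (v + (w - z)) - F v.
have dbound x : disc z (2 * r) x -> cmod (dC F x) <= M / r.
  move=> xz; have -> : r = 3 * r - 2 * r by ring.
  by apply: dC_bound hF hM => //; lra.
have sub x : disc z r x -> disc z (2 * r) x /\ disc z (2 * r) (x + (w - z)).
  rewrite /disc /= => xr; split; first lra.
  have -> : x + (w - z) - z = (x - z) + (w - z) by ring.
  by apply: le_lt_trans (cmodD _ _) _; lra.
have sub3 x : disc z (2 * r) x -> disc z (3 * r) x by rewrite /disc /=; lra.
have hG v : disc z r v -> cder G v (dC F (v + (w - z)) * (1 + 0) - dC F v).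
  move=> /sub[v1 v2]; apply: gder_sub; last exact: hol_cder hF (sub3 _ v1).
  apply: (gder_comp (g := fun v => v + (w - z)) (hol_cder hF (sub3 _ v2))).
  by apply: gderD; [exact: cder_id|exact: gder_cst].
have -> : 2 * M / r ^+ 2 * cmod (w - z) = M / r * cmod (w - z) / (r / 2).
  by field; exact: lt0r_neq0.
have zz : disc z r z by rewrite /disc /= subrr cmod0.
have := hG z zz; rewrite addr0 mulr1 [z + _]addrC subrK => hz.
apply: (@cauchy_estimate R G z _ _ (r / 2) r) hz; [lra|lra| |].
  by move=> v /hG h; eexists; exact: h.
move=> v /[dup] vr /sub[v1 v2]; rewrite /G.
set k := w - z in wr v2 *.
have := @cder_mean_value R F (dC F) v (v + k) (M / r).
have -> : v + k - v = k by ring.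
have near t : 0 <= t <= 1 -> disc z (2 * r) (v + t%:C * k).
  move=> /andP[t0 t1]; rewrite /disc /= addrAC; apply: le_lt_trans (cmodD _ _) _.
  rewrite cmodM cmodR ger0_norm//.
  have := ler_piMl (cmod_ge0 k) t1; move: vr; rewrite /disc /=; lra.
apply=> t ht; last by apply: dbound; exact: near.
by apply: hol_cder hF _; apply: sub3; exact: near.
Qed.

Lemma taylor1 F z w (M r : R) : 0 < r -> cmod (w - z) < r ->
  hol (disc z (3 * r)) F -> (forall x, disc z (3 * r) x -> cmod (F x) <= M) ->
  cmod (F w - F z - dC F z * (w - z)) <= 2 * M / r ^+ 2 * cmod (w - z) ^+ 2.
Proof.
move=> r0 wr hF hM.
have M0 : 0 <= M.
  by apply: le_trans (cmod_ge0 _) (hM z _); rewrite /disc /= subrr cmod0; lra.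
have -> : F w - F z - dC F z * (w - z) =
  (F w - dC F z * w) - (F z - dC F z * z) by ring.
rewrite expr2 mulrA.
apply: (@cder_mean_value R (fun w => F w - dC F z * w)
  (fun w => dC F w - dC F z * 1)) => t /[dup] ht /andP[t0 t1].
  apply: gder_sub; last by apply: gder_scale; exact: cder_id.
  by apply: hol_cder hF _; apply: segment_disc => //; lra.
rewrite mulr1; apply: le_trans (dC_lipschitz r0 (segment_disc ht wr) hF hM) _.
apply: ler_wpM2l; first by rewrite divr_ge0 ?exprn_ge0 ?mulr_ge0// ltW.
by rewrite addrC addKr cmodM cmodR ger0_norm// ler_piMl ?cmod_ge0.
Qed.

(** The limit is the supremum of the numbers that are eventually lower bounds. *)
Lemma real_cauchy (u : nat -> R) :
  (forall e, 0 < e -> exists N, forall n m, (N <= n)%N -> (N <= m)%N -> `|u n - u m| <= e) ->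
  exists l, forall e, 0 < e -> exists N, forall n, (N <= n)%N -> `|u n - l| <= e.
Proof.
move=> hu; pose S : set R := [set x | exists N, forall n, (N <= n)%N -> x <= u n].
have key e N : (forall n m, (N <= n)%N -> (N <= m)%N -> `|u n - u m| <= e) ->
    S (u N - e) /\ ubound S (u N + e).
  move=> h; split.
    by exists N => n Nn; have := h _ _ Nn (leqnn N); rewrite ler_norml; lra.
  move=> x [N' hN']; have := hN' (maxn N N') (leq_maxr _ _).
  by have := h _ _ (leq_maxl N N') (leqnn N); rewrite ler_norml; lra.
have hs : has_sup S.
  have [N hN] := hu 1 ltr01; have [h1 h2] := key _ _ hN.
  by split; [exists (u N - 1)|exists (u N + 1)].
exists (sup S) => e e0; have [|N hN] := hu (e / 2); first lra.
have [h1 h2] := key _ _ hN; exists N => n Nn.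
have k1 := ub_le_sup hs.2 h1; have k2 := ge_sup hs.1 h2.
by have := hN _ _ Nn (leqnn N); rewrite !ler_norml; lra.
Qed.

Lemma complex_cauchy (u : nat -> R[i]) :
  (forall e, 0 < e -> exists N, forall n m, (N <= n)%N -> (N <= m)%N -> cmod (u n - u m) <= e) ->
  exists l, forall e, 0 < e -> exists N, forall n, (N <= n)%N -> cmod (u n - l) <= e.
Proof.
move=> hu.
have [|a ha] := @real_cauchy (fun n => complex.Re (u n)).
  move=> e /hu[N hN]; exists N => n m Nn Nm; apply: le_trans (hN n m Nn Nm).
  have -> : complex.Re (u n) - complex.Re (u m) = complex.Re (u n - u m).
    by case: (u n) (u m) => [? ?] [? ?].
  exact: cmod_Re.
have [|b hb] := @real_cauchy (fun n => complex.Im (u n)).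
  move=> e /hu[N hN]; exists N => n m Nn Nm; apply: le_trans (hN n m Nn Nm).
  have -> : complex.Im (u n) - complex.Im (u m) = complex.Im (u n - u m).
    by case: (u n) (u m) => [? ?] [? ?].
  exact: cmod_Im.
exists (a +i* b)%C => e e0.
have [|N1 h1] := ha (e / 2); first lra.
have [|N2 h2] := hb (e / 2); first lra.
exists (maxn N1 N2) => n; rewrite geq_max => /andP[/h1 k1 /h2 k2].
apply: le_trans (cmod_le_ReIm _) _.
have -> : complex.Re (u n - (a +i* b)%C) = complex.Re (u n) - a by case: (u n).
have -> : complex.Im (u n - (a +i* b)%C) = complex.Im (u n) - b by case: (u n).
by move: k1 k2 => /=; lra.
Qed.

Lemma invS_lt (e : R) : 0 < e -> exists N, forall n, (N <= n)%N -> n.+1%:R^-1 < e.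
Proof.
move=> e0; have [n hn] := halving_lt 1 e0; exists (2 ^ n)%N => m hm.
apply: le_lt_trans hn; rewrite div1r lef_pV2 ?posrE ?exprn_gt0//.
by rewrite -natrX ler_nat ltnW.
Qed.

(** Cauchy's estimate makes the derivatives at [z] of the approximants converge,
    and the Taylor bound, uniform in them, passes to the limit. *)
Lemma hol_limit F z (M r : R) : 0 < r ->
  (forall e, 0 < e -> exists2 G, hol (disc z (3 * r)) G &
    forall w, disc z (3 * r) w -> cmod (G w - F w) <= e /\ cmod (G w) <= M) ->
  exists L, cder F z L.
Proof.
move=> r0 h.
have inv0 n : 0 < n.+1%:R^-1 :> R by rewrite invr_gt0.
have /choice[G hG] : forall n : nat, exists G, hol (disc z (3 * r)) G /\
    forall w, disc z (3 * r) w -> cmod (G w - F w) <= n.+1%:R^-1 /\ cmod (G w) <= M.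
  by move=> n; have [G h1 h2] := h _ (inv0 n); exists G.
have zz : disc z (3 * r) z by rewrite /disc /= subrr cmod0; lra.
have M0 : 0 <= M by have [_ h2] := hG 0%N; exact: le_trans (cmod_ge0 _) (h2 z zz).2.
have [|L hL] := @complex_cauchy (fun n => dC (G n) z).
  move=> e e0; have [|N hN] := @invS_lt (e * r / 2).
    by rewrite divr_gt0// mulr_gt0.
  exists N => n m Nn Nm.
  have [hn bn] := hG n; have [hm bm] := hG m.
  apply: le_trans (_ : (n.+1%:R^-1 + m.+1%:R^-1) / r <= _); last first.
    by rewrite ler_pdivrMr//; have := hN _ Nn; have := hN _ Nm;
      move: (n.+1%:R^-1) (m.+1%:R^-1) => ? ?; lra.
  apply: (@cauchy_estimate R (fun w => G n w - G m w) z _ _ r (3 * r)) => //; [lra| | |].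
  - exact: hol_B.
  - move=> w wz; have -> : G n w - G m w = (G n w - F w) - (G m w - F w) by ring.
    by apply: le_trans (cmodBD _ _) _; apply: lerD; [have [] := bn w wz|have [] := bm w wz].
  - by apply: gder_sub; [exact: hol_cder hn zz|exact: hol_cder hm zz].
exists L.
have T w : cmod (w - z) < r ->
    cmod (F w - F z - L * (w - z)) <= 2 * M / r ^+ 2 * cmod (w - z) ^+ 2.
  move=> wr; apply: le_pinch => e e0.
  have [|N1 hN1] := @invS_lt (e / 4); first lra.
  have [|N2 hN2] := hL (e / 4 / r); first by rewrite divr_gt0//; lra.
  pose n := maxn N1 N2.
  have k1 := hN1 n (leq_maxl _ _); have k2 := hN2 n (leq_maxr _ _).
  have [hn bn] := hG n.
  have k3 := taylor1 r0 wr hn (fun x hx => (bn x hx).2).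
  have wz : disc z (3 * r) w by rewrite /disc /=; lra.
  have [k4 _] := bn w wz; have [k5 _] := bn z zz.
  have k6 : cmod ((dC (G n) z - L) * (w - z)) <= e / 4.
    rewrite cmodM; apply: le_trans (_ : e / 4 / r * r <= _); last first.
      by rewrite divfK// lt0r_neq0.
    by rewrite ler_pM ?cmod_ge0// ltW.
  have -> : F w - F z - L * (w - z) = (G n w - G n z - dC (G n) z * (w - z))
    + (dC (G n) z - L) * (w - z) + (G n z - F z) - (G n w - F w) by ring.
  apply: le_lt_trans (cmodBD _ _) _.
  have := cmodD ((G n w - G n z - dC (G n) z * (w - z))
    + (dC (G n) z - L) * (w - z)) (G n z - F z).
  have := cmodD (G n w - G n z - dC (G n) z * (w - z)) ((dC (G n) z - L) * (w - z)).
  by move: k1 k3 k4 k5 k6; move: (n.+1%:R^-1) => ?; lra.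
move=> e e0.
pose K := 2 * M / r ^+ 2.
have K0 : 0 <= K by rewrite divr_ge0 ?exprn_ge0 ?mulr_ge0// ltW.
exists (Num.min r (e / (K + 1))).
  by rewrite lt_min r0 divr_gt0//; lra.
move=> w; rewrite lt_min => /andP[wr we].
apply: le_trans (T w wr) _; rewrite -/K expr2 mulrA ler_wpM2r ?cmod_ge0//.
move: we; rewrite ltr_pdivlMr; last lra.
by have := cmod_ge0 (w - z); lra.
Qed.

Lemma hol_bounded D F z : open D -> hol D F -> D z ->
  exists r M, [/\ 0 < r, 0 <= M, disc z r `<=` D & forall w, disc z r w -> cmod (F w) <= M].
Proof.
move=> /open_cmod oD hF zD; have [r r0 hr] := oD z zD.
have [d d0 hd] := gder_lip (hol_cder hF zD).
exists (Num.min r d), (cmod (F z) + (cmod (dC F z) + 1) * d); split.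
- by rewrite lt_min r0.
- by rewrite addr_ge0 ?cmod_ge0// mulr_ge0 ?addr_ge0 ?cmod_ge0// ltW.
- by move=> w; rewrite /disc /= lt_min => /andP[/hr].
move=> w; rewrite /disc /= lt_min => /andP[_ /[dup] wd /hd h].
have -> : F w = F z + (F w - F z) by ring.
apply: le_trans (cmodD _ _) _; rewrite lerD2l; apply: le_trans h _.
by rewrite ler_wpM2l ?addr_ge0 ?cmod_ge0// ltW.
Qed.

(** By the Taylor bound, the derivative is a uniform limit of difference
    quotients. *)
Theorem hol_dC D F : open D -> hol D F -> hol D (dC F).
Proof.
move=> oD hF z zD.
have [r' [M [r'0 M0 sub bM]]] := hol_bounded oD hF zD.
(* The Taylor bound at [w] uses the disc of radius [3 * r] around [w], for all [w]
   in the disc of that radius around [z]. *)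
pose r := r' / 12; have r0 : 0 < r by rewrite /r; lra.
pose K := 2 * M / r ^+ 2.
have K0 : 0 <= K by rewrite divr_ge0 ?exprn_ge0 ?mulr_ge0// ltW.
have hF' : hol (disc z r') F by exact: hol_sub hF.
have dB w : disc z (3 * r) w -> cmod (dC F w) <= M / r.
  move=> wz; apply: le_trans (_ : M / (r' - 3 * r) <= _).
    by apply: dC_bound hF' bM => //; rewrite /r; lra.
  by rewrite ler_wpM2l// lef_pV2 ?posrE /r; lra.
apply: (@hol_limit (dC F) z (M / r + K * r) r) => // e e0.
pose h := Num.min (r / 2) (e / (K + 1)).
have h0 : 0 < h by rewrite lt_min !divr_gt0//; lra.
have hr : h < r by rewrite /h; case: (leP (r / 2) (e / (K + 1))) => ?; lra.
have he : K * h <= e.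
  have : h <= e / (K + 1) by rewrite ge_min lexx orbT.
  by rewrite ler_pdivlMr; lra.
have hC0 : h%:C != 0 by rewrite -cmod_gt0 cmodR normr_gt0 lt0r_neq0.
have cC : cmod (h%:C : R[i]) = h by rewrite cmodR gtr0_norm.
have inD w : disc z (3 * r) w -> disc z r' w /\ disc z r' (w + h%:C).
  rewrite /disc /= => wz; split; first by move: wz; rewrite /r; lra.
  rewrite addrAC; apply: le_lt_trans (cmodD _ _) _; rewrite cC.
  by move: wz hr; rewrite /r; lra.
pose G w := (F (w + h%:C) - F w) / h%:C.
have close w : disc z (3 * r) w -> cmod (G w - dC F w) <= K * h.
  move=> wz.
  have sub3 : disc w (3 * r) `<=` disc z r'.
    by apply: disc_sub; move: wz; rewrite /disc /= /r; lra.
  have := @taylor1 F w (w + h%:C) M r r0.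
  rewrite [w + _]addrC addrK cC => /(_ hr (hol_sub sub3 hF') (fun x hx => bM x (sub3 x hx))).
  have -> : G w - dC F w = (F (h%:C + w) - F w - dC F w * h%:C) / h%:C.
    by rewrite /G [w + _]addrC; field.
  by rewrite cmodM cmodV cC ler_pdivrMr// -/K expr2 mulrA.
exists G.
  move=> w /inD[w1 w2]; eexists; apply: gder_div; [exact: hC0| |exact: gder_cst].
  apply: gder_sub; last exact: hol_cder hF' w1.
  apply: (gder_comp (g := fun v => v + h%:C) (hol_cder hF' w2)).
  by apply: gderD; [exact: cder_id|exact: gder_cst].
move=> w wz; have c := close w wz; split; first exact: le_trans c he.
have -> : G w = dC F w + (G w - dC F w) by ring.
apply: le_trans (cmodD _ _) _; apply: lerD; first exact: dB.
by apply: le_trans c _; rewrite ler_wpM2l// ltW.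
Qed.

(** Cauchy's estimate on large discs. *)
Theorem liouville F (M : R) : hol setT F -> (forall w, cmod (F w) <= M) ->
  forall z w, F w = F z.
Proof.
move=> hF hM z w; apply/eqP; rewrite -subr_eq0 -cmod_eq0; apply/eqP/le_anti.
rewrite cmod_ge0 andbT.
have d0 x : cmod (dC F x) <= 0.
  apply: le_pinch => e e0; rewrite add0r.
  have M0 : 0 <= M by exact: le_trans (cmod_ge0 _) (hM 0).
  have r0 : 0 < (M + 1) / e by rewrite divr_gt0//; lra.
  apply: le_lt_trans (_ : M / ((M + 1) / e) < _).
    apply: (@cauchy_estimate R F x _ M _ ((M + 1) / e + 1)) => //; [lra| |].
    - exact: hol_sub hF.
    - exact: hol_cder hF _.
  by rewrite ltr_pdivrMr// mulrC divfK ?lt0r_neq0//; lra.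
have := @cder_mean_value R F (dC F) z w 0; rewrite mul0r; apply=> t _; last exact: d0.
exact: hol_cder hF I.
Qed.

End Taylor.

Section Tolstov.
Variable R : realType.
Implicit Types (F G : R[i] -> R[i]) (z w L : R[i]) (D : set R[i]).

Definition square z (r : R) : rect R :=
  Rect (complex.Re z - r) (complex.Re z + r) (complex.Im z - r) (complex.Im z + r).

Lemma disc_square z r x y : disc z r (x +i* y)%C -> inside (square z r) x y.
Proof.
rewrite /disc /= => h.
have := le_lt_trans (cmod_Re _) h; have := le_lt_trans (cmod_Im _) h.
by rewrite /inside; case: (z) => a b /=; rewrite !ltr_norml; lra.
Qed.

Lemma square_disc z r x y : 0 < r -> inrect (square z (r / 3)) x y -> disc z r (x +i* y)%C.
Proof.
move=> r0; rewrite /disc /mkset /inrect => h.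
apply: le_lt_trans (cmod_le_ReIm _) _; case: z h => a b /= h.
have : `|x - a| <= r / 3 /\ `|y - b| <= r / 3 by rewrite !ler_norml; lra.
lra.
Qed.

Lemma cross_der_lipschitz F G A (M x y x' y' : R) :
  (forall x y, inside A x y -> cross_der G x y (F (x +i* y)%C)) ->
  (forall x y, inside A x y -> cmod (F (x +i* y)%C) <= M) ->
  inside A x y -> inside A x' y' ->
  cmod (G (x' +i* y')%C - G (x +i* y)%C) <= M * (`|x' - x| + `|y' - y|).
Proof.
move=> hG hM xy xy'.
have i1 t : Num.min x x' <= t <= Num.max x x' -> inside A t y'.
  by move: xy xy'; rewrite /inside; case: (leP x x') => ?; lra.
have i2 t : Num.min y y' <= t <= Num.max y y' -> inside A x t.
  by move: xy xy'; rewrite /inside; case: (leP y y') => ?; lra.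
have h1 : cmod (G (x' +i* y')%C - G (x +i* y')%C) <= M * `|x' - x|.
  apply: (@curve_mean_value2 R (fun t => G (t +i* y')%C) (fun t => F (t +i* y')%C)).
    by move=> t /i1/hG[].
  by move=> t /i1/hM.
have h2 : cmod (G (x +i* y')%C - G (x +i* y)%C) <= M * `|y' - y|.
  apply: (@curve_mean_value2 R (fun t => G (x +i* t)%C) (fun t => 'i * F (x +i* t)%C)).
    by move=> t /i2/hG[].
  by move=> t /i2/hM; rewrite cmodM cmodi mul1r.
have := cmod_dist (G (x' +i* y')%C) (G (x +i* y')%C) (G (x +i* y)%C).
by rewrite mulrDr; lra.
Qed.

(** A primitive [G] of [F] is Lipschitz because [F] is bounded, hence a primitive
    [H] of [G] is continuously differentiable.  So [F] is the second derivative
    of the holomorphic function [H]. *)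
Theorem tolstov D F : open D ->
  (forall z, D z -> exists r M, 0 < r /\ forall w, disc z r w -> cmod (F w) <= M) ->
  (forall x y, D (x +i* y)%C -> exists L, cross_der F x y L) -> hol D F.
Proof.
move=> /open_cmod oD bF cF z zD.
have [r1 r10 hr1] := oD z zD; have [r2 [M [r20 hM]]] := bF z zD.
pose r := Num.min r1 r2; have r0 : 0 < r by rewrite lt_min r10.
have rD w : disc z r w -> D w.
  by rewrite /disc /= lt_min => /andP[h _]; exact: hr1.
have rM w : disc z r w -> cmod (F w) <= M.
  by rewrite /disc /= lt_min => /andP[_ h]; exact: hM.
have M0 : 0 <= M.
  by apply: le_trans (cmod_ge0 _) (rM z _); rewrite /disc /= subrr cmod0.
pose A := square z (r / 3).
have AD x y : inrect A x y -> disc z r (x +i* y)%C by exact: square_disc.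
pose dF x y : R[i] := get [set L | cross_der F x y L].
have hdF x y : inrect A x y -> cross_der F x y (dF x y).
  move=> /AD/rD/cF[L hL]; rewrite /dF; by case: xgetP => [w -> //|/(_ L)].
have [G hG] := cross_der_primitive hdF (fun x y h => rM _ (AD x y h)).
have iM x y : inside A x y -> cmod (F (x +i* y)%C) <= M.
  by move=> /inside_inrect/AD/rM.
(* The primitive [G] exists in the interior of [A] only. *)
pose B := square z (r / 6).
have BA x y : inrect B x y -> inside A x y.
  by rewrite /inrect /inside /A /B /=; lra.
have zB : inside A (complex.Re z) (complex.Im z) by rewrite /inside /A /=; lra.
have bG x y : inrect B x y -> cmod (G (x +i* y)%C) <= cmod (G z) + M * r.
  move=> xy; have := cross_der_lipschitz hG iM zB (BA _ _ xy).
  rewrite -complexRI => h.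
  have -> : G (x +i* y)%C = G z + (G (x +i* y)%C - G z) by ring.
  apply: le_trans (cmodD _ _) _; rewrite lerD2l; apply: le_trans h _.
  rewrite ler_wpM2l//; move: xy; rewrite /inrect /B /= => xy.
  have : `|x - complex.Re z| <= r / 6 /\ `|y - complex.Im z| <= r / 6.
    by rewrite !ler_norml; lra.
  lra.
have [H hH] := cross_der_primitive (fun x y h => hG x y (BA x y h)) bG.
have cH x y : inside B x y -> cder H (x +i* y)%C (G (x +i* y)%C).
  move=> xy; apply: (continuous_cross_cder xy hH) => e e0.
  have xyA := BA _ _ (inside_inrect xy).
  pose k := r / 6.
  have k0 : 0 < k by rewrite /k; lra.
  have K0 : 0 < 2 * M + 1 by lra.
  exists (Num.min k (e / (2 * M + 1))); first by rewrite lt_min k0 divr_gt0.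
  move=> w; rewrite lt_min => /andP[wk we].
  rewrite (complexRI w) in wk we *; move: (complex.Re w) (complex.Im w) wk we => a b wk we.
  have ax : `|a - x| <= cmod ((a +i* b) - (x +i* y))%C by exact: (cmod_Re ((a +i* b) - (x +i* y))%C).
  have yb : `|b - y| <= cmod ((a +i* b) - (x +i* y))%C by exact: (cmod_Im ((a +i* b) - (x +i* y))%C).
  have abA : inside A a b.
    have := le_lt_trans ax wk; have := le_lt_trans yb wk.
    by move: xy; rewrite /inside /A /B /k /= !ltr_norml; lra.
  apply: le_trans (cross_der_lipschitz hG iM xyA abA) _.
  move: we; rewrite ltr_pdivlMr// => we.
  have := ler_wpM2l M0 ax; have := ler_wpM2l M0 yb.
  have := cmod_ge0 ((a +i* b) - (x +i* y))%C; lra.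
have hH' w : disc z (r / 6) w -> cder H w (G w).
  by rewrite (complexRI w) => /disc_square; exact: cH.
have hol_H : hol (disc z (r / 6)) H by move=> w /hH'; exists (G w).
have hol_G : hol (disc z (r / 6)) G.
  apply: (@hol_ext R _ (dC H)); first exact: open_disc.
    by move=> w /hH'/dCE.
  by apply: hol_dC => //; exact: open_disc.
have dG w : disc z (r / 6) w -> dC G w = F w.
  move=> wz; have := hol_cder hol_G wz.
  move: wz; rewrite (complexRI w) => wz /cder_cross[h1 _].
  have [h2 _] := hG _ _ (BA _ _ (inside_inrect (disc_square wz))).
  exact: rder_unique h1 h2.
have hol_F : hol (disc z (r / 6)) F.
  apply: (@hol_ext R _ (dC G)) => //; first exact: open_disc.
  by apply: hol_dC => //; exact: open_disc.
by apply: hol_F; rewrite /disc /= subrr cmod0; lra.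
Qed.

Lemma local_primitive D F z : open D -> hol D F -> D z ->
  exists r P, [/\ 0 < r, disc z r `<=` D & forall w, disc z r w -> cder P w (F w)].
Proof.
move=> oD hF zD.
have [r [M [r0 M0 sub bM]]] := hol_bounded oD hF zD.
pose A := square z (r / 3).
have AD x y : inrect A x y -> disc z r (x +i* y)%C by exact: square_disc.
have [G hG] := @cross_der_primitive R F (fun x y => dC F (x +i* y)%C) A M
  (fun x y h => cder_cross (hol_cder hF (sub _ (AD x y h)))) (fun x y h => bM _ (AD x y h)).
exists (r / 3), G; split; first lra.
  by move=> w wz; apply: sub; move: wz; rewrite /disc /=; lra.
move=> w; rewrite (complexRI w) => /disc_square wA.
apply: (continuous_cross_cder wA hG) => e e0.
have [d d0 hd] := gder_lip (hol_cder hF (sub _ (AD _ _ (inside_inrect wA)))).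
rewrite -complexRI in hd *.
have N0 : 0 < cmod (dC F w) + 1 by have := cmod_ge0 (dC F w); lra.
exists (Num.min d (e / (cmod (dC F w) + 1))); first by rewrite lt_min d0 divr_gt0.
move=> x; rewrite lt_min => /andP[/hd h xe]; apply: le_trans h _.
by move: xe; rewrite ltr_pdivlMr// mulrC => /ltW.
Qed.

(** The value at [t] removes the singularity of the divided difference. *)
Definition dq F t z : R[i] := if z == t then dC F t else (F z - F t) / (z - t).

Lemma dqE F t z : F z = F t + (z - t) * dq F t z.
Proof.
rewrite /dq; case: eqP => [->|/eqP zt]; first by rewrite subrr mul0r addr0.
by field; rewrite subr_eq0.
Qed.

(** Away from [t] this is the quotient rule.  At [t] the derivative is half of the
    second derivative of [F]: the difference to the quadratic Taylor polynomial
    has a derivative in o(|w - t|), hence is in o(|w - t|^2). *)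
Theorem hol_dq D F t : open D -> hol D F -> D t -> hol D (dq F t).
Proof.
move=> oD hF tD z zD.
case: (eqVneq z t) => [->|zt]; last first.
  have zt0 : z - t != 0 by rewrite subr_eq0.
  eexists; apply: (@gder_ext _ _ _ (fun z => (F z - F t) / (z - t)) _ _ _ (cmod (z - t))).
  - by rewrite cmod_gt0.
  - move=> w wz; rewrite /dq; case: eqP => [e|//].
    by move: wz; rewrite e cmodB ltxx.
  - apply: gder_div => //; first by apply: gder_sub; [exact: hol_cder hF zD|exact: gder_cst].
    by apply: gder_sub; [exact: cder_id|exact: gder_cst].
have hF' := hol_dC oD hF.
pose c := dC (dC F) t.
exists (c / 2) => e e0.
have [d d0 hd] := hol_cder hF' tD e0.
have [r r0 hr] := (open_cmod D).1 oD t tD.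
exists (Num.min d r); first by rewrite lt_min d0.
move=> w; rewrite lt_min => /andP[wd wr].
case: (eqVneq w t) => [->|wt].
  by rewrite !subrr mulr0 subrr cmod0 mulr0.
have wt0 : w - t != 0 by rewrite subr_eq0.
have ct : 0 < cmod (w - t) by rewrite cmod_gt0.
rewrite /dq (negbTE wt) eqxx.
pose psi x := F x - dC F t * x - c / 2 * ((x - t) * (x - t)).
have -> : (F w - F t) / (w - t) - dC F t - c / 2 * (w - t) = (psi w - psi t) / (w - t).
  by rewrite /psi; field.
rewrite cmodM cmodV ler_pdivrMr//.
apply: (@cder_mean_value R psi (fun x => dC F x - dC F t * 1 -
    c / 2 * ((1 - 0) * (x - t) + (x - t) * (1 - 0)))) => s hs.
  have sD : D (t + s%:C * (w - t)).
    by apply: hr; exact: (segment_disc hs wr).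
  apply: gder_sub; last first.
    by apply: gder_scale; apply: gderM; apply: gder_sub;
      (exact: cder_id || exact: gder_cst).
  by apply: gder_sub; [exact: hol_cder hF sD|apply: gder_scale; exact: cder_id].
set x := t + s%:C * (w - t).
have -> : dC F x - dC F t * 1 - c / 2 * ((1 - 0) * (x - t) + (x - t) * (1 - 0)) =
   dC F x - dC F t - c * (x - t) by field.
have xw : cmod (x - t) <= cmod (w - t).
  rewrite /x addrC addKr cmodM cmodR; case/andP: hs => s0 s1.
  by rewrite ger0_norm// ler_piMl ?cmod_ge0.
apply: le_trans (hd x (le_lt_trans xw wd)) _.
by rewrite ler_pM2l.
Qed.

End Tolstov.


(** * Integrals along rectifiable curves *)

Section Partitions.
Variable R : realType.

Notation pt s := (nth (1 : R) (0 :: s)).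

Lemma partition_bounds (s : seq R) n : itv_partition 0 1 s -> (n <= size s)%N ->
  0 <= pt s n <= 1.
Proof.
by move=> hs ns; rewrite itv_partition_nth_ge//= itv_partition_nth_le.
Qed.

Lemma partition_mono (s : seq R) n : itv_partition 0 1 s -> (n < size s)%N ->
  pt s n < pt s n.+1.
Proof. by move=> [/pathP hs _] ns; exact: hs. Qed.

Lemma partition_telescope (s : seq R) (J : R -> R[i]) : itv_partition 0 1 s ->
  \sum_(0 <= n < size s) (J (pt s n.+1) - J (pt s n)) = J 1 - J 0.
Proof.
move=> hs; rewrite (@telescope_sumr _ 0 (size s) (fun n => J (pt s n)))//.
by rewrite (itv_partition_nth_size _ hs).
Qed.

Lemma fine_partition (d : R) : 0 < d -> exists2 s : seq R, itv_partition 0 1 s &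
  forall n, (n < size s)%N -> pt s n.+1 - pt s n < d.
Proof.
move=> d0; have [N hN] := invS_lt d0; have {}hN := hN N (leqnn N).
have N0 : 0 < N.+1%:R :> R by [].
pose s : seq R := [seq i%:R / N.+1%:R | i <- iota 1 N.+1].
have sz : size s = N.+1 by rewrite size_map size_iota.
have ptE n : (n <= N.+1)%N -> pt s n = n%:R / N.+1%:R.
  case: n => [|n] nN; first by rewrite mul0r.
  rewrite /= (nth_map 0%N) ?size_iota// -/(iota 1 N.+1) nth_iota//.
exists s.
  split; last first.
    rewrite (_ : last 0 s = pt s (size s)); last by rewrite nth_last; case: (s) sz.
    by rewrite sz ptE// divff// lt0r_neq0.
  apply/(pathP 1) => n; rewrite sz => nN.
  rewrite ptE ?[nth _ s _](ptE n.+1)// ?(ltnW nN)//.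
  by rewrite ltr_pM2r ?invr_gt0// ltr_nat.
move=> n; rewrite sz => nN; rewrite !ptE// ?(ltnW nN)//.
by rewrite -mulrBl -natrB// subSnn mul1r.
Qed.

(** Compactness of the unit interval, for a property of a point and of a radius
    that persists when the radius shrinks. *)
Lemma uniform_radius (Q : R -> R -> Prop) :
  (forall r r' t, 0 < r' -> r' <= r -> Q r t -> Q r' t) ->
  (forall t, 0 <= t <= 1 -> exists2 r, 0 < r &
     forall s, 0 <= s <= 1 -> `|s - t| < r -> Q r s) ->
  exists2 r, 0 < r & forall t, 0 <= t <= 1 -> Q r t.
Proof.
move=> mono loc.
have /compact_near_coveringP/near_covering_withinP := @segment_compact R 0 1.
move=> /(_ R ((0 : R)^'+) (fun r t => Q r t) _) h.
have {h} : \forall r \near (0 : R)^'+, (`[0, 1]%classic `<=` Q r).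
  apply: h => t; rewrite /= in_itv /= => t01.
  have [r r0 hr] := loc t t01.
  exists (ball t r, [set x | 0 < x <= r]).
    split=> /=; first exact: nbhsx_ballx.
    by near=> x; apply/andP; split; near: x; [exact: nbhs_right_gt|exact: nbhs_right_le].
  move=> [s x] /= [st /andP[x0 xr]]; rewrite in_itv /= => s01.
  by apply: (mono r) => //; apply: hr => //; rewrite distrC.
move=> h.
have : \forall r \near (0 : R)^'+, 0 < r /\ (`[0, 1]%classic `<=` Q r).
  by apply: filterS2 (nbhs_right_gt (0 : R)) h => r r0 hr; split.
move=> /filter_ex [r [r0 hr]]; exists r.
Unshelve. all: by end_near. Qed.

End Partitions.

Section CurveIntegral.
Variable R : realType.
Implicit Types (g : R -> R[i]) (F G H : R[i] -> R[i]) (D : set R[i]).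

Notation pt s := (nth (1 : R) (0 :: s)).

Definition curve_continuous g := forall t, 0 <= t <= 1 -> forall e, 0 < e ->
  exists2 d, 0 < d & forall s, 0 <= s <= 1 -> `|s - t| < d -> cmod (g s - g t) < e.

Lemma within_curve_continuous g : {within `[0, 1], continuous g} -> curve_continuous g.
Proof.
move=> /subspace_continuousP hg t t01 e e0.
have /hg : `[0, 1]%classic t by rewrite /= in_itv.
have ball0 : nbhs (g t) [set w | cmod (w - g t) < e].
  by apply/nbhs_cmod; exists e.
move=> /(_ _ ball0); rewrite /within /= => /nbhs_ballP[d /= d0 hd].
exists d => // s s01 st; apply: hd; last by rewrite in_itv.
by rewrite /ball /= distrC.
Qed.

Definition curve_length_le g (L : R) := forall s : seq R, itv_partition 0 1 s ->
  \sum_(0 <= n < size s) cmod (g (pt s n.+1) - g (pt s n)) <= L.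

Lemma rectifiable_length g : rectifiable g -> exists2 L, 0 <= L & curve_length_le g L.
Proof.
move=> [L hL].
have h : curve_length_le g L.
  move=> s /hL /=; rewrite -lecR; apply: le_trans.
  by rewrite rmorph_sum /=; apply: ler_sum.
exists L => //; have [s hs _] := @fine_partition R 1 ltr01.
by apply: le_trans (h s hs); apply: sumr_ge0 => n _; exact: cmod_ge0.
Qed.

Lemma cmod_sum (f : nat -> R[i]) m : cmod (\sum_(0 <= n < m) f n) <= \sum_(0 <= n < m) cmod (f n).
Proof.
elim: m => [|m IH]; first by rewrite !big_nil cmod0.
by rewrite !big_nat_recr //=; apply: le_trans (cmodD _ _) _; rewrite lerD2r.
Qed.

(** The sums of the increments of [J] telescope on every partition, so that two
    partitions need not be compared through a common refinement. *)
Lemma integral_criterion g G (J : R -> R[i]) : rectifiable g ->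
  (forall e, 0 < e -> exists2 d, 0 < d & forall a t b,
     0 <= a -> a <= t -> t <= b -> b <= 1 -> b - a < d ->
     cmod (J b - J a - (g b - g a) * G (g t)) <= e * cmod (g b - g a)) ->
  has_curve_integral g G (J 1 - J 0).
Proof.
move=> /rectifiable_length[L L0 hL] hJ e e0.
have e1 : 0 < e / (L + 1) by rewrite divr_gt0//; lra.
have [d d0 hd] := hJ _ e1; exists d => // s tau hs x hx.
rewrite -(partition_telescope J hs) -sumrB [ `|_| ]cmodE ltcR.
apply: le_lt_trans (cmod_sum _ _) _.
apply: le_lt_trans (_ : \sum_(0 <= n < size s)
   e / (L + 1) * cmod (g (x n.+1) - g (x n)) < _).
  rewrite !big_nat; apply: ler_sum => n /andP[_ ns].
  have [xd /andP[x1 x2]] := hx n ns.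
  have /andP[a0 _] := partition_bounds hs (ltnW ns).
  have /andP[_ b1] := partition_bounds hs ns.
  by rewrite -cmodN opprB; exact: (hd _ _ _ a0 x1 x2 b1 xd).
rewrite -mulr_sumr; apply: le_lt_trans (_ : e / (L + 1) * L < _).
  by rewrite ler_pM2l//; exact: hL.
by rewrite mulrAC ltr_pdivrMr; nra.
Qed.

(** A small-scale cocycle is the increment of a function, built by steps of half
    the scale. *)
Lemma cocycle_primitive (h : R -> R -> R[i]) (d : R) : 0 < d ->
  (forall a b c, 0 <= a -> a <= b -> b <= c -> c <= 1 -> c - a < d ->
     h a b + h b c = h a c) ->
  exists J : R -> R[i], forall a b, 0 <= a -> a <= b -> b <= 1 -> b - a < d ->
     J b - J a = h a b.
Proof.
move=> d0 hh.
have claim n : exists J : R -> R[i], forall a b, 0 <= a -> a <= b -> b <= 1 ->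
    b <= n%:R * (d / 2) -> b - a < d -> J b - J a = h a b.
  elim: n => [|n [J hJ]].
    exists (fun _ => 0) => a b a0 ab _; rewrite mul0r => b0 _.
    have -> : b = 0 by lra. have -> : a = 0 by lra.
    by rewrite subrr; apply: (@addrI _ (h 0 0)); rewrite hh ?addr0 ?subr0.
  pose m := n%:R * (d / 2).
  have m0 : 0 <= m by rewrite mulr_ge0// divr_ge0// ltW.
  exists (fun s => if s <= m then J s else J m + h m s) => a b a0 ab b1.
  rewrite -natr1 mulrDl mul1r -/m => bm bad.
  case: (leP b m) => hb; first by rewrite (le_trans ab hb); apply: hJ.
  case: (leP a m) => ha.
    have -> : J m + h m b - J a = (J m - J a) + h m b by ring.
    have -> : J m - J a = h a m by apply: hJ; rewrite -/m; lra.
    by apply: hh => //; exact: ltW.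
  have -> : J m + h m b - (J m + h m a) = h m b - h m a by ring.
  rewrite -(hh m a b)//; [ring|exact: ltW|lra].
have [n hn] : exists n : nat, 1 <= n%:R * (d / 2).
  have d20 : 0 < d / 2 by lra.
  have [n hn] := halving_lt 1 d20; exists (2 ^ n)%N.
  move: hn; rewrite ltr_pdivrMr ?exprn_gt0// natrX mulrC; exact: ltW.
have [J hJ] := claim n; exists J => a b a0 ab b1 bad.
by apply: hJ => //; exact: le_trans hn.
Qed.

Lemma uniform_continuity g : curve_continuous g -> forall e, 0 < e ->
  exists2 d, 0 < d & forall t, 0 <= t <= 1 -> forall s, 0 <= s <= 1 ->
    `|s - t| < d -> cmod (g s - g t) < e.
Proof.
move=> cg e e0.
apply: (@uniform_radius R (fun d t => forall s, 0 <= s <= 1 ->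
    `|s - t| < d -> cmod (g s - g t) < e)).
  by move=> r r' t _ rr h s s01 st; apply: h => //; exact: lt_le_trans st rr.
move=> t t01; have [|d d0 hd] := cg t t01 (e / 2); first lra.
exists (d / 2); first lra.
move=> s s01 st u u01 us.
have ut : `|u - t| < d.
  by apply: le_lt_trans (ler_distD s _ _) _; lra.
have std : `|s - t| < d by lra.
have := hd s s01 std; have := hd u u01 ut.
have := cmod_dist (g u) (g t) (g s); rewrite (cmodB (g t) (g s)); lra.
Qed.

Lemma uniform_oscillation D G g : open D -> hol D G -> curve_continuous g ->
  (forall t, 0 <= t <= 1 -> D (g t)) -> forall e, 0 < e ->
  exists2 d, 0 < d & forall t, 0 <= t <= 1 -> forall w w',
    disc (g t) d w -> disc (g t) d w' -> cmod (G w - G w') <= e.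
Proof.
move=> oD hG cg gD e e0.
apply: (@uniform_radius R (fun d t => forall w w',
    disc (g t) d w -> disc (g t) d w' -> cmod (G w - G w') <= e)).
  move=> r r' t _ rr h w w' w1 w2; apply: h; exact: lt_le_trans rr.
move=> t t01.
have [d d0 hd] := gder_lip (hol_cder hG (gD t t01)).
set K := cmod (dC G (g t)) + 1 in hd.
have K0 : 0 < K by rewrite /K; have := cmod_ge0 (dC G (g t)); lra.
pose r := Num.min d (e / 2 / K).
have r0 : 0 < r by rewrite lt_min d0 !divr_gt0.
have [|c c0 hc] := cg t t01 (r / 2); first lra.
exists (Num.min (r / 2) c); first by rewrite lt_min c0 andbT; lra.
move=> s s01 sc w w'; rewrite /disc /= !lt_min => /andP[w1 _] /andP[w2 _].
have sc' : `|s - t| < c by move: sc; rewrite lt_min => /andP[].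
have {}hc := hc s s01 sc'.
have near x : cmod (x - g s) < r / 2 -> cmod (G x - G (g t)) <= e / 2.
  move=> xs; have xt : cmod (x - g t) < r by have := cmod_dist x (g s) (g t); lra.
  have rd : r <= d /\ r <= e / 2 / K by rewrite !ge_min !lexx !orbT.
  apply: le_trans (hd x _) _; first lra.
  have : cmod (x - g t) <= e / 2 / K by lra.
  by rewrite ler_pdivlMr// mulrC.
have := near w w1; have := near w' w2.
have := cmod_dist (G w) (G (g t)) (G w'); rewrite (cmodB (G (g t)) (G w')); lra.
Qed.

(** At a uniform scale the increments of [J] are those of primitives of [G], which
    differ from [G] times the increment of the curve by the oscillation of [G]. *)
Lemma integral_along D G g (J : R -> R[i]) : open D -> hol D G ->
  curve_continuous g -> rectifiable g -> (forall t, 0 <= t <= 1 -> D (g t)) ->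
  (exists r d, [/\ 0 < r, 0 < d & forall a b, 0 <= a -> a <= b -> b <= 1 -> b - a < d ->
     exists2 P, forall w, disc (g a) r w -> cder P w (G w) &
       J b - J a = P (g b) - P (g a)]) ->
  has_curve_integral g G (J 1 - J 0).
Proof.
move=> oD hG cg rg gD [r [d [r0 d0 hJ]]]; apply: integral_criterion => // e e0.
have [r1 r10 h1] := uniform_oscillation oD hG cg gD e0.
pose r2 := Num.min r r1; have r20 : 0 < r2 by rewrite lt_min r0.
have [d1 d10 h2] := uniform_continuity cg r20.
exists (Num.min d d1); first by rewrite lt_min d0.
move=> a t b a0 at_ tb b1; rewrite lt_min => /andP[bd bd1].
have a01 : 0 <= a <= 1 by lra.
have b01 : 0 <= b <= 1 by lra.
have t01 : 0 <= t <= 1 by lra.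
have abs_b : `|b - a| < d1 by rewrite ger0_norm; lra.
have abs_t : `|t - a| < d1 by rewrite ger0_norm; lra.
have gb := h2 a a01 b b01 abs_b; have gt := h2 a a01 t t01 abs_t.
have ab : a <= b by lra.
have [P hP ->] := hJ a b a0 ab b1 bd.
have -> : P (g b) - P (g a) - (g b - g a) * G (g t) =
  (P (g b) - G (g t) * g b) - (P (g a) - G (g t) * g a) by ring.
have inr w : disc (g a) r2 w -> disc (g a) r w /\ disc (g a) r1 w.
  by rewrite /disc /= lt_min => /andP[].
apply: (@cder_mean_value R (fun w => P w - G (g t) * w) (fun w => G w - G (g t) * 1)).
  move=> s hs; apply: gder_sub; last by apply: gder_scale; exact: cder_id.
  by apply: hP; have [] := inr _ (segment_disc hs gb).
move=> s hs; rewrite mulr1; apply: (h1 a a01).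
  by have [] := inr _ (segment_disc hs gb).
by have [] := inr _ gt.
Qed.

(** The increments of local primitives of [G] along the curve form a cocycle,
    because two primitives differ by a constant on the intersection of two
    discs, which is convex. *)
Theorem holomorphic_integral D G g : open D -> hol D G ->
  curve_continuous g -> rectifiable g -> (forall t, 0 <= t <= 1 -> D (g t)) ->
  exists I, has_curve_integral g G I.
Proof.
move=> oD hG cg rg gD.
have [||r r0 hr] := @uniform_radius R (fun r t => exists P,
    forall w, disc (g t) r w -> cder P w (G w)).
- by move=> r r' t _ rr [P hP]; exists P => w wt; apply: hP; exact: lt_le_trans wt rr.
- move=> t t01; have [r [P [r0 _ hP]]] := local_primitive oD hG (gD t t01).
  have [|d d0 hd] := cg t t01 (r / 2); first lra.
  exists (Num.min d (r / 2)); first by rewrite lt_min d0; lra.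
  move=> s s01; rewrite lt_min => /andP[st _]; exists P => w ws; apply: hP.
  have {}ws : cmod (w - g s) < r / 2.
    by move: ws; rewrite /disc /= lt_min => /andP[].
  have := hd s s01 st; have := cmod_dist w (g s) (g t); rewrite /disc /=; lra.
have /choice[P hP] : forall t, exists P, 0 <= t <= 1 ->
    forall w, disc (g t) r w -> cder P w (G w).
  move=> t; case: (boolP (0 <= t <= 1)) => [/hr[P hP]|_]; first by exists P.
  by exists id.
have [d d0 hd] := uniform_continuity cg r0.
have cont a b : 0 <= a -> a <= b -> b <= 1 -> b - a < d -> disc (g a) r (g b).
  move=> a0 ab b1 bad; apply: hd; rewrite ?ger0_norm ?subr_ge0//.
    by rewrite a0 (le_trans ab).
  by rewrite b1 (le_trans a0).
have [|J hJ] := @cocycle_primitive (fun a b => P a (g b) - P a (g a)) d d0; last first.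
  exists (J 1 - J 0); apply: (integral_along oD hG) => //.
  exists r, d; split=> // a b a0 ab b1 bad; exists (P a); last exact: hJ.
  by apply: hP; rewrite a0 (le_trans ab).
move=> a b c a0 ab bc c1 cad.
have b0 := le_trans a0 ab; have b1 := le_trans bc c1.
have a1 := le_trans ab b1.
have dab : disc (g a) r (g b) by apply: cont => //; lra.
have dac : disc (g a) r (g c) by apply: cont => //; lra.
have dbc : disc (g b) r (g c) by apply: cont => //; lra.
suff : (P b (g c) - P a (g c)) - (P b (g b) - P a (g b)) = 0.
  move=> /eqP; rewrite subr_eq0 => /eqP e.
  have -> : P b (g c) - P b (g b) = P a (g c) - P a (g b).
    have -> : P b (g c) = P b (g b) - P a (g b) + P a (g c) by rewrite -e; ring.
    by ring.
  by ring.
apply/eqP; rewrite -cmod_eq0; apply/eqP/le_anti; rewrite cmod_ge0 andbT.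
have := @cder_mean_value R (fun w => P b w - P a w) (fun w => G w - G w) (g b) (g c) 0.
rewrite mul0r; apply=> s hs; last by rewrite subrr cmod0.
apply: gder_sub; apply: hP; rewrite ?a0 ?b0 ?a1 ?b1//.
  exact: segment_disc.
exact: disc_convex.
Qed.

Theorem derivative_integral D H G g : open D -> hol D G ->
  (forall w, D w -> cder H w (G w)) -> curve_continuous g -> rectifiable g ->
  (forall t, 0 <= t <= 1 -> D (g t)) -> g 0 = g 1 ->
  has_curve_integral g G (0 : R[i]).
Proof.
move=> oD hG hH cg rg gD g01.
have -> : 0 = H (g 1) - H (g 0) by rewrite g01 subrr.
apply: (integral_along (J := fun t => H (g t)) oD hG) => //.
have [||r r0 hr] := @uniform_radius R (fun r t => disc (g t) r `<=` D).
- by move=> r r' t _ rr h w wt; apply: h; exact: lt_le_trans wt rr.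
- move=> t t01; have [r r0 hr] := (open_cmod D).1 oD _ (gD t t01).
  have [|d d0 hd] := cg t t01 (r / 2); first lra.
  exists (Num.min d (r / 2)); first by rewrite lt_min d0; lra.
  move=> s s01; rewrite lt_min => /andP[st _] w ws; apply: hr.
  have {}ws : cmod (w - g s) < r / 2.
    by move: ws; rewrite /disc /= lt_min => /andP[].
  have := hd s s01 st; have := cmod_dist w (g s) (g t); lra.
exists r, 1; split=> // a b a0 ab b1 _; exists H => // w wa.
by apply: hH; apply: hr wa; rewrite a0 (le_trans ab).
Qed.

End CurveIntegral.

Section IntegralRules.
Variable R : realType.
Implicit Types (g : R -> R[i]) (F G H : R[i] -> R[i]) (D : set R[i]) (I : R[i]).

Notation pt s := (nth (1 : R) (0 :: s)).
Notation hci := has_curve_integral.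

Lemma integral_ext (V : normedModType R[i]) g (G G' : R[i] -> V) (I : V) :
  (forall t, 0 <= t <= 1 -> G (g t) = G' (g t)) -> hci g G I -> hci g G' I.
Proof.
move=> GG h e /h[d d0 hd]; exists d => // s tau hs x hx.
have := hd s tau hs hx.
rewrite (_ : \sum_(0 <= n < size s) _ =
  \sum_(0 <= n < size s) (g (x n.+1) - g (x n)) *: G' (g (tau n)))//.
rewrite !big_nat; apply: eq_bigr => n /andP[_ ns]; rewrite GG//.
have [_ /andP[x1 x2]] := hx n ns.
have /andP[a0 _] := partition_bounds hs (ltnW ns).
have /andP[_ b1] := partition_bounds hs ns.
by rewrite (le_trans a0 x1) (le_trans x2 b1).
Qed.

Lemma integral_D g G H I J : hci g G I -> hci g H J ->
  hci g (fun t => G t + H t) (I + J).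
Proof.
move=> hI hJ e e0; have e2 : 0 < e / 2 by lra.
have [d1 d10 h1] := hI _ e2; have [d2 d20 h2] := hJ _ e2.
exists (Num.min d1 d2); first by rewrite lt_min d10.
move=> s tau hs x hx.
have := h1 s tau hs; have := h2 s tau hs => /=; rewrite -/x => k2 k1.
have {}k1 : cmod (\sum_(0 <= n < size s) (g (x n.+1) - g (x n)) * G (g (tau n)) - I) < e / 2.
  rewrite -ltcR; apply: k1 => n /hx[]; rewrite lt_min => /andP[? _]; by split.
have {}k2 : cmod (\sum_(0 <= n < size s) (g (x n.+1) - g (x n)) * H (g (tau n)) - J) < e / 2.
  rewrite -ltcR; apply: k2 => n /hx[]; rewrite lt_min => /andP[_ ?]; by split.
rewrite [ `|_| ]cmodE ltcR.
have -> : \sum_(0 <= n < size s) (g (x n.+1) - g (x n)) *: (G (g (tau n)) + H (g (tau n))) =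
  \sum_(0 <= n < size s) (g (x n.+1) - g (x n)) * G (g (tau n)) +
  \sum_(0 <= n < size s) (g (x n.+1) - g (x n)) * H (g (tau n)).
  by rewrite -big_split /=; apply: eq_bigr => n _; rewrite -mulrDr.
rewrite opprD addrACA; apply: le_lt_trans (cmodD _ _) _; lra.
Qed.

Lemma integral_Z g G I c : hci g G I -> hci g (fun t => c * G t) (c * I).
Proof.
move=> hI e e0; have c0 : 0 < cmod c + 1 by have := cmod_ge0 c; lra.
have [d d0 h] := hI (e / (cmod c + 1)) (divr_gt0 e0 c0).
exists d => // s tau hs x hx.
have k : cmod (\sum_(0 <= n < size s) (g (x n.+1) - g (x n)) * G (g (tau n)) - I) < e / (cmod c + 1).
  by rewrite -ltcR; exact: h.
rewrite [ `|_| ]cmodE ltcR.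
have -> : \sum_(0 <= n < size s) (g (x n.+1) - g (x n)) *: (c * G (g (tau n))) =
  c * \sum_(0 <= n < size s) (g (x n.+1) - g (x n)) * G (g (tau n)).
  by rewrite mulr_sumr; apply: eq_bigr => n _; rewrite /GRing.scale /=; ring.
rewrite -mulrBr cmodM.
move: k; rewrite ltr_pdivlMr//; set y := cmod (_ - _) => k.
by have := cmod_ge0 (\sum_(0 <= n < size s) (g (x n.+1) - g (x n)) * G (g (tau n)) - I);
  rewrite -/y; lra.
Qed.

Lemma integral_B g G H I J : hci g G I -> hci g H J ->
  hci g (fun t => G t - H t) (I - J).
Proof.
move=> hI hJ; have := integral_D hI (integral_Z (-1) hJ); rewrite mulN1r.
by apply: integral_ext => t _; rewrite mulN1r.
Qed.

Lemma integral_bound g G I (L M : R) : curve_length_le g L -> 0 <= M ->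
  hci g G I -> (forall t, 0 <= t <= 1 -> cmod (G (g t)) <= M) -> cmod I <= M * L.
Proof.
move=> hL M0 hI hM; apply: le_pinch => e e0.
have [d d0 h] := hI e e0; have [s hs fine] := fine_partition d0.
have tau01 n : (n < size s)%N -> 0 <= pt s n <= 1.
  by move=> ns; apply: partition_bounds hs (ltnW ns).
have := h s (fun n => pt s n) hs => /= k.
have {}k : cmod (\sum_(0 <= n < size s) (g (pt s n.+1) - g (pt s n)) * G (g (pt s n)) - I) < e.
  rewrite -ltcR; apply: k => n ns; split; first exact: fine.
  by rewrite lexx ltW// partition_mono.
set S := \sum_(0 <= n < size s) _ in k.
have -> : I = S - (S - I) by ring.
apply: le_lt_trans (cmodBD _ _) _; apply: ler_ltD k.
apply: le_trans (cmod_sum _ _) _.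
apply: le_trans (_ : \sum_(0 <= n < size s) M * cmod (g (pt s n.+1) - g (pt s n)) <= _).
  rewrite !big_nat; apply: ler_sum => n /andP[_ ns].
  by rewrite cmodM mulrC ler_wpM2r ?cmod_ge0// hM// tau01.
by rewrite -mulr_sumr ler_wpM2l// hL.
Qed.

Lemma integral_unique g G I J : rectifiable g -> hci g G I -> hci g G J -> I = J.
Proof.
move=> /rectifiable_length[L L0 hL] hI hJ.
apply/eqP; rewrite -subr_eq0 -cmod_eq0; apply/eqP/le_anti; rewrite cmod_ge0 andbT.
have := integral_bound hL (lexx 0) (integral_B hI hJ); rewrite mul0r; apply.
by move=> t _; rewrite subrr cmod0.
Qed.

Lemma A3_norm_le (K : numClosedFieldType) (u : A3 K) :
  A3_norm u <= `|coord0 u| + `|coord1 u| + `|coord2 u|.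
Proof.
have h0 (x : K) : A3_norm (MkA3 x 0 0) = `|x|.
  by rewrite /A3_norm /= normr0 expr0n /= !addr0 sqrCK.
have h1 (x : K) : A3_norm (MkA3 0 x 0) = `|x|.
  by rewrite /A3_norm /= normr0 expr0n /= addr0 add0r sqrCK.
have h2 (x : K) : A3_norm (MkA3 0 0 x) = `|x|.
  by rewrite /A3_norm /= normr0 expr0n /= !add0r sqrCK.
have {1}-> : u = MkA3 (coord0 u) 0 0 + MkA3 0 (coord1 u) 0 + MkA3 0 0 (coord2 u).
  by apply: A3P => /=; rewrite ?addr0 ?add0r.
rewrite -h0 -h1 -h2.
by apply: le_trans (A3_normD _ _) _; rewrite lerD2r A3_normD.
Qed.

Lemma coord_sum (K : fieldType) m (f : nat -> A3 K) :
  [/\ coord0 (\sum_(0 <= n < m) f n) = \sum_(0 <= n < m) coord0 (f n),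
      coord1 (\sum_(0 <= n < m) f n) = \sum_(0 <= n < m) coord1 (f n)
    & coord2 (\sum_(0 <= n < m) f n) = \sum_(0 <= n < m) coord2 (f n)].
Proof.
elim: m => [|m [IH0 IH1 IH2]]; first by rewrite !big_nil.
by rewrite !big_nat_recr //= IH0 IH1 IH2.
Qed.

(** The coordinates of the algebra are linear and dominate the norm. *)
Lemma integral_A3 g (G : R[i] -> A3 R[i]) (I : A3 R[i]) :
  hci g (fun t => coord0 (G t)) (coord0 I) ->
  hci g (fun t => coord1 (G t)) (coord1 I) ->
  hci g (fun t => coord2 (G t)) (coord2 I) -> hci g G I.
Proof.
move=> h0 h1 h2 e e0; have e3 : 0 < e / 3 by lra.
have [d0 p0 k0] := h0 _ e3; have [d1 p1 k1] := h1 _ e3; have [d2 p2 k2] := h2 _ e3.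
exists (Num.min d0 (Num.min d1 d2)); first by rewrite !lt_min p0 p1.
move=> s tau hs x hx.
apply: le_lt_trans (A3_norm_le _) _ => /=.
have [-> -> ->] := coord_sum (size s)
  (fun n => (g (x n.+1) - g (x n)) *: G (g (tau n))).
have -> : e%:C = (e / 3)%:C + (e / 3)%:C + (e / 3)%:C :> R[i].
  by rewrite -!rmorphD /=; congr (_%:C)%C; field.
have q n : (n < size s)%N -> [/\ x n.+1 - x n < d0 /\ x n <= tau n <= x n.+1,
    x n.+1 - x n < d1 /\ x n <= tau n <= x n.+1 &
    x n.+1 - x n < d2 /\ x n <= tau n <= x n.+1].
  by move=> /hx[]; rewrite !lt_min => /and3P[? ? ?] ?; split.
apply: ltrD; first apply: ltrD.
- by apply: k0 => // n /q[].
- by apply: k1 => // n /q[].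
- by apply: k2 => // n /q[].
Qed.

End IntegralRules.

Section Bounds.
Variable R : realType.
Implicit Types (g : R -> R[i]) (F G H : R[i] -> R[i]) (D : set R[i]).

Lemma curve_bounded g : curve_continuous g ->
  exists2 M, 0 < M & forall t, 0 <= t <= 1 -> cmod (g t) <= M.
Proof.
move=> cg.
have [||r r0 hr] := @uniform_radius R (fun r t => cmod (g t) <= r^-1).
- move=> r r' t r'0 rr h; apply: le_trans h _.
  by rewrite lef_pV2 ?posrE//; exact: lt_le_trans rr.
- move=> t t01; have [d d0 hd] := cg t t01 1 ltr01.
  have c0 : 0 < cmod (g t) + 1 by have := cmod_ge0 (g t); lra.
  exists (Num.min d (cmod (g t) + 1)^-1); first by rewrite lt_min d0 invr_gt0.
  move=> s s01; rewrite lt_min => /andP[/(hd s s01) h _].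
  have : cmod (g s) <= cmod (g t) + 1.
    by have := cmod_dist (g s) (g t) 0; rewrite !subr0; lra.
  move/le_trans; apply; rewrite -[leLHS]invrK lef_pV2 ?posrE ?invr_gt0//.
    by rewrite ge_min lexx orbT.
  by rewrite lt_min d0 invr_gt0.
exists r^-1 => //; by rewrite invr_gt0.
Qed.

Lemma curve_continuous_comp D F g : hol D F -> curve_continuous g ->
  (forall t, 0 <= t <= 1 -> D (g t)) -> curve_continuous (fun t => F (g t)).
Proof.
move=> hF cg gD t t01 e e0.
have [d d0 hd] := gder_lip (hol_cder hF (gD t t01)).
set K := cmod _ + 1 in hd; have K0 : 0 < K by rewrite /K; have := cmod_ge0 (dC F (g t)); lra.
have r0 : 0 < Num.min d (e / K) by rewrite lt_min d0 divr_gt0.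
have [k k0 hk] := cg t t01 _ r0; exists k => // s s01 st.
have := hk s s01 st; rewrite lt_min => /andP[h1 h2].
by apply: le_lt_trans (hd _ h1) _; rewrite mulrC -ltr_pdivlMr.
Qed.

Lemma open_compl1 (w : R[i]) : open (~` [set w]).
Proof.
apply/open_cmod => z /eqP zw; exists (cmod (z - w)).
  by rewrite cmod_gt0 subr_eq0.
by move=> x xz e; move: xz; rewrite e cmodB ltxx.
Qed.

Lemma hol_inv_sub (w : R[i]) n : hol (~` [set w]) (fun t => ((t - w) ^+ n)^-1).
Proof.
have h : hol (~` [set w]) (fun t => (t - w) ^+ n).
  elim: n => [|n IH]; first exact: hol_cst.
  apply: (@hol_ext R _ (fun t => (t - w) * (t - w) ^+ n)); first exact: open_compl1.
    by move=> t _; rewrite exprS.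
  by apply: hol_M => //; apply: hol_B; [exact: hol_id|exact: hol_cst].
apply: (@hol_ext R _ (fun t => 1 / (t - w) ^+ n)); first exact: open_compl1.
  by move=> t _; rewrite div1r.
apply: hol_div => //; first exact: hol_cst.
by move=> t /eqP tw; rewrite expf_neq0// subr_eq0.
Qed.

Lemma away_from_curve g (w : R[i]) : curve_continuous g -> ~ curve_image g w ->
  exists2 r, 0 < r & forall t, 0 <= t <= 1 -> r <= cmod (g t - w).
Proof.
move=> cg gw.
have off t : 0 <= t <= 1 -> (~` [set w]) (g t).
  by move=> t01 e; apply: gw; exists t => //=; rewrite in_itv.
have [M M0 hM] := curve_bounded (curve_continuous_comp (@hol_inv_sub w 1) cg off).
exists M^-1; first by rewrite invr_gt0.
move=> t t01; have := hM t t01; rewrite expr1 cmodV.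
have c0 : 0 < cmod (g t - w) by rewrite cmod_gt0 subr_eq0; apply/eqP; exact: off.
by rewrite -[in X in X -> _](invrK M) lef_pV2 ?posrE ?invr_gt0.
Qed.

(** The level set is open and closed in [A]. *)
Lemma connected_constant (T : topologicalType) (S : Type) (A : set T) (h : T -> S) :
  connected A -> (forall x, A x -> nbhs x [set y | A y -> h y = h x]) ->
  forall x y, A x -> A y -> h y = h x.
Proof.
move=> cA loc x y Ax Ay.
pose B := A `&` [set z | h z = h x].
suff : B = A by move=> e; have : B y by [rewrite e]; case.
apply: cA; first by exists x.
- exists [set y | A y -> h y = h x]°; first exact: open_interior.
  apply/seteqP; split=> z [Az] => [hz|/interior_subset hz]; split=> //; last exact: hz.
  by have := loc z Az; rewrite /= hz.
- exists (~` [set y | A y -> h y <> h x]°).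
    by apply: open_closedC; exact: open_interior.
  apply/seteqP; split=> z [Az hz]; split=> //.
    by move=> /interior_subset /(_ Az).
  apply: contrapT => hz'; apply: hz.
  by apply: filterS (loc z Az) => u /= hu Au; rewrite hu.
Qed.

Lemma bounded_cmod (A : set R[i]) (M : R) : (forall w, A w -> cmod w <= M) -> bounded_set A.
Proof.
move=> h; exists M%:C; split; first by rewrite complex_real.
move=> x Mx w /h; rewrite -lecR => hw; change ((cmod w)%:C <= x).
exact: le_trans hw (ltW Mx).
Qed.

End Bounds.

(** * The index and Cauchy's integral formula *)

Section Winding.
Variable R : realType.
Variable g : R -> R[i].
Hypothesis cg : curve_continuous g.
Hypothesis rg : rectifiable g.
Hypothesis g01 : g 0 = g 1.
Implicit Types (F G H : R[i] -> R[i]) (D : set R[i]) (z w : R[i]).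

Notation hci := (has_curve_integral g).

Lemma off_curve w t : ~ curve_image g w -> 0 <= t <= 1 -> (~` [set w]) (g t).
Proof. by move=> gw t01 e; apply: gw; exists t => //=; rewrite in_itv. Qed.

(** The integrand of the left-hand side is [F t * (w' - w) ^+ 2] divided by
    [(t - w) ^+ 2 * (t - w')], by the geometric expansion of the Cauchy kernel. *)
Lemma kernel_bound F w w' I1 I2 I3 (r M L : R) : 0 < r -> 0 <= M ->
  curve_length_le g L ->
  (forall t, 0 <= t <= 1 -> cmod (F (g t)) <= M) ->
  (forall t, 0 <= t <= 1 -> r <= cmod (g t - w)) ->
  (forall t, 0 <= t <= 1 -> r <= cmod (g t - w')) ->
  hci (fun t => F t * ((t - w') ^+ 1)^-1) I1 ->
  hci (fun t => F t * ((t - w) ^+ 1)^-1) I2 ->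
  hci (fun t => F t * ((t - w) ^+ 2)^-1) I3 ->
  cmod (I1 - I2 - I3 * (w' - w)) <= M * L / r ^+ 3 * cmod (w' - w) ^+ 2.
Proof.
move=> r0 M0 hL hM hw hw' h1 h2 h3.
have := integral_B (integral_B h1 h2) (integral_Z (w' - w) h3).
rewrite [(w' - w) * I3]mulrC => h.
have -> : M * L / r ^+ 3 * cmod (w' - w) ^+ 2 = M * cmod (w' - w) ^+ 2 / r ^+ 3 * L.
  by ring.
apply: (integral_bound hL) h _.
  by rewrite divr_ge0 ?mulr_ge0 ?exprn_ge0 ?cmod_ge0// ltW.
move=> t t01.
have c1 : 0 < cmod (g t - w) by exact: lt_le_trans (hw t t01).
have c2 : 0 < cmod (g t - w') by exact: lt_le_trans (hw' t t01).
have n1 : g t - w != 0 by rewrite -cmod_gt0.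
have n2 : g t - w' != 0 by rewrite -cmod_gt0.
have -> : F (g t) * ((g t - w') ^+ 1)^-1 - F (g t) * ((g t - w) ^+ 1)^-1 -
    (w' - w) * (F (g t) * ((g t - w) ^+ 2)^-1) =
  F (g t) * (w' - w) ^+ 2 / ((g t - w) ^+ 2 * (g t - w')).
  by field; rewrite n1 n2.
rewrite cmodM cmodV [cmod (F _ * _)]cmodM cmodX [cmod (_ ^+ 2 * _)]cmodM cmodX.
apply: ler_pM.
- by rewrite mulr_ge0 ?exprn_ge0 ?cmod_ge0.
- by rewrite invr_ge0 mulr_ge0 ?exprn_ge0 ?cmod_ge0.
- by rewrite ler_wpM2r ?exprn_ge0 ?cmod_ge0// hM.
rewrite lef_pV2 ?posrE ?mulr_gt0 ?exprn_gt0// [r ^+ 3]exprSr.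
apply: ler_pM; [by rewrite exprn_ge0// ltW|exact: ltW| |exact: hw'].
by rewrite ler_pXn2r ?nnegrE ?cmod_ge0 ?(ltW r0)//; exact: hw.
Qed.

Lemma kernel_integral D F w n : open D -> hol D F ->
  (forall t, 0 <= t <= 1 -> D (g t)) -> ~ curve_image g w ->
  exists I, hci (fun t => F t * ((t - w) ^+ n)^-1) I.
Proof.
move=> oD hF gD gw.
apply: (@holomorphic_integral R (D `&` ~` [set w])) => //.
- by apply: openI => //; exact: open_compl1.
- apply: hol_M; [apply: hol_sub hF; exact: subIsetl|].
  by apply: hol_sub (@hol_inv_sub R w n); exact: subIsetr.
- by move=> t t01; split; [exact: gD|exact: off_curve].
Qed.

(** The index times 2 pi i, with an arbitrary value on the curve. *)
Definition winding w : R[i] :=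
  get [set I | hci (fun t => 1 * ((t - w) ^+ 1)^-1) I].

Lemma windingP w : ~ curve_image g w -> hci (fun t => 1 * ((t - w) ^+ 1)^-1) (winding w).
Proof.
move=> gw; rewrite /winding; case: xgetP => [I -> //|no].
have [//|I hI] := @kernel_integral setT (fun _ => 1) w 1%N openT (@hol_cst R _ 1) _ gw.
by case: (no I).
Qed.

(** The first order term of the increment is the integral of the derivative of
    [- 1 / (t - x)], which vanishes as the curve is closed. *)
Lemma winding_quadratic w (r : R) : 0 < r ->
  (forall t, 0 <= t <= 1 -> 2 * r <= cmod (g t - w)) ->
  exists K, forall x y, disc w r x -> disc w r y ->
    cmod (winding y - winding x) <= K * cmod (y - x) ^+ 2.
Proof.
move=> r0 hr; have [L L0 hL] := rectifiable_length rg.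
exists (1 * L / r ^+ 3) => x y xw yw.
have far z : disc w r z -> forall t, 0 <= t <= 1 -> r <= cmod (g t - z).
  move=> zw t t01; have := hr t t01; have := cmod_dist (g t) z w.
  by move: zw; rewrite /disc /=; lra.
have off z : disc w r z -> ~ curve_image g z.
  move=> zw [t /=]; rewrite in_itv /= => t01 e; have := far z zw t t01.
  by rewrite e subrr cmod0; lra.
have d0 : hci (fun t => 1 * ((t - x) ^+ 2)^-1) (0 : R[i]).
  apply: (@derivative_integral R (~` [set x]) (fun t => - 1 / (t - x))) => //.
  - exact: open_compl1.
  - by apply: hol_M; [exact: hol_cst|exact: hol_inv_sub].
  - move=> v /eqP vx; have vx0 : v - x != 0 by rewrite subr_eq0.
    have := @gder_div R R[i] (fun w => w) (fun _ => - 1) (fun t => t - x) v _ _ vx0 (gder_cst (fun w : R[i] => w) (- 1) v)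
      (gder_sub (cder_id v) (gder_cst (fun w : R[i] => w) x v)).
    by congr gder; field.
  - by move=> t t01; apply: off_curve => //; exact: off.
have := kernel_bound r0 ler01 hL _ (far x xw) (far y yw)
  (windingP (off y yw)) (windingP (off x xw)) d0.
by rewrite mul0r subr0; apply=> t _; rewrite cmod1.
Qed.

(** By [winding_quadratic] the index has derivative 0 off the curve. *)
Lemma winding_locally_constant w : ~ curve_image g w -> exists2 r, 0 < r &
  forall x, disc w r x -> ~ curve_image g x /\ winding x = winding w.
Proof.
move=> gw; have [r' r'0 hr'] := away_from_curve cg gw.
pose r := r' / 2; have r0 : 0 < r by rewrite /r; lra.
have [|K hK] := @winding_quadratic w r r0.
  by move=> t t01; have := hr' t t01; rewrite /r; lra.
exists r; first exact: r0.
move=> x xw; split.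
  move=> [t /=]; rewrite in_itv /= => t01 e; have := hr' t t01.
  by rewrite e; move: xw; rewrite /disc /r /=; lra.
apply/eqP; rewrite -subr_eq0 -cmod_eq0; apply/eqP/le_anti; rewrite cmod_ge0 andbT.
have := @cder_mean_value R winding (fun _ => 0) w x 0; rewrite mul0r; apply; last first.
  by move=> *; rewrite cmod0.
move=> t ht; have yw := segment_disc ht xw; set y := w + _ in yw *.
have K0 : 0 < `|K| + 1 by have := normr_ge0 K; lra.
have ry : 0 < r - cmod (y - w) by move: yw; rewrite /disc /=; lra.
move=> e e0; exists (Num.min (r - cmod (y - w)) (e / (`|K| + 1))).
  by rewrite lt_min ry divr_gt0.
move=> z; rewrite lt_min => /andP[z1 z2].
have zw : disc w r z.
  by have := cmod_dist z y w; rewrite /disc /=; lra.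
rewrite mul0r subr0; apply: le_trans (hK _ _ yw zw) _.
rewrite expr2 mulrA ler_wpM2r ?cmod_ge0//.
apply: le_trans (_ : (`|K| + 1) * cmod (z - y) <= _).
  by rewrite ler_wpM2r ?cmod_ge0//; have := ler_norm K; lra.
by move: z2; rewrite ltr_pdivlMr// mulrC => /ltW.
Qed.

(** The index is constant on the unbounded component, and small far away. *)
Lemma winding_outside w : ~ curve_image g w -> ~ encloses g w -> winding w = 0.
Proof.
move=> gw ne.
have nb : ~ bounded_set (connected_component (~` curve_image g) w).
  by move=> h; apply: ne.
have [L L0 hL] := rectifiable_length rg.
have [M M0 hM] := curve_bounded cg.
apply/eqP; rewrite -cmod_eq0; apply/eqP/le_anti; rewrite cmod_ge0 andbT.
apply: le_pinch => e e0; rewrite add0r.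
pose B := M + (L + 1) / e.
have [x cx xB] : exists2 x, connected_component (~` curve_image g) w x & B < cmod x.
  apply: contrapT => no; apply: nb; apply: (@bounded_cmod R _ B) => x cx.
  by rewrite leNgt; apply/negP => xB; apply: no; exists x.
have cc : connected_component (~` curve_image g) w w.
  exact: connected_component_refl.
have sub := @connected_component_sub _ (~` curve_image g) w.
have <- : winding x = winding w.
  apply: (connected_constant (@component_connected _ (~` curve_image g) w)) cc cx => y cy.
  have [r r0 hr] := winding_locally_constant (sub _ cy).
  apply/nbhs_cmod; exists r; first exact: r0.
  by move=> z /hr[_ hz] _; exact: hz.
apply: le_lt_trans (_ : e / (L + 1) * L < _); last first.
  by rewrite mulrAC ltr_pdivrMr; nra.
apply: (integral_bound hL) (windingP (sub _ cx)) _.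
  by rewrite divr_ge0 ?ltW//; lra.
move=> t t01; rewrite mul1r expr1 cmodV.
have q0 : 0 < (L + 1) / e by rewrite divr_gt0//; lra.
have h : (L + 1) / e <= cmod (g t - x).
  have := hM t t01; have := cmodD (g t - x) (- g t); rewrite addrAC subrr sub0r !cmodN.
  by move: xB; rewrite /B; lra.
rewrite -[e / _]invf_div lef_pV2 ?posrE//; exact: lt_le_trans h.
Qed.

(** Follow the ray from [w] to infinity, on which the index is constant. *)
Lemma winding_far w (M : R) : (forall t, 0 <= t <= 1 -> cmod (g t) <= M) ->
  M < cmod w -> ~ curve_image g w /\ winding w = 0.
Proof.
move=> hM wM.
have M0 : 0 <= M by apply: le_trans (cmod_ge0 (g 0)) (hM 0 _); rewrite lexx ler01.
have far x : M < cmod x -> ~ curve_image g x.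
  move=> xM [t /=]; rewrite in_itv /= => /hM h e; move: h; rewrite e; lra.
split; first exact: far.
have [L L0 hL] := rectifiable_length rg.
have w0 : 0 < cmod w by lra.
have cs (s : R) : 1 <= s -> cmod (s%:C * w) = s * cmod w.
  by move=> s1; rewrite cmodM cmodR ger0_norm//; lra.
have off (s : R) : 1 <= s -> ~ curve_image g (s%:C * w).
  move=> s1; apply: far; rewrite cs//; have := ler_wpM2r (ltW w0) s1; lra.
have const (s : R) : 1 <= s -> winding (s%:C * w) = winding w.
  move=> s1; apply/eqP; rewrite -subr_eq0 -cmod_eq0; apply/eqP/le_anti.
  rewrite cmod_ge0 andbT.
  have := @curve_mean_value R (fun s => winding (s%:C * w)) (fun _ => 0) 1 s 0 s1.
  rewrite rmorph1 mul0r mul1r; apply; last by move=> *; rewrite cmod0.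
  move=> x /andP[x1 _]; have [r r0 hr] := winding_locally_constant (off x x1).
  move=> e e0; exists (r / cmod w); first by rewrite divr_gt0.
  move=> y; rewrite ltr_pdivlMr// => yx.
  have [|_ ->] := hr (y%:C * w).
    by rewrite /disc /= -mulrBl cmodM.
  by rewrite mul0r subrr subr0 cmod0 mulr_ge0 ?cmod_ge0// ltW.
apply/eqP; rewrite -cmod_eq0; apply/eqP/le_anti; rewrite cmod_ge0 andbT.
apply: le_pinch => e e0; rewrite add0r.
pose s := (M + (L + 1) / e) / cmod w + 1.
have q0 : 0 < (L + 1) / e by rewrite divr_gt0//; lra.
have s1 : 1 <= s by rewrite /s lerDr divr_ge0//; lra.
have sw : M + (L + 1) / e <= s * cmod w.
  have -> : s * cmod w = M + (L + 1) / e + cmod w.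
    by rewrite /s; field; rewrite !lt0r_neq0.
  by lra.
rewrite -(const s s1); apply: le_lt_trans (_ : e / (L + 1) * L < _); last first.
  by rewrite mulrAC ltr_pdivrMr; nra.
apply: (integral_bound hL) (windingP (off s s1)) _.
  by rewrite divr_ge0 ?ltW//; lra.
move=> t t01; rewrite mul1r expr1 cmodV.
have h : (L + 1) / e <= cmod (g t - s%:C * w).
  have := hM t t01; have := cmodD (g t - s%:C * w) (- g t).
  by rewrite addrAC subrr sub0r !cmodN cs//; lra.
rewrite -[e / _]invf_div lef_pV2 ?posrE//; exact: lt_le_trans h.
Qed.

End Winding.

Section Dixon.
Variable R : realType.
Variable g : R -> R[i].
Hypothesis cg : curve_continuous g.
Hypothesis rg : rectifiable g.
Hypothesis g01 : g 0 = g 1.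
Variable D : set R[i].
Hypothesis oD : open D.
Hypothesis gD : forall t, 0 <= t <= 1 -> D (g t).
Implicit Types (F G H : R[i] -> R[i]) (z w : R[i]).

Notation hci := (has_curve_integral g).

(** Off the curve this is the Cauchy transform of [F] minus [F] times the index;
    unlike these two it is holomorphic on all of [D], the curve included. *)
Definition dixon F z : R[i] := get [set I | hci (dq F z) I].

Lemma dixonP F z : hol D F -> D z -> hci (dq F z) (dixon F z).
Proof.
move=> hF zD; rewrite /dixon; case: xgetP => [I -> //|no].
have [I hI] := @holomorphic_integral R D _ g oD (hol_dq oD hF zD) cg rg gD.
by case: (no I).
Qed.

(** Near [z0] the divided difference is bounded by the derivative, by the mean
    value inequality; elsewhere the denominator is bounded away from 0. *)
Lemma dq_bounded F z0 : hol D F -> D z0 -> exists r M, [/\ 0 < r, 0 <= M &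
  forall z, disc z0 r z -> D z /\ forall t, 0 <= t <= 1 -> cmod (dq F z (g t)) <= M].
Proof.
move=> hF zD; have hF' := hol_dC oD hF.
have [r1 [M1 [r10 M10 sub1 b1]]] := hol_bounded oD hF' zD.
have [r2 [M2 [r20 M20 sub2 b2]]] := hol_bounded oD hF zD.
have [M3 M30 b3] := curve_bounded (curve_continuous_comp hF cg gD).
pose r := Num.min r1 r2.
have r0 : 0 < r by rewrite lt_min r10.
exists (r / 2), (M1 + (M3 + M2) / (r / 2)); split; first lra.
  by rewrite addr_ge0// divr_ge0//; lra.
have M0 : 0 <= (M3 + M2) / (r / 2) by rewrite divr_ge0//; lra.
move=> z zr.
have [z1 z2] : disc z0 r1 z /\ disc z0 r2 z.
  by move: zr; rewrite /disc /r /=; case: (leP r1 r2) => ?; lra.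
split; first exact: sub1.
move=> t t01; rewrite /dq; case: (eqVneq (g t) z) => [_|gz].
  by apply: le_trans (b1 z z1) _; lra.
have gz0 : 0 < cmod (g t - z) by rewrite cmod_gt0 subr_eq0.
rewrite cmodM cmodV ler_pdivrMr//.
case: (ltP (cmod (g t - z0)) r) => near.
  apply: le_trans (_ : M1 * cmod (g t - z) <= _); last by rewrite ler_pM2r//; lra.
  have g1 : disc z0 r1 (g t) by move: near; rewrite /disc /= lt_min => /andP[].
  apply: (@cder_mean_value R F (dC F)) => s hs.
    by apply: hol_cder hF _; apply: sub1; exact: disc_convex.
  by apply: b1; exact: disc_convex.
apply: le_trans (_ : (M3 + M2) / (r / 2) * cmod (g t - z) <= _); last by rewrite ler_pM2r//; lra.
apply: le_trans (cmodBD _ _) _.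
apply: le_trans (_ : (M3 + M2) / (r / 2) * (r / 2) <= _).
  by rewrite divfK ?lt0r_neq0//; [apply: lerD; [exact: b3|exact: b2]|lra].
rewrite ler_wpM2l//.
have := cmod_dist (g t) z z0; move: zr; rewrite /disc /=; lra.
Qed.

(** Second divided differences are symmetric: increments of [dixon F] are values
    of [dixon] for another holomorphic function.  So Lipschitz continuity for all
    functions yields differentiability, also at the points of the curve. *)
Lemma dixon_sub F z0 z : hol D F -> D z0 -> D z ->
  dixon F z - dixon F z0 = (z - z0) * dixon (dq F z0) z.
Proof.
move=> hF z0D zD; have h1 := hol_dq oD hF z0D.
apply: (integral_unique rg) (integral_B (dixonP hF zD) (dixonP hF z0D)) _.
apply: integral_ext (integral_Z (z - z0) (dixonP h1 zD)) => t t01.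
set F1 := dq F z0; set x := g t.
have eF w : F w = F z0 + (w - z0) * F1 w by exact: dqE.
have dF : dC F z = F1 z + (z - z0) * dC F1 z.
  apply: dCE.
  have h : cder (fun w => F z0 + (w - z0) * F1 w) z
      (0 + ((1 - 0) * F1 z + (z - z0) * dC F1 z)).
    apply: gderD; first exact: gder_cst.
    apply: gderM; last exact: hol_cder h1 zD.
    by apply: gder_sub; [exact: cder_id|exact: gder_cst].
  rewrite subr0 add0r mul1r in h.
  by apply: gder_ext ltr01 _ h => w _.
rewrite [dq F z x]/dq [dq F1 z x]/dq; case: (eqVneq x z) => [->|xz].
  by rewrite dF -/F1; ring.
by rewrite (eF x) (eF z) -/(F1 x); field; rewrite subr_eq0.
Qed.

Lemma dixon_lipschitz F z0 : hol D F -> D z0 -> exists r K, [/\ 0 < r, 0 <= K &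
  forall z, disc z0 r z -> D z /\ cmod (dixon F z - dixon F z0) <= K * cmod (z - z0)].
Proof.
move=> hF z0D; have h1 := hol_dq oD hF z0D.
have [L L0 hL] := rectifiable_length rg.
have [r [M [r0 M0 hM]]] := dq_bounded h1 z0D.
exists r, (M * L); split=> //; first exact: mulr_ge0.
move=> z /hM[zD bz]; split=> //.
rewrite dixon_sub// cmodM mulrC ler_wpM2r ?cmod_ge0//.
exact: integral_bound hL M0 (dixonP h1 zD) bz.
Qed.

Lemma hol_dixon F : hol D F -> hol D (dixon F).
Proof.
move=> hF z0 z0D; have h1 := hol_dq oD hF z0D.
exists (dixon (dq F z0) z0) => e e0.
have [r [K [r0 K0 hK]]] := dixon_lipschitz h1 z0D.
have K1 : 0 < K + 1 by lra.
exists (Num.min r (e / (K + 1))); first by rewrite lt_min r0 divr_gt0.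
move=> z; rewrite lt_min => /andP[zr ze].
have [zD bz] := hK z zr.
rewrite dixon_sub// [_ * (z - z0)]mulrC -mulrBr cmodM mulrC ler_wpM2r ?cmod_ge0//.
apply: le_trans bz _; move: ze; rewrite ltr_pdivlMr//.
by have := cmod_ge0 (z - z0); lra.
Qed.

Definition cauchy_transform F z : R[i] :=
  get [set I | hci (fun t => F t * ((t - z) ^+ 1)^-1) I].

Lemma cauchy_transformP F z : hol D F -> ~ curve_image g z ->
  hci (fun t => F t * ((t - z) ^+ 1)^-1) (cauchy_transform F z).
Proof.
move=> hF gz; rewrite /cauchy_transform; case: xgetP => [I -> //|no].
have [I hI] := kernel_integral cg rg 1 oD hF gD gz.
by case: (no I).
Qed.

Lemma dixon_off F z : hol D F -> D z -> ~ curve_image g z ->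
  dixon F z = cauchy_transform F z - F z * winding g z.
Proof.
move=> hF zD gz; apply: (integral_unique rg) (dixonP hF zD) _.
have := integral_B (cauchy_transformP hF gz) (integral_Z (F z) (windingP cg rg gz)).
apply: integral_ext => t t01; rewrite /dq expr1 div1r.
have gtz : g t != z by apply/eqP => e; exact: off_curve gz t01 e.
by rewrite (negbTE gtz); field; rewrite subr_eq0.
Qed.

(** [kernel_bound] is the differentiability of the transform at [z]. *)
Lemma cauchy_transform_cder F z : hol D F -> ~ curve_image g z ->
  exists L, cder (cauchy_transform F) z L.
Proof.
move=> hF gz; have [r' r'0 hr'] := away_from_curve cg gz.
have [L L0 hL] := rectifiable_length rg.
have [M M0 hM] := curve_bounded (curve_continuous_comp hF cg gD).
have [I hI] := kernel_integral cg rg 2 oD hF gD gz.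
pose r := r' / 2; have r0 : 0 < r by rewrite /r; lra.
exists I => e e0.
pose K := M * L / r ^+ 3.
have K0 : 0 <= K by rewrite divr_ge0 ?mulr_ge0 ?exprn_ge0// ltW.
exists (Num.min r (e / (K + 1))); first by rewrite lt_min r0 divr_gt0//; lra.
move=> w; rewrite lt_min => /andP[wr we].
have far t : 0 <= t <= 1 -> r <= cmod (g t - w).
  move=> t01; have := hr' t t01; have := cmod_dist (g t) w z; move: wr; rewrite /r; lra.
have gw : ~ curve_image g w.
  move=> [t /=]; rewrite in_itv /= => /far h E; move: h; rewrite E subrr cmod0; lra.
have := kernel_bound r0 (ltW M0) hL hM _ far (cauchy_transformP hF gw)
  (cauchy_transformP hF gz) hI.
move=> /(_ (fun t t01 => le_trans _ (hr' t t01))) h.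
apply: le_trans (h _) _; first by move=> *; rewrite /r; lra.
rewrite -/K expr2 mulrA ler_wpM2r ?cmod_ge0//.
by move: we; rewrite ltr_pdivlMr; have := cmod_ge0 (w - z); lra.
Qed.

Lemma bounded_disc F (r : R) : hol setT F -> exists M, forall w, cmod w <= r -> cmod (F w) <= M.
Proof.
move=> hF.
case: (ltP r 0) => r0.
  by exists 0 => w wr; have := cmod_ge0 w; lra.
pose S := Rect (- r) r (- r) r : rect R.
pose f (p : R * R) := cmod (F (p.1 +i* p.2)%C).
have Sn : [set p : R * R | inrect S p.1 p.2] !=set0.
  by exists (0, 0); rewrite /= /inrect /=; lra.
have cf : continuous f.
  move=> p; apply/cvgrPdist_lt => e e0.
  have [d d0 hd] := gder_lip (hol_cder hF (I : setT (p.1 +i* p.2)%C)).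
  set K := _ + 1 in hd; have K0 : 0 < K by rewrite /K; have := cmod_ge0 (dC F (p.1 +i* p.2)%C); lra.
  pose k := Num.min d (e / K) / 2.
  have k0 : 0 < k by rewrite divr_gt0// lt_min d0 divr_gt0.
  have k1 : 2 * k <= d /\ 2 * k <= e / K.
    by rewrite /k; case: (leP d (e / K)) => ?; split; lra.
  exists (ball p.1 k, ball p.2 k) => /=; first by split; exact: nbhsx_ballx.
  move=> [a b] [/= ha hb].
  have close : cmod ((a +i* b)%C - (p.1 +i* p.2)%C) < 2 * k.
    apply: le_lt_trans (cmod_le_ReIm _) _ => /=.
    by move: ha hb; rewrite /ball /= distrC [`|p.2 - b|]distrC; lra.
  have {}hd := hd _ (lt_le_trans close k1.1).
  rewrite /f /=.
  have h1 := cmod_dist (F (a +i* b)%C) (F (p.1 +i* p.2)%C) 0.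
  have h2 := cmod_dist (F (p.1 +i* p.2)%C) (F (a +i* b)%C) 0.
  rewrite !subr0 in h1 h2; rewrite (cmodB (F (p.1 +i* p.2)%C)) in h2.
  apply: (@le_lt_trans _ _ (cmod (F (a +i* b)%C - F (p.1 +i* p.2)%C))).
    by rewrite ler_norml; lra.
  apply: le_lt_trans hd _; rewrite mulrC -ltr_pdivlMr//; lra.
have [c _ hc] := compact_EVT_max Sn (@compact_rect R S)
  (@continuous_subspaceT _ _ _ f cf).
exists (f c) => w wr; have := hc (complex.Re w, complex.Im w).
rewrite /f /= -complexRI; apply; apply/mem_set; rewrite /= /inrect /=.
by have := cmod_Re w; have := cmod_Im w; rewrite -!ler_norml; split; lra.
Qed.

(** By [dixon_off], [dixon F] and the Cauchy transform of [F] agree where the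
    index vanishes, which includes the complement of [D].  Together they define
    an entire function; it tends to 0 at infinity, so it is 0.  At a point with
    index 1 this is Cauchy's formula. *)
Theorem cauchy_formula F z : hol D F -> (forall w, encloses g w -> D w) ->
  positively_oriented g -> encloses g z ->
  hci (fun t => F t * ((t - z) ^+ 1)^-1) (two_pi_i R * F z).
Proof.
move=> hF inD po ez.
have out w : ~ D w -> ~ curve_image g w /\ winding g w = 0.
  move=> nD; have gw : ~ curve_image g w.
    by move=> [t /=]; rewrite in_itv /= => t01 e; apply: nD; rewrite -e; exact: gD.
  by split=> //; apply: winding_outside => // /inD.
have [h [hin hout]] : exists h : R[i] -> R[i], (forall w, D w -> h w = dixon F w) /\
    (forall w, ~ D w -> h w = cauchy_transform F w).
  exists (fun w => if `[< D w >] then dixon F w else cauchy_transform F w).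
  by split=> w wD; [rewrite asboolT|rewrite asboolF].
have h0 w : ~ curve_image g w -> winding g w = 0 -> h w = cauchy_transform F w.
  move=> gw w0; case: (pselect (D w)) => wD; last exact: (hout w wD).
  by rewrite (hin w wD) (dixon_off hF wD gw) w0 mulr0 subr0.
have hD : hol D h.
  exact: (@hol_ext R D (dixon F) h oD (fun x xD => esym (hin x xD)) (hol_dixon hF)).
have entire : hol setT h.
  move=> w _; case: (pselect (D w)) => wD; first exact: (hD w wD).
  have [gw w0] := out w wD.
  have [r r0 hr] := winding_locally_constant cg rg g01 gw.
  have [L hL] := cauchy_transform_cder hF gw; exists L.
  have ext x : cmod (x - w) < r -> cauchy_transform F x = h x.
    by move=> /hr[gx xw]; exact: esym (h0 x gx (etrans xw w0)).
  exact: (gder_ext r0 ext hL).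
have [M M0 hM] := curve_bounded cg.
have [N N0 hN] := curve_bounded (curve_continuous_comp hF cg gD).
have [L L0 hL] := rectifiable_length rg.
(* Far away the index vanishes, so [h] is the Cauchy transform there. *)
have far w : M < cmod w -> cmod (h w) <= N / (cmod w - M) * L.
  move=> wM; have [gw w0] := winding_far cg rg g01 hM wM.
  rewrite (h0 w gw w0); apply: (integral_bound hL) (cauchy_transformP hF gw) _.
    by rewrite divr_ge0 ?ltW// subr_gt0.
  move=> t t01; rewrite expr1 cmodM cmodV ler_pM ?invr_ge0 ?cmod_ge0 ?hN//.
  have h1 : cmod w - M <= cmod (g t - w).
    have := hM t t01; have := cmodD (g t - w) (- g t).
    by rewrite addrAC subrr sub0r !cmodN; lra.
  have p0 : 0 < cmod w - M by lra.
  by rewrite lef_pV2 ?posrE//; exact: lt_le_trans h1.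
have [B hB] := bounded_disc (M + 1) entire.
have bh w : cmod (h w) <= `|B| + N * L.
  have NL : 0 <= N * L by exact: mulr_ge0 (ltW N0) L0.
  case: (leP (cmod w) (M + 1)) => wM.
    by apply: le_trans (hB w wM) _; have := ler_norm B; lra.
  apply: le_trans (far w _) _; first lra.
  apply: le_trans (_ : N * L <= _); last by have := normr_ge0 B; lra.
  by rewrite ler_wpM2r// ler_pdivrMr ?ler_peMr ?ltW//; lra.
have h00 w : h w = 0.
  apply/eqP; rewrite -cmod_eq0; apply/eqP/le_anti; rewrite cmod_ge0 andbT.
  apply: le_pinch => e e0; rewrite add0r.
  pose x : R := M + (N * L + 1) / e.
  have NL : 0 <= N * L by exact: mulr_ge0 (ltW N0) L0.
  have q0 : 0 < (N * L + 1) / e by rewrite divr_gt0//; lra.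
  have cx : cmod x%:C = x by rewrite cmodR ger0_norm// /x; lra.
  rewrite (liouville entire bh x%:C w); apply: le_lt_trans (far _ _) _.
    by rewrite cx /x; lra.
  have -> : cmod x%:C - M = (N * L + 1) / e by rewrite cx /x; ring.
  rewrite mulrAC ltr_pdivrMr// [e * _]mulrC divfK ?lt0r_neq0//; lra.
have gz : ~ curve_image g z by case: ez.
have zD := inD z ez.
have wz : winding g z = two_pi_i R.
  apply: (integral_unique rg) (windingP cg rg gz) _.
  by apply: integral_ext (po z ez) => t _; rewrite mul1r expr1.
have := h00 z; rewrite (hin z zD) (dixon_off hF zD gz) wz => /eqP; rewrite subr_eq0 => /eqP e.
by rewrite mulrC -e; exact: cauchy_transformP.
Qed.

(** Integration by parts: the derivative of F / (t - z) has integral 0. *)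
Theorem cauchy_formula1 F z : hol D F -> (forall w, encloses g w -> D w) ->
  positively_oriented g -> encloses g z ->
  hci (fun t => F t * ((t - z) ^+ 2)^-1) (two_pi_i R * dC F z).
Proof.
move=> hF inD po ez; have hF' := hol_dC oD hF.
have gz : ~ curve_image g z by case: ez.
have f0 := cauchy_formula hF' inD po ez.
pose G t := dC F t * ((t - z) ^+ 1)^-1 - F t * ((t - z) ^+ 2)^-1.
have hG : hci G (0 : R[i]).
  apply: (@derivative_integral R (D `&` ~` [set z]) (fun t => F t / (t - z))) => //.
  - by apply: openI => //; exact: open_compl1.
  - apply: hol_B; apply: hol_M; try (by apply: hol_sub (@hol_inv_sub R z _); exact: subIsetr).
      by apply: hol_sub hF'; exact: subIsetl.
    by apply: hol_sub hF; exact: subIsetl.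
  - move=> v [vD /eqP vz]; have vz0 : v - z != 0 by rewrite subr_eq0.
    have := @gder_div R R[i] (fun w => w) F (fun t => t - z) v _ _ vz0 (hol_cder hF vD)
      (gder_sub (cder_id v) (gder_cst (fun w : R[i] => w) z v)).
    by congr gder; rewrite /G; field.
  - by move=> t t01; split; [exact: gD|exact: off_curve].
have := integral_B f0 hG; rewrite subr0.
by apply: integral_ext => t _; rewrite /G; ring.
Qed.

(** As for [cauchy_formula1], with the derivative of F / (t - z)^2. *)
Theorem cauchy_formula2 F z : hol D F -> (forall w, encloses g w -> D w) ->
  positively_oriented g -> encloses g z ->
  hci (fun t => F t * ((t - z) ^+ 3)^-1) (two_pi_i R * (dC (dC F) z / 2)).
Proof.
move=> hF inD po ez; have hF' := hol_dC oD hF.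
have gz : ~ curve_image g z by case: ez.
have f1 := cauchy_formula1 hF' inD po ez.
pose G t := dC F t * ((t - z) ^+ 2)^-1 - 2 * (F t * ((t - z) ^+ 3)^-1).
have hG : hci G (0 : R[i]).
  apply: (@derivative_integral R (D `&` ~` [set z]) (fun t => F t / ((t - z) * (t - z)))) => //.
  - by apply: openI => //; exact: open_compl1.
  - apply: hol_B; last (apply: hol_M; first exact: hol_cst); apply: hol_M;
      try (by apply: hol_sub (@hol_inv_sub R z _); exact: subIsetr).
      by apply: hol_sub hF'; exact: subIsetl.
    by apply: hol_sub hF; exact: subIsetl.
  - move=> v [vD /eqP vz]; have vz0 : v - z != 0 by rewrite subr_eq0.
    have d1 : cder (fun t => t - z) v (1 - 0).
      by apply: gder_sub; [exact: cder_id|exact: gder_cst].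
    have := @gder_div R R[i] (fun w => w) F (fun t => (t - z) * (t - z)) v _ _
      (mulf_neq0 vz0 vz0) (hol_cder hF vD) (gderM d1 d1).
    by congr gder; rewrite /G; field.
  - by move=> t t01; split; [exact: gD|exact: off_curve].
have := integral_Z (1 / 2) (integral_B f1 hG); rewrite subr0.
have -> : 1 / 2 * (two_pi_i R * dC (dC F) z) = two_pi_i R * (dC (dC F) z / 2) by ring.
by apply: integral_ext => t _; rewrite /G subKr mulrA divfK ?mul1r ?pnatr_eq0.
Qed.

End Dixon.


(** * The algebra and the subspace *)

Section Algebra.
Variable R : realType.
Local Notation A := (A3 R[i]).
Implicit Types (u w z h : A) (E U : set A).

(** These neighbourhoods of [z] are easier to handle than the balls of the
    Euclidean norm, and define the same topology. *)
Definition cube z (r : R) : set A := [set w |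
  [/\ cmod (coord0 w - coord0 z) < r, cmod (coord1 w - coord1 z) < r
    & cmod (coord2 w - coord2 z) < r]].

Lemma coord_le_norm u : [/\ (cmod (coord0 u))%:C <= A3_norm u,
  (cmod (coord1 u))%:C <= A3_norm u & (cmod (coord2 u))%:C <= A3_norm u].
Proof.
have key (x y : R[i]) : 0 <= y -> 0 <= x -> x <= sqrtC (x ^+ 2 + y).
  move=> y0 x0; rewrite -(@ler_pXn2r _ 2) ?nnegrE ?sqrtC_ge0 ?addr_ge0 ?exprn_ge0//.
  by rewrite sqrtCK lerDl.
have p (x : R[i]) : 0 <= `|x| ^+ 2 by rewrite exprn_ge0.
rewrite /A3_norm -!cmodE; split.
- by rewrite -addrA; apply: key; rewrite ?addr_ge0.
- by rewrite [X in X + _]addrC -addrA; apply: key; rewrite ?addr_ge0.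
- by rewrite addrC; apply: key; rewrite ?addr_ge0.
Qed.

Lemma nbhs_cube z U : nbhs z U <-> exists2 r : R, 0 < r & cube z r `<=` U.
Proof.
split=> [/nbhs_normP[[r i]] /=|[r r0 h]].
  rewrite ltcE /= => /andP[/eqP -> r0] h; exists (r / 3); first lra.
  move=> w [h0 h1 h2]; apply: h => /=; rewrite distrC.
  change (A3_norm (w - z) < r%:C); apply: le_lt_trans (A3_norm_le _) _.
  rewrite !cmodE -!rmorphD /= ltcR; move: h0 h1 h2 => /=; lra.
apply: (iffRL (@nbhs_normP R[i] A z U)); exists r%:C; first by rewrite /= ltcR.
move=> w /=; rewrite distrC => hw; apply: h.
have {}hw : A3_norm (w - z) < r%:C by [].
have [h0 h1 h2] := coord_le_norm (w - z).
by split; rewrite -ltcR; apply: le_lt_trans hw.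
Qed.

Lemma cube_scale z h (t : R) r : 0 < r ->
  `|t| * (cmod (coord0 h) + cmod (coord1 h) + cmod (coord2 h)) < r ->
  cube z r (z + t%:C *: h).
Proof.
move=> r0 ht; have t0 := normr_ge0 t.
have [h0 h1 h2] : [/\ 0 <= cmod (coord0 h), 0 <= cmod (coord1 h) & 0 <= cmod (coord2 h)].
  by split; exact: cmod_ge0.
have p0 := mulr_ge0 t0 h0; have p1 := mulr_ge0 t0 h1; have p2 := mulr_ge0 t0 h2.
by rewrite /cube /=; split; rewrite addrC addKr cmodM cmodR; lra.
Qed.

Lemma cube_small h r : 0 < r -> exists2 d, 0 < d &
  forall z (t : R), `|t| < d -> cube z r (z + t%:C *: h).
Proof.
move=> r0; set S := cmod (coord0 h) + cmod (coord1 h) + cmod (coord2 h).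
have S0 : 0 < S + 1.
  by rewrite /S; have := cmod_ge0 (coord0 h); have := cmod_ge0 (coord1 h);
     have := cmod_ge0 (coord2 h); lra.
exists (r / (S + 1)); first by rewrite divr_gt0.
move=> z t; rewrite ltr_pdivlMr// => ht; apply: cube_scale => //; rewrite -/S.
by have := normr_ge0 t; lra.
Qed.

Lemma cube_trans z w u r s : cube z r w -> cube w s u -> cube z (r + s) u.
Proof.
move=> [a0 a1 a2] [b0 b1 b2]; split.
- by have := cmod_dist (coord0 u) (coord0 w) (coord0 z); lra.
- by have := cmod_dist (coord1 u) (coord1 w) (coord1 z); lra.
- by have := cmod_dist (coord2 u) (coord2 w) (coord2 z); lra.
Qed.

Section Subspace.
Variables (E : set A) (a b c : A).
Hypothesis hE : real_subspace 3 E.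
Hypotheses (Ea : E a) (Eb : E b) (Ec : E c) (c0 : c <> 0).
Hypotheses (fa : ff a = 1) (fb : ff b = 'i) (fc : ff c = 0).

Lemma subspace_D u w : E u -> E w -> E (u + w).
Proof.
case: hE => e [_ ->] [x _ <-] [y _ <-]; exists (fun i => x i + y i) => //.
by rewrite -big_split /=; apply: eq_bigr => i _; rewrite rmorphD scalerDl.
Qed.

Lemma subspace_Z (t : R) u : E u -> E (t%:C *: u).
Proof.
case: hE => e [_ ->] [x _ <-]; exists (fun i => t * x i) => //.
by rewrite scaler_sumr; apply: eq_bigr => i _; rewrite scalerA rmorphM.
Qed.

Lemma subspace_B u w : E u -> E w -> E (u - w).
Proof.
move=> hu hw; have := subspace_D hu (subspace_Z (-1) hw).
by rewrite rmorphN rmorph1 scaleN1r.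
Qed.

Definition point (x y s : R) : A := x%:C *: a + y%:C *: b + s%:C *: c.

Lemma ff_point x y s : ff (point x y s) = (x +i* y)%C.
Proof.
rewrite /ff /=; move: fa fb fc; rewrite /ff => -> -> ->.
by apply/eqP; rewrite eq_complex /=; apply/andP; split; apply/eqP; ring.
Qed.

Lemma point_eq0 x y s : point x y s = 0 -> [/\ x = 0, y = 0 & s = 0].
Proof.
move=> e; have := ff_point x y s; rewrite e /ff /= => -[x0 y0].
split; rewrite -?x0 -?y0//.
move: e; rewrite /point -x0 -y0 rmorph0 !scale0r !add0r => e.
apply/eqP; apply: contrapT => /negP s0; apply: c0.
have : (s^-1)%:C *: (s%:C *: c) = 0 by rewrite e scaler0.
by rewrite scalerA -rmorphM /= mulVf// scale1r.
Qed.

(** The coordinates of [a], [b], [c] in the given basis of [E] form an invertible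
    matrix, since these vectors are independent: [ff] separates [a] from [b] and
    vanishes on [c]. *)
Lemma subspace_spanned u : E u -> exists x y s, u = point x y s.
Proof.
case: hE => e [ind EE].
pose lin (v : 'rV[R]_3) := \sum_i (v 0 i)%:C *: e i.
have linD v v' : lin (v + v') = lin v + lin v'.
  by rewrite /lin -big_split /=; apply: eq_bigr => i _; rewrite mxE rmorphD scalerDl.
have linZ (t : R) v : lin (t *: v) = t%:C *: lin v.
  by rewrite /lin scaler_sumr; apply: eq_bigr => i _; rewrite mxE rmorphM scalerA.
have lin_ex w : E w -> exists v, lin v = w.
  rewrite EE => -[x _ <-]; exists (\row_i x i).
  by apply: eq_bigr => i _; rewrite mxE.
have [va hva] := lin_ex _ Ea; have [vb hvb] := lin_ex _ Eb.
have [vc hvc] := lin_ex _ Ec.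
pose M : 'M[R]_3 := \matrix_(i, k) (nth 0 [:: va; vb; vc] i) 0 k.
have linM (v : 'rV[R]_3) : lin (v *m M) = point (v 0 0) (v 0 1) (v 0 (1 + 1)).
  have -> : v *m M = v 0 0 *: va + v 0 1 *: vb + v 0 (1 + 1) *: vc.
    apply/rowP => k; rewrite !mxE big_ord_recl big_ord_recl big_ord_recl big_ord0 addr0.
    rewrite !mxE /= addrA; congr (_ * _ + _ * _ + _ * _); congr (v 0 _); exact/val_inj.
  by rewrite !linD !linZ hva hvb hvc.
have Mf : row_free M.
  apply: inj_row_free => v vM.
  have : point (v 0 0) (v 0 1) (v 0 (1 + 1)) = 0.
    by rewrite -linM vM /lin big1// => i _; rewrite mxE rmorph0 scale0r.
  move/point_eq0 => [v0 v1 v2]; apply/rowP => i; rewrite mxE.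
  case: i => -[|[|[|//]]] hi.
  - by rewrite -[RHS]v0; congr (v 0 _); exact/val_inj.
  - by rewrite -[RHS]v1; congr (v 0 _); exact/val_inj.
  - by rewrite -[RHS]v2; congr (v 0 _); exact/val_inj.
rewrite -/(E u) => /lin_ex[v <-].
have Mu : M \in unitmx by rewrite -row_free_unit.
exists ((v *m invmx M) 0 0), ((v *m invmx M) 0 1), ((v *m invmx M) 0 (1 + 1)).
by rewrite -linM mulmxKV.
Qed.

Lemma kernel_line u : E u -> ff u = 0 -> exists s : R, u = s%:C *: c.
Proof.
move=> /subspace_spanned[x [y [s ->]]]; rewrite ff_point => -[-> ->].
by exists s; rewrite /point rmorph0 !scale0r !add0r.
Qed.

End Subspace.
End Algebra.

(** * Monogenic functions *)

Section Descent.
Variable R : realType.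
Local Notation A := (A3 R[i]).
Implicit Types (u w z h : A) (psi : A -> R[i]).
Variables (E : set A) (a b c : A) (Omega : set A).
Hypothesis hE : real_subspace 3 E.
Hypotheses (Ea : E a) (Eb : E b) (Ec : E c) (c0 : c <> 0).
Hypotheses (fa : ff a = 1) (fb : ff b = 'i) (fc : ff c = 0).
Hypothesis hOmega : domain_in E Omega.
Hypothesis hlines : forall z, E z -> connected (Omega `&` fiber_line E z).

Definition dirder psi z h (v : R[i]) := rder (fun s => psi (z + s%:C *: h)) 0 v.

Lemma dirder_at psi z h (t : R) v : dirder psi (z + t%:C *: h) h v ->
  rder (fun s => psi (z + s%:C *: h)) t v.
Proof.
move=> hd e /hd[d d0 k]; exists d => // s sd.
have := k (s - t); rewrite rmorph0 subr0 rmorphB /= => /(_ sd).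
rewrite scale0r addr0 -[z + _ + _]addrA -scalerDl.
by have -> : t%:C + (s%:C - t%:C) = s%:C :> R[i] by ring.
Qed.

Lemma domain_sub z : Omega z -> E z.
Proof. by case: hOmega => _ _ [U _ ->] []. Qed.

Lemma domain_cube z : Omega z -> exists2 r : R, 0 < r &
  forall w, E w -> cube z r w -> Omega w.
Proof.
case: hOmega => _ _ [U oU ->] [Ez Uz].
have /nbhs_cube[r r0 hr] := open_nbhs_nbhs (conj oU Uz).
by exists r => // w Ew /hr.
Qed.

Lemma domain_line z h : E h -> Omega z -> exists2 d : R, 0 < d &
  forall t : R, `|t| < d -> Omega (z + t%:C *: h).
Proof.
move=> Eh Oz; have [r r0 hr] := domain_cube Oz.
have [d d0 hd] := cube_small h r0; exists d => // t td; apply: hr; last exact: hd.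
by apply: (subspace_D hE); [exact: domain_sub|exact: (subspace_Z hE)].
Qed.

(** On the fibre through a point the function is locally constant along [c], and
    the fibre is connected. *)
Lemma fiber_constant psi : (forall z, Omega z -> dirder psi z c 0) ->
  forall z z', Omega z -> Omega z' -> ff z = ff z' -> psi z' = psi z.
Proof.
move=> hpsi z z' Oz Oz' fz.
have Ez := domain_sub Oz; have Ez' := domain_sub Oz'.
have E0 : E 0 by have := subspace_B hE Ez Ez; rewrite subrr.
apply: (connected_constant (hlines Ez)); first last.
- split=> //; exists (z' - z); last by rewrite addrC subrK.
  split; first exact: (subspace_B hE).
  by move: fz; rewrite /ff /= => ->; rewrite subrr.
- by split=> //; exists 0; [split=> //|rewrite addr0].
move=> y [Oy [u [Eu fu] yE]].
have [r r0 hr] := domain_cube Oy.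
apply/nbhs_cube; exists r => // y' y'r [Oy' [u' [Eu' fu'] y'E]].
have Ey := domain_sub Oy.
have [s hs] : exists s : R, y' - y = s%:C *: c.
  apply: (kernel_line hE Ea Eb Ec c0 fa fb fc).
    by apply: (subspace_B hE) => //; exact: domain_sub.
  by rewrite -yE -y'E /ff /=; move: fu fu'; rewrite /ff => -> ->; rewrite addr0 subrr.
have y'E' : y' = y + s%:C *: c by rewrite -hs addrC subrK.
have seg t : `|t| <= `|s| -> Omega (y + t%:C *: c).
  move=> ts; apply: hr; first by apply: (subspace_D hE) => //; exact: (subspace_Z hE).
  move: y'r; rewrite y'E' /cube /= !(addrC (coord0 y)) !(addrC (coord1 y)) !(addrC (coord2 y)) !addrK.
  by rewrite !cmodM !cmodR => -[k0 k1 k2]; split;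
    apply: le_lt_trans (ler_wpM2r (cmod_ge0 _) ts) _.
apply/eqP; rewrite -subr_eq0 -cmod_eq0; apply/eqP/le_anti; rewrite cmod_ge0 andbT.
have := @curve_mean_value2 R (fun t => psi (y + t%:C *: c)) (fun _ => 0) 0 s 0.
rewrite mul0r rmorph0 scale0r addr0 -y'E'; apply; last by move=> *; rewrite cmod0.
move=> t ht; apply: dirder_at; apply: hpsi; apply: seg.
move: ht; case: (leP 0 s) => s0 /andP[t1 t2]; last by rewrite !ler0_norm//; lra.
by rewrite !ger0_norm//; lra.
Qed.

Definition locally_bounded psi := forall z, Omega z -> exists r M, 0 < r /\
  forall w, Omega w -> cube z r w -> cmod (psi w) <= M.

Local Notation D := (@ff R[i] @` Omega).

Lemma chart z r : Omega z -> 0 < r -> exists2 d : R, 0 < d &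
  forall x y : R, `|x| < d -> `|y| < d -> let w := z + x%:C *: a + y%:C *: b in
  [/\ Omega w, cube z r w & ff w = ff z + (x +i* y)%C].
Proof.
move=> Oz k0; have [r' r'0 hr] := domain_cube Oz.
pose q := Num.min r r'; have q0 : 0 < q by rewrite lt_min k0.
have q2 : 0 < q / 2 by lra.
have [d1 d10 h1] := cube_small a q2; have [d2 d20 h2] := cube_small b q2.
exists (Num.min d1 d2); first by rewrite lt_min d10.
move=> x y; rewrite !lt_min => /andP[x1 _] /andP[_ y2] w.
have wq : cube z q w.
  have -> : q = q / 2 + q / 2 by field.
  exact: cube_trans (h1 _ _ x1) (h2 _ _ y2).
have [qr qr'] : q <= r /\ q <= r' by rewrite !ge_min !lexx orbT.
split.
- apply: hr.
    by apply: (subspace_D hE); [apply: (subspace_D hE)|];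
      [exact: domain_sub|exact: (subspace_Z hE)|exact: (subspace_Z hE)].
  by case: wq => ? ? ?; split; exact: lt_le_trans qr'.
- by case: wq => ? ? ?; split; exact: lt_le_trans qr.
rewrite /w /ff /=; move: fa fb; rewrite /ff => -> ->; rewrite -addrA; congr (_ + _).
by apply/eqP; rewrite eq_complex /=; apply/andP; split; apply/eqP; ring.
Qed.

Lemma open_projection : open D.
Proof.
apply/open_cmod => _ [z Oz <-]; have [d d0 hd] := chart Oz ltr01.
exists d => // w wz.
have [|| Ow _ fw] := hd (complex.Re (w - ff z)) (complex.Im (w - ff z)).
- exact: le_lt_trans (cmod_Re _) wz.
- exact: le_lt_trans (cmod_Im _) wz.
by eexists; first exact: Ow; rewrite fw -complexRI addrC subrK.
Qed.

Lemma dirder_shift psi z h (x : R) v : dirder psi z h v ->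
  rder (fun t => psi (z + (t - x)%:C *: h)) x v.
Proof.
move=> hd e /hd[d d0 k]; exists d => // t td.
by have := k (t - x); rewrite rmorph0 subr0 subrr rmorph0 rmorphB /=; apply.
Qed.

(** By [fiber_constant] the function factors through [ff].  The derivatives along
    [a] and [b] become the partial derivatives on the projection, and they
    satisfy the Cauchy-Riemann equations. *)
Theorem descent psi : locally_bounded psi ->
  (forall z, Omega z -> exists L,
     [/\ dirder psi z a L, dirder psi z b ('i * L) & dirder psi z c 0]) ->
  exists2 F, hol D F & forall z, Omega z -> psi z = F (ff z).
Proof.
move=> bpsi hpsi.
have cpsi z : Omega z -> dirder psi z c 0 by move=> /hpsi[L []].
have /choice[s hs] : forall w : R[i], exists z, D w -> Omega z /\ ff z = w.
  move=> w; case: (pselect (D w)) => [[z Oz <-]|]; first by exists z.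
  by exists 0.
pose F (w : R[i]) := psi (s w).
have FE z : Omega z -> psi z = F (ff z).
  move=> Oz; have [|Os fs] := hs (ff z); first by exists z.
  exact: (fiber_constant cpsi Os Oz fs).
exists F => //; apply: tolstov open_projection _ _.
- move=> _ [z Oz <-]; have [r [M [r0 hM]]] := bpsi z Oz.
  have [d d0 hd] := chart Oz r0; exists d, M; split=> // w wz.
  have [|| Ow cw fw] := hd (complex.Re (w - ff z)) (complex.Im (w - ff z)).
  + exact: le_lt_trans (cmod_Re _) wz.
  + exact: le_lt_trans (cmod_Im _) wz.
  have e : w = ff z + (complex.Re (w - ff z) +i* complex.Im (w - ff z))%C.
    by rewrite -complexRI addrC subrK.
  by rewrite e -fw -FE//; exact: hM.
move=> x y [z Oz fz]; have [L [La Lb _]] := hpsi z Oz; exists L; split.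
  have [d d0 hd] := domain_line Ea Oz.
  apply: gder_ext d0 _ (dirder_shift x La) => t; rewrite -rmorphB cmodR => td.
  rewrite FE; last exact: hd.
  rewrite /ff /=; move: fa fz; rewrite /ff => -> ->; congr F.
  by apply/eqP; rewrite eq_complex /=; apply/andP; split; apply/eqP; ring.
have [d d0 hd] := domain_line Eb Oz.
apply: gder_ext d0 _ (dirder_shift y Lb) => t; rewrite -rmorphB cmodR => td.
rewrite FE; last exact: hd.
rewrite /ff /=; move: fb fz; rewrite /ff => -> ->; congr F.
by apply/eqP; rewrite eq_complex /=; apply/andP; split; apply/eqP; ring.
Qed.

Lemma dirder_unique psi z h (v w : R[i]) : dirder psi z h v -> dirder psi z h w -> v = w.
Proof. exact: rder_unique. Qed.

Lemma dirder_ext psi chi z h v : E h -> Omega z ->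
  (forall w, Omega w -> psi w = chi w) -> dirder psi z h v -> dirder chi z h v.
Proof.
move=> Eh Oz e; have [d d0 hd] := domain_line Eh Oz.
apply: gder_ext d0 _ => t; rewrite rmorph0 subr0 cmodR => /hd; exact: e.
Qed.

Lemma dirderM psi chi z h (v w : R[i]) : dirder psi z h v -> dirder chi z h w ->
  dirder (fun z => psi z * chi z) z h (v * chi z + psi z * w).
Proof.
by move=> h1 h2; have := gderM h1 h2; rewrite rmorph0 scale0r addr0.
Qed.

Lemma dirder_comp F z h : hol D F -> Omega z ->
  dirder (fun w => F (ff w)) z h (dC F (ff z) * coord0 h).
Proof.
move=> hF Oz; have fz : D (ff z) by exists z.
have hF' := hol_cder hF fz.
apply: (@gder_comp R R (fun s => s%:C) F (fun s => ff (z + s%:C *: h)) 0 _ (coord0 h)).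
  by rewrite rmorph0 scale0r addr0.
exact: rder_const_dir.
Qed.

Lemma dirder_coord1 z h : dirder (fun w => coord1 w) z h (coord1 h).
Proof. exact: rder_const_dir. Qed.

Lemma dirder_coord2 z h : dirder (fun w => coord2 w) z h (coord2 h).
Proof. exact: rder_const_dir. Qed.

(** Coordinates of the principal extension of [F], whose first coordinate is
    [F (ff z)]: the Taylor polynomial of [F] at [ff z], evaluated at [z]. *)
Definition ext1 F z : R[i] := dC F (ff z) * coord1 z.
Definition ext2 F z : R[i] :=
  dC F (ff z) * coord2 z + dC (dC F) (ff z) / 2 * (coord1 z * coord1 z).

(** This derivative and the next are the coordinates of [h] times the principal
    extension of the derivative of [F]. *)
Lemma dirder_ext1 F z h : hol D F -> Omega z ->
  dirder (ext1 F) z h (coord0 h * ext1 (dC F) z + coord1 h * dC F (ff z)).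
Proof.
move=> hF Oz; have hF' := hol_dC open_projection hF.
have := dirderM (dirder_comp h hF' Oz) (dirder_coord1 z h).
by congr dirder; rewrite /ext1; ring.
Qed.

Lemma dirder_ext2 F z h : hol D F -> Omega z ->
  dirder (ext2 F) z h
   (coord0 h * ext2 (dC F) z + coord1 h * ext1 (dC F) z + coord2 h * dC F (ff z)).
Proof.
move=> hF Oz; have hF' := hol_dC open_projection hF.
have hF2 := hol_dC open_projection hF'.
have hF3 : hol D (fun w : R[i] => dC (dC F) w / 2) by apply: hol_M => //; exact: hol_cst.
have e3 : dC (fun w : R[i] => dC (dC F) w / 2) (ff z) = dC (dC (dC F)) (ff z) / 2.
  have fz : D (ff z) by exists z.
  apply: dCE; have := gderM (hol_cder hF2 fz) (gder_cst (fun w : R[i] => w) (2^-1) (ff z)).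
  by rewrite mulr0 addr0.
have := gderD (dirderM (dirder_comp h hF' Oz) (dirder_coord2 z h))
  (dirderM (dirder_comp h hF3 Oz) (dirderM (dirder_coord1 z h) (dirder_coord1 z h))).
rewrite e3.
by congr gder; rewrite /ext1 /ext2; field.
Qed.

Lemma locally_bounded_comp F : hol D F -> locally_bounded (fun z => F (ff z)).
Proof.
move=> hF z Oz; have fz : D (ff z) by exists z.
have [r [M [r0 _ _ hM]]] := hol_bounded open_projection hF fz.
by exists r, M; split=> // w _ [wz _ _]; exact: hM.
Qed.

Lemma locally_bounded_coord1 : locally_bounded (@coord1 R[i]).
Proof.
move=> z _; exists 1, (cmod (coord1 z) + 1); split=> // w _ [_ wz _].
by have := cmod_dist (coord1 w) (coord1 z) 0; rewrite !subr0; lra.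
Qed.

Lemma locally_bounded_coord2 : locally_bounded (@coord2 R[i]).
Proof.
move=> z _; exists 1, (cmod (coord2 z) + 1); split=> // w _ [_ _ wz].
by have := cmod_dist (coord2 w) (coord2 z) 0; rewrite !subr0; lra.
Qed.

Lemma cube_min z w r s : cube z (Num.min r s) w -> cube z r w /\ cube z s w.
Proof.
by rewrite /cube /= !lt_min => -[/andP[? ?] /andP[? ?] /andP[? ?]].
Qed.

Lemma locally_bounded_op (op : R[i] -> R[i] -> R[i]) (bd : R -> R -> R) psi chi :
  (forall x y (M N : R), cmod x <= M -> cmod y <= N -> cmod (op x y) <= bd M N) ->
  locally_bounded psi -> locally_bounded chi ->
  locally_bounded (fun z => op (psi z) (chi z)).
Proof.
move=> hop h1 h2 z Oz.
have [r [M [r0 hM]]] := h1 z Oz; have [s [N [s0 hN]]] := h2 z Oz.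
exists (Num.min r s), (bd M N); split; first by rewrite lt_min r0.
by move=> w Ow /cube_min[w1 w2]; apply: hop; [exact: hM|exact: hN].
Qed.

Lemma locally_boundedM psi chi : locally_bounded psi -> locally_bounded chi ->
  locally_bounded (fun z => psi z * chi z).
Proof.
apply: (@locally_bounded_op *%R *%R) => x y M N xM yN.
by rewrite cmodM ler_pM ?cmod_ge0.
Qed.

Lemma locally_boundedD psi chi : locally_bounded psi -> locally_bounded chi ->
  locally_bounded (fun z => psi z + chi z).
Proof.
apply: (@locally_bounded_op +%R +%R) => x y M N xM yN.
by apply: le_trans (cmodD _ _) _; exact: lerD.
Qed.

Lemma locally_boundedB psi chi : locally_bounded psi -> locally_bounded chi ->
  locally_bounded (fun z => psi z - chi z).
Proof.
apply: (@locally_bounded_op (fun x y => x - y) +%R) => x y M N xM yN.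
by apply: le_trans (cmodBD _ _) _; exact: lerD.
Qed.

Lemma locally_bounded_ext1 F : hol D F -> locally_bounded (ext1 F).
Proof.
move=> hF; apply: locally_boundedM; last exact: locally_bounded_coord1.
by apply: locally_bounded_comp; exact: hol_dC open_projection hF.
Qed.

Lemma locally_bounded_ext2 F : hol D F -> locally_bounded (ext2 F).
Proof.
move=> hF; have hF' := hol_dC open_projection hF.
have hF2 := hol_dC open_projection hF'.
apply: locally_boundedD; apply: locally_boundedM.
- exact: locally_bounded_comp.
- exact: locally_bounded_coord2.
- apply: (@locally_bounded_comp (fun w : R[i] => dC (dC F) w / 2)).
  by apply: hol_M => //; exact: hol_cst.
by apply: locally_boundedM; exact: locally_bounded_coord1.
Qed.

(** The derivative [d] of [Phi] is determined coordinate by coordinate together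
    with the functions: once a coordinate of [Phi] is known, its derivative along
    [a] gives the corresponding coordinate of [d], and the part of the next
    derivative that involves the coordinates of [h] other than the first one is
    that of the principal extensions already found. *)
Theorem monogenic_structure (Phi : A -> A) :
  locally_bounded (fun z => coord0 (Phi z)) ->
  locally_bounded (fun z => coord1 (Phi z)) ->
  locally_bounded (fun z => coord2 (Phi z)) ->
  (forall z, Omega z -> exists d : A, forall h, [\/ h = a, h = b | h = c] ->
     [/\ dirder (fun z => coord0 (Phi z)) z h (coord0 (h * d)),
         dirder (fun z => coord1 (Phi z)) z h (coord1 (h * d))
       & dirder (fun z => coord2 (Phi z)) z h (coord2 (h * d))]) ->
  exists F0 F1 F2, [/\ hol D F0, hol D F1, hol D F2 & forall z, Omega z ->
    [/\ coord0 (Phi z) = F0 (ff z),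
        coord1 (Phi z) = ext1 F0 z + F1 (ff z)
      & coord2 (Phi z) = ext2 F0 z + ext1 F1 z + F2 (ff z)]].
Proof.
move=> b0 b1 b2 hPhi.
have a0E : coord0 a = 1 := fa; have b0E : coord0 b = 'i := fb.
have c0E : coord0 c = 0 := fc.
have m0 h d : coord0 (h * d) = coord0 h * coord0 d by [].
have m1 h d : coord1 (h * d) = coord0 h * coord1 d + coord1 h * coord0 d by [].
have m2 h d : coord2 (h * d) =
  coord0 h * coord2 d + coord1 h * coord1 d + coord2 h * coord0 d by [].
have [|F0 hF0 E0] := descent b0.
  move=> z /hPhi[d hd]; exists (coord0 d).
  have [ha _ _] := hd a (Or31 _ _ erefl); have [hb _ _] := hd b (Or32 _ _ erefl).
  have [hc _ _] := hd c (Or33 _ _ erefl).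
  split.
  + by have := ha; rewrite m0 a0E mul1r.
  + by have := hb; rewrite m0 b0E.
  + by have := hc; rewrite m0 c0E mul0r.
have hF0' := hol_dC open_projection hF0.
have d0E z d : Omega z ->
    dirder (fun z => coord0 (Phi z)) z a (coord0 (a * d)) -> coord0 d = dC F0 (ff z).
  move=> Oz h; have h' := dirder_ext Ea Oz E0 h.
  have := dirder_unique h' (dirder_comp a hF0 Oz).
  by rewrite m0 a0E mul1r mulr1.
pose psi1 z := coord1 (Phi z) - ext1 F0 z.
have dpsi1 z d h : Omega z -> coord0 d = dC F0 (ff z) ->
    dirder (fun z => coord1 (Phi z)) z h (coord1 (h * d)) ->
    dirder psi1 z h (coord0 h * (coord1 d - ext1 (dC F0) z)).
  move=> Oz ed hd; have := gder_sub hd (dirder_ext1 h hF0 Oz).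
  by congr gder; rewrite m1 ed; ring.
have [||F1 hF1 E1] := @descent psi1.
- by apply: locally_boundedB => //; exact: locally_bounded_ext1.
- move=> z Oz; have [d hd] := hPhi z Oz.
  have [ha0 ha _] := hd a (Or31 _ _ erefl); have [_ hb _] := hd b (Or32 _ _ erefl).
  have [_ hc _] := hd c (Or33 _ _ erefl).
  have ed := d0E z d Oz ha0.
  exists (coord1 d - ext1 (dC F0) z); split.
  + by have := dpsi1 z d a Oz ed ha; rewrite a0E mul1r.
  + by have := dpsi1 z d b Oz ed hb; rewrite b0E.
  + by have := dpsi1 z d c Oz ed hc; rewrite c0E mul0r.
have d1E z d : Omega z -> coord0 d = dC F0 (ff z) ->
    dirder (fun z => coord1 (Phi z)) z a (coord1 (a * d)) ->
    coord1 d = ext1 (dC F0) z + dC F1 (ff z).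
  move=> Oz ed hd; have h' := dirder_ext Ea Oz E1 (dpsi1 z d a Oz ed hd).
  have := dirder_unique h' (dirder_comp a hF1 Oz).
  by rewrite a0E mul1r mulr1 => <-; ring.
pose psi2 z := coord2 (Phi z) - ext2 F0 z - ext1 F1 z.
have dpsi2 z d h : Omega z -> coord0 d = dC F0 (ff z) ->
    coord1 d = ext1 (dC F0) z + dC F1 (ff z) ->
    dirder (fun z => coord2 (Phi z)) z h (coord2 (h * d)) ->
    dirder psi2 z h (coord0 h * (coord2 d - ext2 (dC F0) z - ext1 (dC F1) z)).
  move=> Oz ed ed1 hd.
  have := gder_sub (gder_sub hd (dirder_ext2 h hF0 Oz)) (dirder_ext1 h hF1 Oz).
  by congr gder; rewrite m2 ed ed1; ring.
have [||F2 hF2 E2] := @descent psi2.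
- apply: locally_boundedB; last exact: locally_bounded_ext1.
  by apply: locally_boundedB => //; exact: locally_bounded_ext2.
- move=> z Oz; have [d hd] := hPhi z Oz.
  have [ha0 ha1 ha] := hd a (Or31 _ _ erefl); have [_ _ hb] := hd b (Or32 _ _ erefl).
  have [_ _ hc] := hd c (Or33 _ _ erefl).
  have ed := d0E z d Oz ha0; have ed1 := d1E z d Oz ed ha1.
  exists (coord2 d - ext2 (dC F0) z - ext1 (dC F1) z); split.
  + by have := dpsi2 z d a Oz ed ed1 ha; rewrite a0E mul1r.
  + by have := dpsi2 z d b Oz ed ed1 hb; rewrite b0E.
  + by have := dpsi2 z d c Oz ed ed1 hc; rewrite c0E mul0r.
exists F0, F1, F2; split=> // z Oz; split; first exact: E0.
  by rewrite -(E1 z Oz) /psi1; ring.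
by rewrite -(E2 z Oz) /psi2; ring.
Qed.

End Descent.

Section Hypotheses.
Variable R : realType.
Local Notation A := (A3 R[i]).
Implicit Types (u z h : A) (Omega : set A) (Phi : A -> A).

Lemma one_sided_limit Phi z h (L : A) :
  (delta^-1)%:C *: (Phi (z + delta%:C *: h) - Phi z)
    @[delta --> (0 : R)^'+] --> L ->
  forall e : R, 0 < e -> exists2 d : R, 0 < d & forall t : R, 0 < t -> t < d ->
    cube L e ((t^-1)%:C *: (Phi (z + t%:C *: h) - Phi z)).
Proof.
move=> hL e e0; have nL : nbhs L (cube L e) by apply/nbhs_cube; exists e.
have := hL _ nL => -[d /= d0 hd]; exists d => // t t0 td.
by apply: hd => //; rewrite /ball_ /= sub0r normrN gtr0_norm.
Qed.

(** The limits along [h] and along [- h] are those of a two-sided difference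
    quotient. *)
Lemma limits_dirder (kappa : A -> R[i]) Phi z h (L : A) :
  (forall k u, kappa (k *: u) = k * kappa u) ->
  (forall u v, kappa (u - v) = kappa u - kappa v) ->
  (forall e u, cube L e u -> cmod (kappa u - kappa L) < e) ->
  (forall e u, cube (- L) e u -> cmod (kappa u - kappa (- L)) < e) ->
  (delta^-1)%:C *: (Phi (z + delta%:C *: h) - Phi z) @[delta --> (0 : R)^'+] --> L ->
  (delta^-1)%:C *: (Phi (z + delta%:C *: - h) - Phi z) @[delta --> (0 : R)^'+] --> - L ->
  dirder (fun z => kappa (Phi z)) z h (kappa L).
Proof.
move=> kZ kB k1 k2 h1 h2 e e0.
have [d1 d10 b1] := one_sided_limit h1 e0; have [d2 d20 b2] := one_sided_limit h2 e0.
have kN : kappa (- L) = - kappa L.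
  have k0 : kappa 0 = 0 by have := kZ 0 0; rewrite scale0r mul0r.
  by rewrite -[- L]sub0r kB k0 sub0r.
exists (Num.min d1 d2); first by rewrite lt_min d10.
move=> t; rewrite rmorph0 subr0 cmodR scale0r addr0 lt_min => /andP[t1 t2].
case: (ltgtP t 0) => [tn|tp|->]; last first.
- by rewrite rmorph0 scale0r addr0 subrr mulr0 subrr cmod0 normr0 mulr0.
- rewrite gtr0_norm// in t1; rewrite gtr0_norm//; have := k1 _ _ (b1 t tp t1); rewrite kZ kB => /ltW hle.
  have t0 : t%:C != 0 by rewrite -cmod_gt0 cmodR normr_gt0 lt0r_neq0.
  have -> : kappa (Phi (z + t%:C *: h)) - kappa (Phi z) - kappa L * t%:C =
    ((t^-1)%:C * (kappa (Phi (z + t%:C *: h)) - kappa (Phi z)) - kappa L) * t%:C.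
    by rewrite fmorphV; field.
  by rewrite cmodM cmodR gtr0_norm// ler_pM2r.
have s0 : 0 < - t by rewrite oppr_gt0.
rewrite ltr0_norm// in t2; rewrite ltr0_norm//; have := k2 _ _ (b2 (- t) s0 t2).
rewrite kZ kB kN scalerN rmorphN scaleNr opprK => /ltW hle.
have t0 : t%:C != 0 by rewrite -cmod_gt0 cmodR normr_gt0 lt_eqF.
have -> : kappa (Phi (z + t%:C *: h)) - kappa (Phi z) - kappa L * t%:C =
  (((- t)^-1)%:C * (kappa (Phi (z + t%:C *: h)) - kappa (Phi z)) - - kappa L) * - t%:C.
  by rewrite fmorphV rmorphN; field.
by rewrite cmodM cmodN cmodR ltr0_norm// ler_pM2r.
Qed.

Lemma bounded_coords Omega Phi : [locally [bounded Phi z | z in Omega]] ->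
  forall z, Omega z -> exists r M : R, 0 < r /\ forall w, Omega w -> cube z r w ->
    [/\ cmod (coord0 (Phi w)) <= M, cmod (coord1 (Phi w)) <= M & cmod (coord2 (Phi w)) <= M].
Proof.
move=> hb z Oz; have [N [Nr hN]] := hb z Oz.
have N1 : N < N + 1 by rewrite ltrDl ltr01.
have := hN _ N1; rewrite /within /= => /nbhs_cube[r r0 hr].
exists r, (complex.Re (N + 1)); split=> // w Ow wz.
have bw : A3_norm (Phi w) <= N + 1 by exact: hr w wz Ow.
have le_Re (x : R) : x%:C <= N + 1 -> x <= complex.Re (N + 1).
  by rewrite [N + 1]complexRI lecE /= => /andP[].
have [h0 h1 h2] := coord_le_norm (Phi w).
by split; apply: le_Re; apply: le_trans bw.
Qed.

Lemma two_pi_i_neq0 : two_pi_i R != 0.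
Proof.
rewrite -cmod_gt0 /two_pi_i cmodM cmodi mulr1 cmodR normr_gt0 mulf_neq0 ?pnatr_eq0//.
by rewrite lt0r_neq0// pi_gt0.
Qed.

Lemma hol_analytic (D : set R[i]) F : hol D F -> analytic_on D F.
Proof. by move=> h z /h; exact: (cderP F z).2. Qed.

(** Geometric expansion of the inverse in the nilpotent part of [t - z]. *)
Lemma kernel_coords (t : R[i]) z : t != coord0 z ->
  (t%:A - z)^-1 = MkA3 ((t - coord0 z) ^+ 1)^-1
    (coord1 z * ((t - coord0 z) ^+ 2)^-1)
    (coord2 z * ((t - coord0 z) ^+ 2)^-1 + coord1 z ^+ 2 * ((t - coord0 z) ^+ 3)^-1).
Proof.
move=> tz; have t0 : t - coord0 z != 0 by rewrite subr_eq0.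
have -> : t%:A - z = MkA3 (t - coord0 z) (- coord1 z) (- coord2 z).
  by apply: A3P => /=; ring.
have -> : (MkA3 (t - coord0 z) (- coord1 z) (- coord2 z))^-1 =
    A3_inv (MkA3 (t - coord0 z) (- coord1 z) (- coord2 z)) by [].
rewrite /A3_inv /A3_unit t0.
by apply: A3P => /=; field.
Qed.

End Hypotheses.

Theorem theorem6 (R : realType) (E : set (A3 R[i])) (a b c : A3 R[i])
  (Omega : set (A3 R[i])) (Phi : A3 R[i] -> A3 R[i])
  (hE : real_subspace 3 E)
  (hfE : @ff R[i] @` E = setT)
  (ha : E a /\ a <> 0) (hb : E b /\ b <> 0) (hc : E c /\ c <> 0)
  (hfa : ff a = 1) (hfb : ff b = 'i) (hfc : ff c = 0)
  (hOmega : domain_in E Omega)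
  (hlines : forall z, E z -> connected (Omega `&` fiber_line E z))
  (hbound : [locally [bounded Phi z | z in Omega]])
  (hPhi : forall z, Omega z -> exists dPhi : A3 R[i],
     forall h, h \in [:: a; - a; b; - b; c; - c] ->
     (delta^-1)%:C *: (Phi (z + delta%:C *: h) - Phi z)
       @[delta --> (0 : R)^'+] --> h * dPhi) :
  exists F0 F1 F2 : R[i] -> R[i],
    [/\ analytic_on (@ff R[i] @` Omega) F0,
        analytic_on (@ff R[i] @` Omega) F1,
        analytic_on (@ff R[i] @` Omega) F2
      & forall z, Omega z -> forall g : R -> R[i],
        closed_rectifiable_jordan g ->
        positively_oriented g ->
        curve_image g `<=` @ff R[i] @` Omega ->
        (forall w, encloses g w -> (@ff R[i] @` Omega) w) ->
        encloses g (ff z) ->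
        exists I : A3 R[i],
          has_curve_integral g
            (fun t => ((F0 t)%:A + F1 t *: rho R[i] + F2 t *: rho R[i] ^+ 2)
                        * (t%:A - z)^-1) I /\
          Phi z = (two_pi_i R)^-1 *: I].
Proof.
have bc := bounded_coords hbound.
have dPhi z : Omega z -> exists d : A3 R[i], forall h, [\/ h = a, h = b | h = c] ->
     [/\ dirder (fun z => coord0 (Phi z)) z h (coord0 (h * d)),
         dirder (fun z => coord1 (Phi z)) z h (coord1 (h * d))
       & dirder (fun z => coord2 (Phi z)) z h (coord2 (h * d))].
  move=> /hPhi[d hd]; exists d => h hh.
  have l1 := hd h; have l2 := hd (- h); rewrite mulNr in l2.
  have i1 : h \in [:: a; - a; b; - b; c; - c].
    by case: hh => ->; rewrite !inE eqxx ?orbT.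
  have i2 : - h \in [:: a; - a; b; - b; c; - c].
    by case: hh => ->; rewrite !inE eqxx ?orbT.
  by split; apply: limits_dirder (l1 i1) (l2 i2) => // e u [].
have [||||F0 [F1 [F2 [hF0 hF1 hF2 hrep]]]] :=
  @monogenic_structure R E a b c Omega hE ha.1 hb.1 hc.1 hc.2 hfa hfb hfc hOmega hlines Phi.
- by move=> z /bc[r [M [r0 h]]]; exists r, M; split=> // w Ow /(h w Ow)[].
- by move=> z /bc[r [M [r0 h]]]; exists r, M; split=> // w Ow /(h w Ow)[].
- by move=> z /bc[r [M [r0 h]]]; exists r, M; split=> // w Ow /(h w Ow)[].
- exact: dPhi.
have oD := open_projection hE ha.1 hb.1 hfa hfb hOmega.
exists F0, F1, F2; split; [exact: hol_analytic|exact: hol_analytic|exact: hol_analytic|].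
move=> z Oz g [wcg g01 _ rg] po gim gin ez.
exists (two_pi_i R *: Phi z); split; last by rewrite scalerA mulVf ?two_pi_i_neq0// scale1r.
have cg := within_curve_continuous wcg.
have gD t : 0 <= t <= 1 -> (@ff R[i] @` Omega) (g t).
  by move=> t01; apply: gim; exists t => //=; rewrite in_itv.
have [E0 E1 E2] := hrep z Oz.
have K F (hF : hol (@ff R[i] @` Omega) F) :=
  cauchy_formula cg rg g01 oD gD hF gin po ez.
have K1 F (hF : hol (@ff R[i] @` Omega) F) :=
  cauchy_formula1 cg rg g01 oD gD hF gin po ez.
have K2 F (hF : hol (@ff R[i] @` Omega) F) :=
  cauchy_formula2 cg rg g01 oD gD hF gin po ez.
have integrand t : 0 <= t <= 1 ->
    ((F0 (g t))%:A + F1 (g t) *: rho R[i] + F2 (g t) *: rho R[i] ^+ 2)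
      * ((g t)%:A - z)^-1 =
    MkA3 (F0 (g t)) (F1 (g t)) (F2 (g t)) *
    MkA3 ((g t - ff z) ^+ 1)^-1 (coord1 z * ((g t - ff z) ^+ 2)^-1)
     (coord2 z * ((g t - ff z) ^+ 2)^-1 + coord1 z ^+ 2 * ((g t - ff z) ^+ 3)^-1).
  move=> t01; rewrite kernel_coords; last first.
    by apply/eqP => e; case: ez => h _; apply: h; exists t => //=; rewrite in_itv.
  by congr (_ * _); rewrite [RHS]A3_basisE.
apply: integral_A3.
- have -> : coord0 (two_pi_i R *: Phi z) = two_pi_i R * F0 (ff z) by rewrite /= E0.
  by apply: integral_ext (K F0 hF0) => t t01; rewrite integrand.
- have -> : coord1 (two_pi_i R *: Phi z) =
      coord1 z * (two_pi_i R * dC F0 (ff z)) + two_pi_i R * F1 (ff z).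
    by rewrite /= E1 /ext1; ring.
  apply: integral_ext (integral_D (integral_Z (coord1 z) (K1 F0 hF0)) (K F1 hF1)).
  by move=> t t01; rewrite integrand //=; ring.
- have -> : coord2 (two_pi_i R *: Phi z) =
      (coord2 z * (two_pi_i R * dC F0 (ff z)) +
       coord1 z ^+ 2 * (two_pi_i R * (dC (dC F0) (ff z) / 2)) +
       coord1 z * (two_pi_i R * dC F1 (ff z))) + two_pi_i R * F2 (ff z).
    by rewrite /= E2 /ext1 /ext2; ring.
  apply: integral_ext (integral_D (integral_D (integral_D
    (integral_Z (coord2 z) (K1 F0 hF0)) (integral_Z (coord1 z ^+ 2) (K2 F0 hF0)))
    (integral_Z (coord1 z) (K1 F1 hF1))) (K F2 hF2)).
  by move=> t t01; rewrite integrand //=; ring.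
Qed.
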